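(* Let $f,w\in C(E)$, assume (A.1) stated in the context for this $f$, and let $\mu(f)>0$. Then $$z(x):=\inf_\tau\mathbb{E}_x\Big\{\int_0^\tau f(X_s)\,ds+w(X_\tau)\Big\}$$ is continuous in $x\in E$, and an optimal stopping time $\tau^*$ is of the form $$\tau^*=\inf\{s\ge0: z(X_s)\ge w(X_s)\}.$$ Furthermore, for any stopping time $\sigma$ and all $x\in E$, $$z(x)=\inf_\tau\mathbb{E}_x\Big\{\int_0^{\tau\wedge\sigma}f(X_s)\,ds+1_{\tau<\sigma}\,w(X_\tau)+1_{\sigma\le\tau}\,z(X_\sigma)\Big\}.$$
   Context: $E$ is a locally compact space with metric $\rho$ and Borel $\sigma$-field. $(X_t)$ is a Feller–Markov process with values in $E$ and right continuous, left limited paths, with filtration $(F_t)$; $\mathbb{P}_x,\mathbb{E}_x$ are the probability and expectation when it starts from $x$. $C(E)$ is the space of bounded continuous functions on $E$, $C_0(E)$ the continuous functions vanishing at infinity. The semigroup $T_th(x)=\mathbb{E}_x\{h(X_t)\}$ maps $C_0(E)$ into itself. (A.1) $(X_t)$ has a unique invariant probability measure $\mu$, and, with $\mu(f)=\int f\,d\mu$, there is a continuous function $q$ on $E$ such that for every bounded stopping time $\tau$, $q(x)=\mathbb{E}_x\{\int_0^\tau(f(X_s)-\mu(f))\,ds+q(X_\tau)\}$; moreover $q$ is bounded from above by a constant $K$ and $(q(X_t))_{t\ge0}$ is uniformly integrable. Convention: infima are over stopping times $\tau$; for possibly unbounded $\tau$ the expectation is understood as the $\liminf_{T\to\infty}$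 of the same expectation with $\tau$ replaced by $\tau\wedge T$, so that the infimum equals the infimum over bounded stopping times.
   Formalization: Two conventions are added: F_0 contains all sets negligible under every P_x (else τ* need not be a stopping time), and the laws of X_t under P_x are tight, automatic for separable E (else z may be discontinuous if real-valued measurable cardinals exist). *)

(* Defs.v *)
From HB Require Import structures.
From mathcomp Require Import all_boot all_order all_algebra.
From mathcomp Require Import all_classical all_reals all_analysis.
From mathcomp Require Import measurable_realfun.

Set Implicit Arguments.
Unset Strict Implicit.
Unset Printing Implicit Defensive.

Import Order.TTheory GRing.Theory Num.Theory.
Import numFieldNormedType.Exports.

Local Open Scope classical_set_scope.
Local Open Scope ring_scope.

(* The library's [measurableType]s are pointed. A space carrying a probability
   measure is nonempty, so pointing E loses nothing. *)
#[short(type="pmetricType")]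
HB.structure Definition PointedMetric (K : numDomainType) :=
  { M of Metric K M & Pointed M }.

Definition borel (T : ptopologicalType) := g_sigma_algebraType (@open T).

Definition bounded_continuous (R : realType) (E : pmetricType R)
    (h : E -> R) : Prop :=
  continuous h /\ bounded_fun h.

Definition vanishing_continuous (R : realType) (E : pmetricType R)
    (h : E -> R) : Prop :=
  continuous h /\
  forall eps : R, 0 < eps ->
    exists2 K : set E, compact K & forall x, ~ K x -> `|h x| < eps.

Definition semigroup (d : measure_display) (Om : measurableType d)
    (R : realType) (E : pmetricType R) (P : E -> probability Om R)
    (X : R -> Om -> E) (t : R) (h : E -> R) (x : E) : R :=
  \int[P x]_om h (X t om).

(* Processes and filtrations are indexed by all of R for convenience; only
   their values at times t >= 0 are ever used. *)
Record is_filtration (d : measure_display) (Om : measurableType d)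
    (R : realType) (F : R -> set (set Om)) : Prop := {
  filtration_sigma : forall t : R, 0 <= t -> sigma_algebra setT (F t) ;
  filtration_sub : forall t : R, 0 <= t -> F t `<=` measurable ;
  filtration_le : forall s t : R, 0 <= s -> s <= t -> F s `<=` F t
}.

Record feller_markov (d : measure_display) (Om : measurableType d)
    (R : realType) (E : pmetricType R) (P : E -> probability Om R)
    (X : R -> Om -> E) (F : R -> set (set Om)) : Prop := {
  fm_filtration : is_filtration F ;
  (* Completeness: without it, the hitting time of a closed set by a right
     continuous process is only almost surely equal to a stopping time. *)
  fm_complete : forall N : set Om, (forall x, (P x).-negligible N) -> F 0 N ;
  fm_adapted : forall t : R, 0 <= t -> forall B : set (borel E), measurable B ->
    F t (X t @^-1` B) ;
  fm_right_continuous : forall om (t : R), 0 <= t ->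
    X s om @[s --> t^'+] --> X t om ;
  fm_left_limits : forall om (t : R), 0 < t ->
    exists l : E, X s om @[s --> t^'-] --> l ;
  fm_start : forall x, P x (X 0 @^-1` [set x]) = 1%E ;
  fm_kernel : forall t : R, 0 <= t -> forall B : set (borel E), measurable B ->
    measurable_fun setT (fun x : borel E => P x (X t @^-1` B)) ;
  (* The laws of X_t are Radon measures, so that they are determined by their
     values on continuous functions vanishing at infinity. This is automatic
     when E is separable, since E is then sigma-compact. *)
  fm_tight : forall x (t : R), 0 <= t -> forall eps : R, 0 < eps ->
    exists2 K : set E, compact K & (P x (X t @^-1` (~` K)) < eps%:E)%E ;
  fm_markov : forall x (s t : R), 0 <= s -> 0 <= t ->
    forall A : set Om, F s A ->
    forall h : borel E -> R, measurable_fun setT h -> bounded_fun h ->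
    \int[P x]_(om in A) h (X (s + t) om) =
    \int[P x]_(om in A) semigroup P X t h (X s om) ;
  fm_feller : forall t : R, 0 <= t -> forall h : E -> R,
    vanishing_continuous h -> vanishing_continuous (semigroup P X t h)
}.

Definition stopping_time (d : measure_display) (Om : measurableType d)
    (R : realType) (F : R -> set (set Om)) (tau : Om -> \bar R) : Prop :=
  (forall om, 0 <= tau om)%E /\
  forall t : R, 0 <= t -> F t [set om | (tau om <= t%:E)%E].

Definition bounded_stopping_time (d : measure_display) (Om : measurableType d)
    (R : realType) (F : R -> set (set Om)) (tau : Om -> \bar R) : Prop :=
  stopping_time F tau /\ exists M : R, forall om, (tau om <= M%:E)%E.

Definition running_cost (R : realType) (Om : Type) (E : Type)
    (X : R -> Om -> E) (f : E -> R) (r : R) (om : Om) : R :=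
  \int[lebesgue_measure]_(s in `[0, r]) f (X s om).

(* The two costs below are only evaluated at finite times r. *)
Definition cost (R : realType) (Om : Type) (E : Type)
    (X : R -> Om -> E) (f w : E -> R) (r : \bar R) (om : Om) : R :=
  running_cost X f (fine r) om + w (X (fine r) om).

Definition cost_until (R : realType) (Om : Type) (E : Type)
    (X : R -> Om -> E) (f w z : E -> R) (sigma : Om -> \bar R)
    (r : \bar R) (om : Om) : R :=
  running_cost X f (fine (Order.min r (sigma om))) om +
  (if (r < sigma om)%E then w (X (fine r) om) else z (X (fine (sigma om)) om)).

(* The expectation of a cost at a possibly unbounded random time tau, as the
   lower limit of its expectations at tau /\ T; for a bounded tau it is the
   expectation at tau. *)
Definition expected_cost (d : measure_display) (Om : measurableType d)
    (R : realType) (Q : probability Om R) (G : \bar R -> Om -> R)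
    (tau : Om -> \bar R) : \bar R :=
  limf_einf
    (fun T : R => ('E_Q[fun om => G (Order.min (tau om) T%:E) om])%E) +oo.

Definition inf_expected_cost (d : measure_display) (Om : measurableType d)
    (R : realType) (F : R -> set (set Om)) (Q : probability Om R)
    (G : \bar R -> Om -> R) : \bar R :=
  ereal_inf [set expected_cost Q G tau | tau in stopping_time F].

Definition value (d : measure_display) (Om : measurableType d)
    (R : realType) (E : pmetricType R) (P : E -> probability Om R)
    (X : R -> Om -> E) (F : R -> set (set Om)) (f w : E -> R) (x : E) : \bar R :=
  inf_expected_cost F (P x) (cost X f w).

Definition hitting_time (R : realType) (Om : Type) (E : Type)
    (X : R -> Om -> E) (D : set E) (om : Om) : \bar R :=
  ereal_inf [set s%:E | s in [set s : R | 0 <= s /\ D (X s om)]].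

Definition invariant (d : measure_display) (Om : measurableType d)
    (R : realType) (E : pmetricType R) (P : E -> probability Om R)
    (X : R -> Om -> E) (mu : probability (borel E) R) : Prop :=
  forall t : R, 0 <= t -> forall B : set (borel E), measurable B ->
    (\int[mu]_x P x (X t @^-1` B))%E = mu B.

Definition mean (R : realType) (E : pmetricType R)
    (mu : probability (borel E) R) (f : E -> R) : R :=
  \int[mu]_x f x.

Definition sup_tail_expectation (d : measure_display)
    (Om : measurableType d) (R : realType) (Q : probability Om R)
    (Y : R -> Om -> R) (c : R) : \bar R :=
  ereal_sup
    [set (\int[Q]_(om in [set om | (c < `|Y t om|)%R]) `|Y t om|%:E)%E
    | t in [set t : R | 0 <= t]].

Definition uniformly_integrable (d : measure_display) (Om : measurableType d)
    (R : realType) (Q : probability Om R) (Y : R -> Om -> R) : Prop :=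
  sup_tail_expectation Q Y c @[c --> +oo] --> (0 : \bar R)%E.

Record assumption_A1 (d : measure_display) (Om : measurableType d)
    (R : realType) (E : pmetricType R) (P : E -> probability Om R)
    (X : R -> Om -> E) (F : R -> set (set Om)) (f : E -> R)
    (mu : probability (borel E) R) : Prop := {
  A1_invariant : invariant P X mu ;
  A1_unique : forall nu : probability (borel E) R, invariant P X nu ->
    forall B, measurable B -> nu B = mu B ;
  A1_potential : exists q : E -> R, [/\ continuous q,
    (forall tau, bounded_stopping_time F tau -> forall x,
      (q x)%:E =
      'E_(P x)[fun om => cost X (fun y => (f y - mean mu f)%R) q (tau om) om])%E,
    (exists K : R, forall x, q x <= K) &
    forall x, uniformly_integrable (P x) (fun t om => q (X t om))]
}.

(* Main.v *)
Require Import Defs.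
From mathcomp Require Import all_boot all_order all_algebra.
From mathcomp Require Import all_classical all_reals all_analysis.
From mathcomp Require Import measurable_realfun.
From mathcomp Require Import ring lra.

Set Implicit Arguments.
Unset Strict Implicit.
Unset Printing Implicit Defensive.

Import Order.TTheory GRing.Theory Num.Theory.
Import numFieldNormedType.Exports.

Local Open Scope classical_set_scope.
Local Open Scope ring_scope.

(** The potential q turns the running cost into a clock. For a bounded stopping
    time tau and m = mu(f), the cost at tau is
      q(x) + E_x (m tau + (w - q)(X_tau))
    (payoff_rep). Since q is bounded above and w is bounded, w - q is bounded
    below, so m > 0 bounds the expected duration of every near-optimal tau,
    locally uniformly in x, and uniform integrability of q(X_t) allows tau to be
    cut at a fixed horizon at a small expense (cut_horizon).

    Continuity. Let W n N be the result of N steps of dynamic programming with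
    time step 2^-n: the optimal cost among stopping times with values on the
    dyadic grid of level n, up to time N 2^-n. Each W n N is continuous, because
    the semigroup preserves bounded continuous functions, and is at least z. It
    remains to see that some W n N exceeds z by at most eps on a whole
    neighbourhood of x (W_approx), that is, that rounding a stopping time up to
    the grid changes the expectation of w(X) little, uniformly in the starting
    point near x (rounding_error). This rests on two properties of Feller
    processes: T_t h tends to h uniformly on compact sets as t tends to 0, even
    if h does not vanish at infinity (semigroup_compact_uniform), and, up to a
    fixed horizon, the process stopped at a grid time stays in one compact set
    with probability close to 1, uniformly in the starting point near x
    (compact_containment). Both come from resolvents v, for which
    exp (-a t) T_t v decreases in t.

    Optimality. The submartingale inequality z(x) <= E_x (cost of running up to
    tau, plus z(X_tau)) is inherited from W (rvalue_submartingale). The converse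
    holds up to the first contact of z with w (payoff_before_contact): the grid
    processes are martingales until their own first contact, and Fatou's lemma
    passes to the limit, provided that the path does not come close to the
    contact set just before a time at which it jumps away from it. Such jumps
    have probability zero by quasi-left-continuity (quasi_left_continuity), and
    the same fact shows that tau* is a stopping time (hitting_stopping).
    Replacing z by w at the end of the run costs only the part of (w - z)(X_T)
    on which neither tau* nor sigma has occurred before T, and this vanishes as
    T grows, because tau* /\ sigma has finite expectation
    (cost_until_contact_le). The case of an infinite sigma is the optimality of
    tau*, the general case is the dynamic programming principle. *)

(** * Expectations *)

Section expectation.
Context {d : measure_display} {Om : measurableType d} {R : realType}.
Variable Q : probability Om R.
Implicit Types (Y Z : Om -> R) (A : set Om) (c : R).

Definition expect Y : R := \int[Q]_om Y om.

Definition summable_rv Y : Prop := Q.-integrable setT (EFin \o Y).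

Definition bounded_rv Y : Prop :=
  measurable_fun setT Y /\ exists M : R, forall om, `|Y om| <= M.

Lemma summable_measurable Y : summable_rv Y -> measurable_fun setT Y.
Proof. by move=> /measurable_int /measurable_EFinP. Qed.

Lemma summable_le Y Z : measurable_fun setT Y -> summable_rv Z ->
  (forall om, `|Y om| <= Z om) -> summable_rv Y.
Proof.
move=> mY iZ YZ; apply: le_integrable iZ => //; first exact/measurable_EFinP.
by move=> om _ /=; rewrite lee_fin (le_trans (YZ om))// ler_norm.
Qed.

Lemma summable_cst c : summable_rv (fun=> c).
Proof. by apply: finite_measure_integrable_cst. Qed.

Lemma bounded_summable Y : bounded_rv Y -> summable_rv Y.
Proof. by move=> [mY [M YM]]; exact: summable_le mY (summable_cst M) YM. Qed.

Lemma summableD Y Z : summable_rv Y -> summable_rv Z ->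
  summable_rv (fun om => Y om + Z om).
Proof. by move=> iY iZ; exact: (integrableD _ iY iZ). Qed.

Lemma summableB Y Z : summable_rv Y -> summable_rv Z ->
  summable_rv (fun om => Y om - Z om).
Proof. by move=> iY iZ; exact: (integrableB _ iY iZ). Qed.

Lemma summableZ c Y : summable_rv Y -> summable_rv (fun om => c * Y om).
Proof. by move=> iY; exact: (integrableZl _ c iY). Qed.

Lemma summable_indicM A Y : measurable A -> summable_rv Y ->
  summable_rv (fun om => \1_A om * Y om).
Proof.
move=> mA iY; apply: (@summable_le _ (fun om => `|Y om|)).
- by apply: measurable_funM => //; exact: summable_measurable.
- exact: integrable_norm.
- by move=> om; rewrite normrM ler_piMl// ger0_norm // indicE lern1; case: (_ \in _).
Qed.

Lemma expectD Y Z : summable_rv Y -> summable_rv Z ->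
  expect (fun om => Y om + Z om) = expect Y + expect Z.
Proof. by move=> iY iZ; exact: RintegralD. Qed.

Lemma expectB Y Z : summable_rv Y -> summable_rv Z ->
  expect (fun om => Y om - Z om) = expect Y - expect Z.
Proof. by move=> iY iZ; exact: RintegralB. Qed.

Lemma expectZ c Y : summable_rv Y ->
  expect (fun om => c * Y om) = c * expect Y.
Proof. by move=> iY; exact: RintegralZl. Qed.

Lemma expect_cst c : expect (fun=> c) = c.
Proof. by rewrite /expect Rintegral_cst//= probability_setT mulr1. Qed.

Lemma expect_le Y Z : summable_rv Y -> summable_rv Z ->
  (forall om, Y om <= Z om) -> expect Y <= expect Z.
Proof. by move=> iY iZ YZ; apply: le_Rintegral. Qed.

Lemma expect_ge0 Y : (forall om, 0 <= Y om) -> 0 <= expect Y.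
Proof. by move=> Y0; apply: Rintegral_ge0. Qed.

Lemma expect_ext Y Z : (forall om, Y om = Z om) -> expect Y = expect Z.
Proof. by move=> YZ; congr expect; apply/funext. Qed.

Lemma expect_ge_cst Y c : summable_rv Y -> (forall om, c <= Y om) ->
  c <= expect Y.
Proof.
by move=> iY Yc; rewrite -(expect_cst c) expect_le//; exact: summable_cst.
Qed.

Lemma expect_abs Y Z : measurable_fun setT Y -> summable_rv Z ->
  (forall om, `|Y om| <= Z om) -> `|expect Y| <= expect Z.
Proof.
move=> mY iZ YZ; have iY := summable_le mY iZ YZ.
apply: le_trans (le_normr_Rintegral measurableT iY) _.
by apply: expect_le => //; exact: integrable_norm.
Qed.

Lemma EFin_expect Y : summable_rv Y -> (expect Y)%:E = 'E_Q[Y]%E.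
Proof.
move=> iY; rewrite unlock /expect /Rintegral fineK//.
exact: integrable_fin_num.
Qed.

Lemma expect_on A Y : expect (fun om => \1_A om * Y om) = \int[Q]_(om in A) Y om.
Proof.
rewrite Rintegral_mkcond; apply: expect_ext => om.
by rewrite patchE indicE; case: ifP => _; rewrite ?mul1r ?mul0r.
Qed.

Lemma summable_sum n (Y : nat -> Om -> R) :
  (forall i, (i < n)%N -> summable_rv (Y i)) ->
  summable_rv (fun om => \sum_(0 <= i < n) Y i om).
Proof.
elim: n => [|n IHn] iY.
  rewrite (_ : (fun _ => _) = (fun=> 0 : R)); first exact: summable_cst.
  by apply/funext => om; rewrite big_geq.
rewrite (_ : (fun _ => _) = (fun om => \sum_(0 <= i < n) Y i om + Y n om)).
  by apply: summableD; [apply: IHn => i /ltnW; exact: iY|exact: iY].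
by apply/funext => om; rewrite big_nat_recr.
Qed.

Lemma expect_sum n (Y : nat -> Om -> R) :
  (forall i, (i < n)%N -> summable_rv (Y i)) ->
  expect (fun om => \sum_(0 <= i < n) Y i om) = \sum_(0 <= i < n) expect (Y i).
Proof.
elim: n => [|n IHn] iY.
  rewrite [RHS]big_geq// -[RHS](expect_cst 0); apply: expect_ext => om.
  by rewrite big_geq.
have iYn i : (i < n)%N -> summable_rv (Y i) by move=> /ltnW; exact: iY.
rewrite big_nat_recr//= -IHn// -expectD//; last 2 first.
- exact: summable_sum.
- exact: iY.
by apply: expect_ext => om; rewrite big_nat_recr.
Qed.

Lemma expect_dominated (Y_ : nat -> Om -> R) Y Z :
  (forall n, measurable_fun setT (Y_ n)) -> summable_rv Z ->
  (forall n om, `|Y_ n om| <= Z om) ->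
  (forall om, Y_ n om @[n --> \oo] --> Y om) ->
  summable_rv Y /\ expect (Y_ n) @[n --> \oo] --> expect Y.
Proof.
move=> mY iZ YZ cY.
have mYl : measurable_fun setT Y by apply: measurable_fun_cvg mY _ => om _.
have iY : summable_rv Y.
  apply: summable_le mYl iZ _ => om.
  have cn : `|Y_ n om| @[n --> \oo] --> `|Y om| by exact: cvg_norm.
  by apply: (cvgr_to_le cn); apply: nearW => n; exact: YZ.
split=> //.
have iYn n : summable_rv (Y_ n) by exact: summable_le (mY n) iZ (YZ n).
apply: fine_cvg; rewrite /expect /Rintegral fineK; last exact: integrable_fin_num.
apply: (@dominated_cvg _ _ _ Q setT measurableT _ _ (EFin \o Z)) => //=.
- by move=> n; exact/measurable_EFinP.
- by move=> om _; apply: cvg_EFin; [exact: nearW|exact: cY].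
- by move=> n om _; rewrite lee_fin YZ.
Qed.

Lemma expect_negligible (N : set Om) Y : measurable N -> Q N = 0 ->
  summable_rv Y -> expect (fun om => \1_(~` N) om * Y om) = expect Y.
Proof.
move=> mN N0 iY; rewrite /expect /Rintegral; congr fine.
apply: ae_eq_integral => //.
- apply/measurable_EFinP; apply: measurable_funM; last exact: summable_measurable.
  by apply: measurable_indic; exact: measurableC.
- by apply/measurable_EFinP; exact: summable_measurable.
- exists N; split => // om /= nh; apply: contrapT => Nom; apply: nh => _.
  by rewrite indicE mem_set//= mul1r.
Qed.

Lemma summable_min Y Z : summable_rv Y -> summable_rv Z ->
  summable_rv (fun om => Num.min (Y om) (Z om)).
Proof.
move=> iY iZ; apply: (@summable_le _ (fun om => `|Y om| + `|Z om|)).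
- by apply: measurable_minr; exact: summable_measurable.
- by apply: summableD; exact: integrable_norm.
- move=> om; have [_|_] := leP (Y om) (Z om); first by rewrite lerDl.
  by rewrite lerDr.
Qed.

(** Fatou's lemma off a null set, phrased without lower limits: dominated
    convergence applies to min(Y_n, Y) - Y, which lies between -|Y| - |D| and 0. *)
Lemma expect_fatou (N : set Om) (Y_ : nat -> Om -> R) Y D (c_ : nat -> R) c :
  measurable N -> Q N = 0 ->
  (forall n, summable_rv (Y_ n)) -> summable_rv Y ->
  (forall n om, D <= Y_ n om) ->
  (forall om, ~ N om -> forall eps, 0 < eps ->
     \forall n \near \oo, Y om - eps <= Y_ n om) ->
  (forall n, expect (Y_ n) <= c_ n) -> c_ n @[n --> \oo] --> c ->
  expect Y <= c.
Proof.
move=> mN N0 iY_ iY DY liminfY Ec cc.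
pose V n om := Num.min (Y_ n om) (Y om) - Y om.
have iV n : summable_rv (V n).
  by apply: summableB => //; exact: summable_min.
have [_] : summable_rv (fun _ : Om => 0 : R) /\
    expect (fun om => \1_(~` N) om * V n om) @[n --> \oo] --> expect (fun=> 0).
  apply: (@expect_dominated _ _ (fun om => `|Y om| + `|D|)).
- move=> n; apply: measurable_funM; last exact: summable_measurable.
  by apply: measurable_indic; exact: measurableC.
- by apply: summableD; [exact: integrable_norm|exact: summable_cst].
- move=> n om; rewrite normrM (@le_trans _ _ `|V n om|)//.
    by rewrite ler_piMl// indicE; case: (_ \in _); rewrite ?normr1 ?normr0.
  have := DY n om; have := ler_norm (Y om); have := ler_norm (- D).
  have := normr_ge0 (Y om); have := normr_ge0 D.
  rewrite /V normrN ler_norml; have [le1|lt1] := leP (Y_ n om) (Y om).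
    by move=> *; apply/andP; split; lra.
  by move=> *; apply/andP; split; lra.
- move=> om; have [Nom|nN] := pselect (N om).
    rewrite indicE memNset/=; last by apply.
    by under eq_fun do rewrite mul0r; exact: cvg_cst.
  rewrite indicE mem_set//=; under eq_fun do rewrite mul1r.
  apply/cvgrPdist_le => e e0; have := liminfY om nN e e0.
  apply: filterS => n Ye; rewrite sub0r normrN /V.
  have [le1|le1] := leP (Y_ n om) (Y om); last by rewrite subrr normr0 ltW.
  by rewrite ler0_norm ?subr_le0// opprB; lra.
rewrite expect_cst => V0.
have cv : c_ n - expect (fun om => \1_(~` N) om * V n om) @[n --> \oo] --> c - 0.
  exact: cvgB.
rewrite -(subr0 c); apply: (cvgr_to_ge cv); apply: nearW => n.
rewrite expect_negligible// lerBrDr.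
apply: le_trans (Ec n); rewrite /V expectB//; last exact: summable_min.
rewrite addrC subrK; apply: expect_le => //; first exact: summable_min.
by move=> om; rewrite ge_min lexx.
Qed.

End expectation.

(** * Compact sets of a locally compact metric space *)

Section locally_compact_metric.
Context {R : realType} {E : pmetricType R}.

(** Continuity at x can be tested on sequences, as x has a countable basis of
    neighbourhoods; this lets dominated convergence prove continuity of
    integrals in a parameter. *)
Lemma seq_continuousP (h : E -> R) (x : E) :
  (forall u : nat -> E, u n @[n --> \oo] --> x ->
    h (u n) @[n --> \oo] --> h x) ->
  h y @[y --> x] --> h x.
Proof.
move=> hu; apply/cvgrPdist_lt => e e0; apply: contrapT => nh.
have far n : exists y, ball x n.+1%:R^-1 y /\ e <= `|h x - h y|.
  apply: contrapT => nex; apply: nh.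
  have n0 : 0 < n.+1%:R^-1 :> R by rewrite invr_gt0.
  near=> y; rewrite ltNge; apply/negP => ley; apply: nex; exists y; split => //.
  by near: y; exact: nbhsx_ballx.
have [u uP] := choice far.
have ux : u n @[n --> \oo] --> x.
  apply/cvg_ballP => r r0; near=> n.
  apply: (@le_ball _ _ _ n.+1%:R^-1); last exact: (uP n).1.
  by apply: ltW; near: n; exact: near_infty_natSinv_lt (PosNum r0).
have /cvgrPdist_lt /(_ e e0) [N _ /(_ N (leqnn N)) /=] := hu u ux.
by rewrite ltNge (uP N).2.
Unshelve. all: by end_near. Qed.

Hypothesis lcE : locally_compact [set: E].

Lemma point_compact_nbhs (x : E) : exists2 U, nbhs x U & compact U.
Proof.
have [U xU [cU _]] := @lcE x I; exists U => //.
apply: (@filterS _ (nbhs x) _ [set y | [set: E] y -> U y]) => //.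
by move=> y /(_ I).
Qed.

Lemma compact_compact_nbhs (K : set E) : compact K ->
  exists2 K', compact K' & forall x, K x -> nbhs x K'.
Proof.
move=> cK.
pose G := filter_from (@compact E) (fun C => [set K' | compact K' /\ C `<=` K']).
have fG : Filter G.
  apply: filter_from_filter; first by exists set0; exact: compact0.
  move=> A B cA cB; exists (A `|` B); first exact: compactU.
  by move=> K' /= [cK']; rewrite subUset => -[AK BK].
have [] := (iffLR (compact_near_coveringP K) cK) _ G (fun K' x => nbhs x K') fG.
  move=> x Kx; have [U xU cU] := point_compact_nbhs x.
  exists (interior U, [set K' | compact K' /\ U `<=` K']).
    by split; [exact: nbhs_interior|exists U].
  by move=> [y K'] /= [Uy [_ UK']]; exact: filterS UK' Uy.
by move=> C cC CK; exists C => // x Kx; exact: (CK C (conj cC (@subset_refl _ C)) x Kx).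
Qed.

Lemma compact_bump (K : set E) : compact K ->
  exists phi : E -> R, [/\ continuous phi, forall x, 0 <= phi x <= 1,
    forall x, K x -> phi x = 1 &
    exists2 K', compact K' & forall x, ~ K' x -> phi x = 0].
Proof.
move=> cK; have [K' cK' KK'] := compact_compact_nbhs cK.
have clK : closed K by apply: compact_closed cK; exact: metric_hausdorff.
have sep : uniform_separator (~` interior K') K.
  apply: (iffLR (@normal_separatorP R E) (@pseudometric_normal R E)).
  - by apply: open_closedC; exact: open_interior.
  - exact: clK.
  - by apply/seteqP; split=> // x [nx Kx]; apply: nx; exact: KK'.
exists (Urysohn (R := R) (~` interior K') K); split.
- exact: Urysohn_continuous.
- move=> x; have := @Urysohn_range E R (~` interior K') K (Urysohn (R := R) (~` interior K') K x).
  by rewrite /= in_itv/=; apply; exists x.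
- move=> x Kx; have := @Urysohn_sub1 E R _ _ sep.
  by move=> /(_ (Urysohn (R := R) (~` interior K') K x)); apply; exists x.
- exists K' => // x nK'x; have := @Urysohn_sub0 E R _ _ sep.
  move=> /(_ (Urysohn (R := R) (~` interior K') K x)); apply; exists x => //.
  by move/interior_subset.
Qed.

(** A countable union of compact sets lies in the interiors of an increasing
    sequence of compact sets, so each compact subset of the union is absorbed
    by that sequence. Vanishing at infinity can then be tested on one sequence
    of points, even though E need not be sigma-compact. *)
Lemma compact_exhaustion (S : nat -> set E) : (forall n, compact (S n)) ->
  exists K : nat -> set E, (forall n, compact (K n)) /\
    forall C, compact C -> C `<=` \bigcup_n S n ->
      exists N, forall n, (N <= n)%N -> C `<=` K n.
Proof.
move=> cS.
have next (A : {A : set E | compact A}) (n : nat) :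
    {A' : set E | compact A' & forall x, (sval A `|` S n) x -> nbhs x A'}.
  apply: cid2; apply: compact_compact_nbhs; apply: compactU => //.
  by case: A.
pose step A n : {A : set E | compact A} := let: exist2 A' c _ := next A n in exist _ A' c.
pose K := fix K n : {A : set E | compact A} :=
  if n is m.+1 then step (K m) n else step (exist _ set0 (@compact0 E)) 0%N.
have stepP A n x : (sval A `|` S n) x -> nbhs x (sval (step A n)).
  by rewrite /step; case: (next A n) => A' cA' /= /(_ x); apply.
have nS n x : S n x -> nbhs x (sval (K n)).
  by case: n => [|n] Sx /=; apply: stepP; right.
have nK n x : sval (K n) x -> nbhs x (sval (K n.+1)).
  by move=> Kx /=; apply: stepP; left.
have Kmono m n : (m <= n)%N -> sval (K m) `<=` sval (K n).
  move=> /subnK <-; elim: (n - m)%N => [//|k IHk] x /IHk /nK.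
  exact: nbhs_singleton.
exists (fun n => sval (K n)); split => [n|C cC CS]; first by case: (K n).
have [] := (iffLR (compact_near_coveringP C) cC) _ \oo (fun n x => sval (K n) x) _.
  move=> x /CS [n _ /nS xKn]; exists (sval (K n), [set m | (n <= m)%N]) => /=.
    by split=> //; exists n.
  by move=> [y m] /= [Ky nm]; exact: Kmono nm _ Ky.
by move=> N _ NC; exists N => n Nn; exact: NC.
Qed.

End locally_compact_metric.

(** * Dyadic times *)

Section dyadic_rounding.
Context {R : realType}.
Implicit Types (s t : R) (n j : nat).

Definition mesh n : R := (2 ^+ n)^-1.
Definition grid n j : R := j%:R * mesh n.
(** The index of the first point of the grid of level n strictly after t. With
    strict inequality, rounding up turns an optional time into a stopping
    time. *)
Definition up n t : nat := (Num.truncn (t * 2 ^+ n)).+1.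
Definition rd n t : R := grid n (up n t).

Lemma mesh_gt0 n : 0 < mesh n.
Proof. by rewrite invr_gt0 exprn_gt0. Qed.

Lemma mesh_cvg : mesh n @[n --> \oo] --> 0.
Proof.
apply/cvgrPdist_lt => e e0; near=> n.
rewrite sub0r normrN ger0_norm ?(ltW (mesh_gt0 n))// -[X in X < _]div1r.
by near: n; exact: (near_infty_natSinv_expn_lt (PosNum e0)).
Unshelve. all: by end_near. Qed.

Lemma grid_ge0 n j : 0 <= grid n j.
Proof. by rewrite mulr_ge0// ltW// mesh_gt0. Qed.

Lemma gridS n j : grid n j.+1 = grid n j + mesh n.
Proof. by rewrite /grid -natr1 mulrDl mul1r. Qed.

Lemma gridD n i j : grid n (i + j) = grid n i + grid n j.
Proof. by rewrite /grid natrD mulrDl. Qed.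

Lemma ler_grid n i j : (grid n i <= grid n j) = (i <= j)%N.
Proof. by rewrite /grid ler_pM2r ?mesh_gt0// ler_nat. Qed.

Lemma ltr_grid n i j : (grid n i < grid n j) = (i < j)%N.
Proof. by rewrite /grid ltr_pM2r ?mesh_gt0// ltr_nat. Qed.

Lemma mesh_refine n m : mesh n = (2 ^ m)%:R * mesh (n + m).
Proof.
by rewrite /mesh exprD natrX invfM [RHS]mulrC -mulrA mulVf ?mulr1// expf_neq0.
Qed.

Lemma grid_refine n m j : grid n j = grid (n + m) (j * 2 ^ m).
Proof. by rewrite /grid natrM -mulrA -mesh_refine. Qed.

Lemma grid_int n k : grid n (k * 2 ^ n) = k%:R.
Proof. by rewrite /grid /mesh natrM natrX mulfK// expf_neq0. Qed.

Lemma up_le n t j : 0 <= t -> (up n t <= j)%N = (t < grid n j).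
Proof.
move=> t0; rewrite /up truncn_lt_nat; last by rewrite mulr_ge0// exprn_ge0.
by rewrite /grid ltr_pdivlMr// exprn_gt0.
Qed.

Lemma rd_gt n t : 0 <= t -> t < rd n t.
Proof. by move=> t0; rewrite /rd -up_le. Qed.

Lemma rd_ge n t : 0 <= t -> t <= rd n t.
Proof. by move=> t0; rewrite ltW// rd_gt. Qed.

Lemma rd_le n t : 0 <= t -> rd n t <= t + mesh n.
Proof.
move=> t0; rewrite /rd /up gridS lerD2r leNgt -up_le//.
by rewrite /up ltnn.
Qed.

Lemma rd_cvg t : 0 <= t -> rd n t @[n --> \oo] --> t.
Proof.
move=> t0; apply: (@squeeze_cvgr _ _ _ _ (fun=> t) (fun n => t + mesh n)).
- by apply: nearW => n; rewrite rd_ge// rd_le.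
- exact: cvg_cst.
- by rewrite -[X in _ --> X]addr0; apply: cvgD; [exact: cvg_cst|exact: mesh_cvg].
Qed.

Lemma up_eq n t j : 0 <= t ->
  (up n t == j.+1) = (grid n j <= t < grid n j.+1).
Proof.
by move=> t0; rewrite eqn_leq up_le// ltnNge up_le// -leNgt andbC.
Qed.

Lemma round_up_bounds n l j :
  0 <= grid n (j %/ 2 ^ l).+1 - grid (n + l) j <= mesh n.
Proof.
rewrite (grid_refine n l) subr_ge0 ler_grid ltnW ?ltn_ceil ?expn_gt0//=.
have -> : mesh n = grid (n + l) (2 ^ l).
  by rewrite -[X in grid _ X]mul1n -grid_refine /grid mul1r.
by rewrite lerBlDr addrC -gridD ler_grid mulSn addnC leq_add2r leq_divM.
Qed.

End dyadic_rounding.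

(** * Joint measurability and translation in time *)

Section time_integral.
Context {R : realType} {d : measure_display} {Om : measurableType d}.
Local Notation leb := (@lebesgue_measure R).

(** A right continuous process is the limit of its values at rd n s, which are
    jointly measurable because they are constant in s on the grid intervals.
    Negative times are sent to 0 since nothing is known of the process there. *)
Lemma rc_jointly_measurable (G : R -> Om -> R) :
  (forall s, 0 <= s -> measurable_fun setT (G s)) ->
  (forall s om, 0 <= s -> G (rd n s) om @[n --> \oo] --> G s om) ->
  measurable_fun (setT : set (measurableTypeR R * Om))
    (fun p => if 0 <= p.1 then G p.1 p.2 else 0).
Proof.
move=> mG cG.
pose H n (p : measurableTypeR R * Om) := if 0 <= p.1 then G (rd n p.1) p.2 else 0.
apply: (@measurable_fun_cvg _ _ _ _ H); last first.
  move=> [s om] _ /=; rewrite /H /=; case: ifPn => s0; last exact: cvg_cst.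
  exact: cG.
move=> n.
pose D j : set (measurableTypeR R * Om) :=
  if j is i.+1 then [set` `[grid n i, grid n i.+1[ ] `*` setT
  else [set` `]-oo, 0[] `*` setT.
have DT : \bigcup_j D j = setT.
  apply/seteqP; split => // -[s om] _.
  have [s0|s0] := leP 0 s.
    exists (up n s) => //; rewrite /D; case E : (up n s) => [//|i].
    by split => //=; rewrite in_itv/= -up_eq// E.
  by exists 0%N => //; split => //=; rewrite in_itv.
rewrite -DT; apply/measurable_fun_bigcup => [j|j].
  by case: j => [|i] /=; apply: measurableX => //; exact: measurable_itv.
case: j => [|i] /=.
  apply: (@eq_measurable_fun _ _ _ R _ (fun=> 0)); last exact: measurable_cst.
  by move=> [s om]; rewrite inE/= in_itv/= => -[s0 _]; rewrite /H/= leNgt s0.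
apply: (@eq_measurable_fun _ _ _ R _ (fun p => G (grid n i.+1) p.2)).
  move=> [s om]; rewrite inE/= in_itv/= => -[sgrid _].
  have s0 : 0 <= s by case/andP: sgrid => + _; apply: le_trans; exact: grid_ge0.
  by rewrite /H/= s0 /rd; move: sgrid; rewrite -up_eq// => /eqP ->.
apply: measurable_funTS.
apply: (measurableT_comp (mG _ (grid_ge0 n i.+1))) => //.
Qed.

Lemma lebesgue_measure_shift (a : R) (A : set (measurableTypeR R)) :
  measurable A -> pushforward leb (fun s : measurableTypeR R => s + a) A = leb A.
Proof.
move=> mA; symmetry.
have mphi : measurable_fun setT (fun s : measurableTypeR R => (s + a) : measurableTypeR R).
  by apply: measurable_funD.
apply: (@lebesgue_measure_unique R (measure_function_pushforward__canonical__measure_function_Measure leb mphi)) => // _ [[u v]] _ <-.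
rewrite /= /pushforward (_ : _ @^-1` _ = [set` `]u - a, v - a]]); last first.
  apply/seteqP; split => s /=; rewrite !in_itv/=.
    by rewrite ltrBlDr lerBrDr.
  by rewrite ltrBlDr lerBrDr.
rewrite !lebesgue_measure_itv/= !lte_fin ltrD2r.
by case: ifP => // _; rewrite -!EFinD; congr (_%:E); ring.
Qed.

Lemma Rintegral_shift (a : R) (g : R -> R) :
  leb.-integrable setT (EFin \o (fun s => g (s + a))) ->
  measurable_fun setT g ->
  \int[leb]_s g (s + a) = \int[leb]_s g s.
Proof.
move=> ig mg; rewrite /Rintegral; congr fine.
have mphi : measurable_fun setT (fun s : measurableTypeR R => (s + a) : measurableTypeR R).
  exact: measurable_funD.
have := @integral_pushforward _ _ (measurableTypeR R) (measurableTypeR R) R _ mphi leb setT (EFin \o g) _ _ measurableT.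
rewrite preimage_setT => <- //; last exact/measurable_EFinP.
apply: (@eq_measure_integral _ _ _ setT leb
  (measure_function_pushforward__canonical__measure_function_Measure leb mphi)).
by move=> A mA _; exact: lebesgue_measure_shift.
Qed.

End time_integral.

(** * Weighted time integrals *)

Section weighted_integral.
Context {R : realType}.
Local Notation leb := (@lebesgue_measure R).
Implicit Types (s t a M : R) (rho g : R -> R).

(** Weights are supported in the nonnegative times, so that one integral over the
    whole line serves for the running cost and for the resolvent. *)
Definition weight rho : Prop :=
  [/\ forall s, 0 <= rho s, forall s, s < 0 -> rho s = 0 &
      leb.-integrable setT (EFin \o rho)].

Definition wint rho g : R := \int[leb]_s (rho s * g s).

(** Right continuity is only asked along the dyadic approximations rd n s, which
    is what measurability and the passage to the limit use. *)
Definition rc_bounded g M : Prop :=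
  (forall s, 0 <= s -> g (rd n s) @[n --> \oo] --> g s) /\
  (forall s, 0 <= s -> `|g s| <= M).

Let pos g s := if 0 <= s then g s else 0.

Variable rho : R -> R.
Hypothesis wrho : weight rho.

Let rho_pos g s : rho s * g s = rho s * pos g s.
Proof.
have [_ rho0 _] := wrho; rewrite /pos; case: ifPn => //; rewrite -ltNge => s0.
by rewrite rho0// !mul0r.
Qed.

Let pos_measurable g : (forall s, 0 <= s -> g (rd n s) @[n --> \oo] --> g s) ->
  measurable_fun (setT : set (measurableTypeR R)) (pos g).
Proof.
move=> cg.
have mG := @rc_jointly_measurable R _ (measurableTypeR R) (fun s _ => g s)
  (fun s ps => measurable_cst _) (fun s _ ps => cg s ps).
exact: (measurableT_comp mG (measurable_fun_pair (@measurable_id _ _ setT)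
  (@measurable_cst _ _ _ _ setT (0 : measurableTypeR R)))).
Qed.

Lemma weight_measurable : measurable_fun (setT : set (measurableTypeR R)) rho.
Proof. by have [_ _ /measurable_int /measurable_EFinP] := wrho. Qed.

Let rhog_measurable g : (forall s, 0 <= s -> g (rd n s) @[n --> \oo] --> g s) ->
  measurable_fun (setT : set (measurableTypeR R)) (fun s => rho s * g s).
Proof.
move=> /pos_measurable mg; under eq_fun do rewrite rho_pos.
by apply: measurable_funM => //; exact: weight_measurable.
Qed.

Let rho_bound g M : (forall s, 0 <= s -> `|g s| <= M) ->
  forall s, `|rho s * g s| <= M * rho s.
Proof.
move=> gM s; have [rho_ge0 rho0 _] := wrho.
have [s0|s0] := leP 0 s; last by rewrite rho0// mul0r mulr0 normr0.
by rewrite normrM (ger0_norm (rho_ge0 s)) mulrC ler_wpM2r// gM.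
Qed.

Let Mrho_integrable M : leb.-integrable setT (EFin \o (fun s => M * rho s)).
Proof. by have [_ _ irho] := wrho; exact: (integrableZl _ M irho). Qed.

Lemma wint_integrable g M : rc_bounded g M ->
  leb.-integrable setT (EFin \o (fun s => rho s * g s)).
Proof.
move=> [cg gM]; apply: le_integrable (Mrho_integrable M) => //.
  by apply/measurable_EFinP; exact: rhog_measurable.
move=> s _ /=; rewrite lee_fin (le_trans (rho_bound gM s))//.
exact: ler_norm.
Qed.

Lemma wintZ c g M : rc_bounded g M ->
  wint rho (fun s => c * g s) = c * wint rho g.
Proof.
move=> bg; rewrite /wint -RintegralZl//; last exact: wint_integrable bg.
by apply: eq_Rintegral => s _; rewrite mulrCA.
Qed.

Lemma rc_boundedZ c g M : `|c| <= 1 -> rc_bounded g M ->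
  rc_bounded (fun s => c * g s) M.
Proof.
move=> c1 [cg gM]; split=> s s0; first by apply: cvgMl_tmp; exact: cg.
by rewrite normrM (le_trans _ (gM s s0))// ler_piMl.
Qed.

Lemma wint_bound g M : rc_bounded g M -> `|wint rho g| <= M * wint rho (fun=> 1).
Proof.
move=> bg; apply: le_trans (le_normr_Rintegral measurableT (wint_integrable bg)) _.
rewrite /wint -RintegralZl//; last first.
  by apply: (@wint_integrable _ 1); split => [s s0|s _]; [exact: cvg_cst|rewrite normr1].
apply: le_Rintegral => //.
- by apply: integrable_norm => //; exact: wint_integrable bg.
- by have := Mrho_integrable M; congr (_.-integrable _ _); apply/funext => s /=; rewrite mulr1.
- by move=> s _; rewrite mulr1; exact: rho_bound bg.2 s.
Qed.

Lemma wint_dominated (g_ : nat -> R -> R) g M :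
  (forall k, rc_bounded (g_ k) M) ->
  (forall s, 0 <= s -> g_ k s @[k --> \oo] --> g s) ->
  wint rho (g_ k) @[k --> \oo] --> wint rho g.
Proof.
move=> bg cg.
have cm s : rho s * g_ k s @[k --> \oo] --> rho s * g s.
  have [_ rho0 _] := wrho.
  have [s0|s0] := leP 0 s; first by apply: cvgMl_tmp; exact: cg.
  rewrite rho0// mul0r; under eq_fun do rewrite mul0r; exact: cvg_cst.
have mrg : measurable_fun (setT : set (measurableTypeR R)) (fun s => rho s * g s).
  apply: (@measurable_fun_cvg _ _ _ _ (fun k s => rho s * g_ k s)) => //.
  by move=> k; apply: rhog_measurable; case: (bg k).
have irg : leb.-integrable setT (EFin \o (fun s => rho s * g s)).
  apply: le_integrable (Mrho_integrable M) => //; first exact/measurable_EFinP.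
  move=> s _ /=; rewrite lee_fin (le_trans _ (ler_norm _))//.
  apply: (cvgr_to_le (cvg_norm (cm s))); apply: nearW => k.
  by apply: rho_bound; case: (bg k).
apply: fine_cvg; rewrite /wint /Rintegral fineK; last exact: integrable_fin_num.
apply: (@dominated_cvg _ _ _ leb setT measurableT _ _ (EFin \o (fun s => M * rho s))) => //=.
- by move=> k; apply/measurable_EFinP; apply: rhog_measurable; case: (bg k).
- by move=> s _; apply: cvg_EFin; [exact: nearW|exact: cm].
- by move=> k s _; rewrite lee_fin; apply: rho_bound; case: (bg k).
Qed.

Section fubini.
Context {d : measure_display} {Om : measurableType d} (Q : probability Om R).
Variables (G : R -> Om -> R) (M : R).
Hypothesis mG : forall s, 0 <= s -> measurable_fun setT (G s).
Hypothesis bG : forall om, rc_bounded (G ^~ om) M.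

Let f (p : measurableTypeR R * Om) : \bar R := (rho p.1 * G p.1 p.2)%:E.

Let f_measurable : measurable_fun setT f.
Proof.
apply/measurable_EFinP.
rewrite (_ : (fun _ => _) = (fun p : measurableTypeR R * Om =>
  rho p.1 * (if 0 <= p.1 then G p.1 p.2 else 0))); last first.
  by apply/funext => -[s om] /=; rewrite (rho_pos (G ^~ om)).
apply: measurable_funM.
  by apply: (measurableT_comp weight_measurable).
by apply: rc_jointly_measurable => // s om s0; exact: (bG om).1.
Qed.

Let f_integrable : (leb \x Q)%E.-integrable setT f.
Proof.
apply/(integrable12ltyP _ _ f_measurable).
have mF : measurable_fun (setT : set (measurableTypeR R))
    (fun s => \int[Q]_om `|f (s, om)|)%E.
  apply: (measurable_fun_fubini_tonelli_F (abse \o f)) => //=.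
  exact: measurableT_comp.
apply: (@le_lt_trans _ _ (\int[leb]_s (M * rho s)%:E)%E); last first.
  have /integrableP[_] := Mrho_integrable M; apply: le_lt_trans.
  apply: (ge0_le_integral) => //=.
  - by move=> s _; rewrite lee_fin (le_trans _ (rho_bound (bG point).2 s)).
  - by apply/measurable_EFinP; apply: measurable_funM => //; exact: weight_measurable.
  - apply/measurable_EFinP; apply: measurableT_comp => //.
    by apply: measurable_funM => //; exact: weight_measurable.
  - by move=> s _; rewrite lee_fin ler_norm.
apply: ge0_le_integral => //=.
- by move=> s _; apply: integral_ge0.
- by apply/measurable_EFinP; apply: measurable_funM => //; exact: weight_measurable.
- move=> s _.
  have -> : ((M * rho s)%:E = \int[Q]_om (M * rho s)%:E)%E.
    by rewrite integral_cst//= probability_setT mule1.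
  apply: ge0_le_integral => //=.
  + have mfs : measurable_fun setT (fun om => f (s, om)) := (measurableT_comp f_measurable (measurable_fun_pair
      (measurable_cst (s : measurableTypeR R)) (@measurable_id _ _ setT))).
    by apply: (measurableT_comp _ mfs (f := abse)).
  + by move=> om _; rewrite lee_fin; exact: rho_bound (bG om).2 s.
Qed.

Lemma wint_expect : expect Q (fun om => wint rho (G ^~ om)) =
  wint rho (fun s => expect Q (G s)).
Proof.
rewrite /expect /wint /Rintegral; congr fine.
transitivity (\int[Q]_om \int[leb]_s f (s, om))%E.
  apply: eq_integral => om _; rewrite fineK//.
  exact: integrable_fin_num (wint_integrable (bG om)).
rewrite -Fubini//; apply: eq_integral => s _; rewrite /f/=.
have [s0|s0] := leP 0 s; last first.
  have [_ rho0 _] := wrho; rewrite rho0//; under eq_integral do rewrite mul0r.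
  by rewrite integral0 mul0r.
have iG : summable_rv Q (G s).
  by apply: bounded_summable; split; [exact: mG|exists M => om; exact: (bG om).2].
under eq_integral do rewrite EFinM.
rewrite integralZl//.
by rewrite EFinM fineK//; exact: integrable_fin_num.
Qed.

Lemma wint_bounded_rv : bounded_rv (fun om => wint rho (G ^~ om)).
Proof.
split; last by exists (M * wint rho (fun=> 1)) => om; exact: wint_bound.
have mg := measurable_fubini_G f_integrable.
by apply: (measurableT_comp (@fine_measurable R setT measurableT) mg).
Qed.

End fubini.

End weighted_integral.

(** * Integrals up to a fixed or an exponential time *)

Section box_and_exponential.
Context {R : realType}.
Local Notation leb := (@lebesgue_measure R).
Implicit Types (s t a b M : R) (g : R -> R).

Definition box a : R -> R := \1_`[0, a[.

Lemma boxE a s : box a s = (0 <= s < a)%R%:R.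
Proof. by rewrite /box indicE mem_setE in_itv. Qed.

Lemma weight_box a : weight (box a).
Proof.
split=> [s|s s0|]; first by rewrite boxE.
  by rewrite boxE leNgt s0.
exact: (integrable_indic_itv 0 a true true).
Qed.

Lemma wint_box1 a : 0 <= a -> wint (box a) (fun=> 1) = a.
Proof.
move=> a0; rewrite /wint /Rintegral.
under eq_integral do rewrite mulr1.
rewrite /box integral_indic//= setIT.
have := lebesgue_measure_itv `[0, a[; rewrite /= => ->.
rewrite lte_fin; move: a0; rewrite le_eqVlt => /predU1P[<-|a0].
  by rewrite ltxx.
by rewrite a0 /= oppr0 addr0.
Qed.

Lemma rc_bounded_shift g M a : 0 <= a -> rc_bounded g M ->
  (forall s, 0 <= s -> g (a + rd n s) @[n --> \oo] --> g (a + s)) ->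
  rc_bounded (fun s => g (a + s)) M.
Proof.
by move=> a0 [_ gM] cg; split=> // s s0; apply: gM; rewrite addr_ge0.
Qed.

Lemma wint_box_split g M a b : 0 <= a -> 0 <= b -> rc_bounded g M ->
  (forall s, 0 <= s -> g (a + rd n s) @[n --> \oo] --> g (a + s)) ->
  wint (box (a + b)) g = wint (box a) g + wint (box b) (fun s => g (a + s)).
Proof.
move=> a0 b0 bg cg.
have bga := rc_bounded_shift a0 bg cg.
have split s : box (a + b) s * g s = box a s * g s + box b (s - a) * g s.
  rewrite -mulrDl; congr (_ * _); rewrite !boxE subr_ge0 ltrBlDr (addrC b).
  have [sa|sa] := ltP s a; last first.
    by rewrite andbF add0r (le_trans a0 sa).
  rewrite addr0 (lt_le_trans sa)// ?lerDl// ?andbT.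
have ib := wint_integrable (weight_box b) bga.
have ia := wint_integrable (weight_box a) bg.
have iab := wint_integrable (weight_box (a + b)) bg.
have ish : leb.-integrable setT (EFin \o (fun s => box b (s - a) * g s)).
  rewrite (_ : EFin \o _ = (EFin \o (fun s => (box (a + b) s * g s)%R)) \-
      (EFin \o (fun s => (box a s * g s)%R)))%E; first exact: integrableB.
  by apply/funext => s /=; rewrite split -EFinB; congr (_%:E); ring.
rewrite /wint (_ : \int[leb]_s (box b s * g (a + s)) =
    \int[leb]_s (box b (s + a - a) * g (s + a))); last first.
  by apply: eq_Rintegral => s _; rewrite addrK addrC.
rewrite (Rintegral_shift (a := a) (g := fun s => box b (s - a) * g s)).
- by rewrite -RintegralD//; apply: eq_Rintegral => s _; rewrite split.
- move: ib; congr (is_true (_.-integrable _ _)); apply/funext => s /=.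
  by rewrite addrK (addrC a).
- by have /measurable_int/measurable_EFinP := ish.
Qed.

Definition expo : R -> R := exponential_pdf 1.

Lemma expoE s : expo s = if 0 <= s then expR (- s) else 0.
Proof.
rewrite /expo /exponential_pdf patchE mem_setE in_itv/= andbT.
by case: ifP => // _; rewrite mul1r mulN1r.
Qed.

Lemma weight_expo : weight expo.
Proof.
split=> [s|s s0|]; first exact: exponential_pdf_ge0.
  exact: lt0_exponential_pdf.
exact: integrable_exponential_pdf.
Qed.

Lemma wint_expo1 : wint expo (fun=> 1) = 1.
Proof.
rewrite /wint /Rintegral; under eq_integral do rewrite mulr1.
by rewrite /expo integral_exponential_pdf.
Qed.

(** The density of s is exp a times the density at s + a: substituting s - a for
    s and dropping the part of the integral before a gives the inequality. It
    is the source of all supermedian estimates below. *)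
Lemma wint_expo_shift g M a : 0 <= a -> rc_bounded g M ->
  (forall s, 0 <= s -> g (a + rd n s) @[n --> \oo] --> g (a + s)) ->
  (forall s, 0 <= s -> 0 <= g s) ->
  wint expo (fun s => g (a + s)) <= expR a * wint expo g.
Proof.
move=> a0 bg cg g0; have bga := rc_bounded_shift a0 bg cg.
have ia := wint_integrable weight_expo bga.
have ig := wint_integrable weight_expo bg.
have mg : measurable_fun (setT : set (measurableTypeR R))
    (fun s => expo (s - a) * g s).
  rewrite (_ : (fun _ => _) = (fun s => expo s * g (a + s)) \o (fun s => s - a)).
    apply: measurableT_comp; first by have /measurable_int/measurable_EFinP := ia.
    by apply: measurable_funB.
  by apply/funext => s /=; rewrite addrCA subrr addr0.
have expo_shift s : 0 <= expo (s - a) * g s <= expR a * (expo s * g s).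
  rewrite !expoE subr_ge0; have [as_|sa] := leP a s; last first.
    rewrite mul0r lexx/=; case: ifP => s0; last by rewrite mul0r mulr0.
    by rewrite !mulr_ge0 ?expR_ge0// g0.
  have s0 := le_trans a0 as_.
  rewrite s0 opprB expRD mulr_ge0 ?g0 ?mulr_ge0 ?expR_ge0//=.
  by rewrite mulrA.
have iag : leb.-integrable setT (EFin \o (fun s => expR a * (expo s * g s))).
  exact: (integrableZl _ (expR a) ig).
rewrite /wint (_ : \int[leb]_s (expo s * g (a + s)) =
    \int[leb]_s (expo (s + a - a) * g (s + a))); last first.
  by apply: eq_Rintegral => s _; rewrite addrK addrC.
rewrite (Rintegral_shift (a := a) (g := fun s => expo (s - a) * g s))//; last first.
  move: ia; congr (is_true (_.-integrable _ _)); apply/funext => s /=.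
  by rewrite addrK (addrC a).
rewrite -RintegralZl//; apply: le_Rintegral => //.
  apply: le_integrable iag => //; first exact/measurable_EFinP.
  move=> s _ /=; have /andP[p0 p1] := expo_shift s.
  by rewrite lee_fin ger0_norm// ger0_norm// (le_trans p0).
by move=> s _; have /andP[] := expo_shift s.
Qed.

(** A nonnegative function that is at least c up to time t has a resolvent bounded
    away from 0; the crude bound exp (-t) for the density on [0, t[ suffices. *)
Lemma wint_expo_ge g M t (c : R) : 0 <= t -> 0 <= c -> rc_bounded g M ->
  (forall s, 0 <= s -> 0 <= g s) -> (forall s, 0 <= s < t -> c <= g s) ->
  expR (- t) * c * t <= wint expo g.
Proof.
move=> t0 c0 bg g0 cg.
have i1 : leb.-integrable setT (EFin \o (fun s => box t s * 1)).
  apply: (@wint_integrable _ _ (weight_box t) _ 1).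
  by split=> s s0; [exact: cvg_cst|rewrite normr1].
rewrite -[X in _ * X](wint_box1 t0) /wint -RintegralZl//.
apply: le_Rintegral => //; first exact: (integrableZl _ (expR (- t) * c) i1).
  exact: (wint_integrable weight_expo bg).
move=> s _; rewrite boxE mulr1 expoE.
have [s0|s0]/= := leP 0 s; last by rewrite mulr0 mul0r.
have [st|st] := ltP s t; last by rewrite mulr0 mulr_ge0 ?expR_ge0// g0.
by rewrite mulr1 ler_pM ?expR_ge0// ?ler_expR ?lerN2 ?(ltW st)// cg// s0.
Qed.

End box_and_exponential.

(** * The semigroup on bounded continuous functions *)

Definition Cb (R : realType) (E : pmetricType R) (h : E -> R) : Prop :=
  continuous h /\ exists M : R, forall x, `|h x| <= M.

Section feller_process.
Context {R : realType} {d : measure_display} {Om : measurableType d}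
  {E : pmetricType R}.
Variables (P : E -> probability Om R) (X : R -> Om -> E)
  (F : R -> set (set Om)).
Hypothesis fm : feller_markov P X F.
Hypothesis lcE : locally_compact [set: E].

Local Notation T := (semigroup P X).

Implicit Types (s t eps c M : R) (x y : E) (om : Om).

Lemma Cb_bounded_continuous (h : E -> R) : bounded_continuous h -> Cb h.
Proof.
move=> [ch [M [_ Mh]]]; split => //; exists (M + 1) => x.
by apply: Mh => //; rewrite ltrDl.
Qed.

Lemma Cb_cst c : Cb (fun _ : E => c).
Proof. by split; [exact: cst_continuous|exists `|c|]. Qed.

Lemma CbD (g h : E -> R) : Cb g -> Cb h -> Cb (fun x => g x + h x).
Proof.
move=> [cg [M gM]] [ch [N hN]]; split.
  by move=> x; apply: continuousD; [exact: cg|exact: ch].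
by exists (M + N) => x; rewrite (le_trans (ler_normD _ _))// lerD.
Qed.

Lemma CbM (g h : E -> R) : Cb g -> Cb h -> Cb (fun x => g x * h x).
Proof.
move=> [cg [M gM]] [ch [N hN]]; split.
  by move=> x; apply: continuousM; [exact: cg|exact: ch].
by exists (M * N) => x; rewrite normrM ler_pM.
Qed.

Lemma CbN (g : E -> R) : Cb g -> Cb (fun x => - g x).
Proof.
move=> [cg [M gM]]; split; first by move=> x; apply: continuousN; exact: cg.
by exists M => x; rewrite normrN.
Qed.

Lemma CbB (g h : E -> R) : Cb g -> Cb h -> Cb (fun x => g x - h x).
Proof. by move=> Cg Ch; apply: CbD => //; exact: CbN. Qed.

Lemma cvg_minr {I : Type} {G : set_system I} {FG : Filter G} (g h : I -> R) a b :
  g i @[i --> G] --> a -> h i @[i --> G] --> b ->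
  Num.min (g i) (h i) @[i --> G] --> Num.min a b.
Proof.
move=> ga hb; rewrite (_ : (fun i => _) =
    (fun i => (g i + h i - `|g i - h i|) / 2)); last first.
  by apply/funext => i; rewrite minr_absE.
rewrite minr_absE; apply: cvgMr_tmp.
by apply: cvgB; [exact: cvgD|apply: cvg_norm; exact: cvgB].
Qed.

Lemma continuous_minr (g h : E -> R) : continuous g -> continuous h ->
  continuous (fun x => Num.min (g x) (h x)).
Proof. by move=> cg ch x; apply: cvg_minr; [exact: cg|exact: ch]. Qed.

Lemma CbI (g h : E -> R) : Cb g -> Cb h -> Cb (fun x => Num.min (g x) (h x)).
Proof.
move=> [cg [M gM]] [ch [N hN]]; split; first exact: continuous_minr.
exists (Num.max M N) => x; rewrite le_max.
by have [_|_] := leP (g x) (h x); rewrite ?gM ?hN ?orbT.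
Qed.

Lemma continuous_borel (h : E -> R) : continuous h ->
  measurable_fun (setT : set (borel E)) h.
Proof.
move=> /continuousP ch; apply: (measurability _ (RGenOpens.measurableE R)).
move=> _ [_ [a [b ->] <-]]; rewrite setTI; apply: sub_sigma_algebra.
by apply: ch; exact: interval_open.
Qed.

Lemma path_adapted (h : E -> R) t (B : set R) : continuous h -> 0 <= t ->
  measurable B -> F t [set om | B (h (X t om))].
Proof.
move=> ch t0 mB; apply: (fm_adapted fm t0 (B := h @^-1` B)).
by rewrite -[X in measurable X]setTI; apply: continuous_borel.
Qed.

Lemma filtration_measurable t A : 0 <= t -> F t A -> measurable A.
Proof. by move=> t0; apply: (filtration_sub (fm_filtration fm)). Qed.

Lemma path_measurable (h : E -> R) t : continuous h -> 0 <= t ->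
  measurable_fun setT (fun om => h (X t om)).
Proof.
move=> ch t0 _ B mB; rewrite setTI.
exact: (filtration_measurable t0 (path_adapted ch t0 mB)).
Qed.

Lemma path_bounded (h : E -> R) t : Cb h -> 0 <= t ->
  bounded_rv (fun om => h (X t om)).
Proof.
by move=> [ch [M hM]] t0; split; [exact: path_measurable|exists M].
Qed.

Lemma path_summable (h : E -> R) t x : Cb h -> 0 <= t ->
  summable_rv (P x) (fun om => h (X t om)).
Proof. by move=> Ch t0; apply: bounded_summable; exact: path_bounded. Qed.

Lemma semigroupE t (h : E -> R) x :
  T t h x = expect (P x) (fun om => h (X t om)).
Proof. by []. Qed.

Lemma semigroup_bound t (h : E -> R) M : continuous h ->
  (forall x, `|h x| <= M) -> 0 <= t -> forall x, `|T t h x| <= M.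
Proof.
move=> ch hM t0 x; rewrite -(expect_cst (P x) M); apply: expect_abs => //.
  exact: path_measurable.
exact: summable_cst.
Qed.

Lemma semigroup_le t (g h : E -> R) x : Cb g -> Cb h -> 0 <= t ->
  (forall y, g y <= h y) -> T t g x <= T t h x.
Proof. by move=> Cg Ch t0 gh; apply: expect_le => //; exact: path_summable. Qed.

Lemma semigroupD t (g h : E -> R) x : Cb g -> Cb h -> 0 <= t ->
  T t (fun y => g y + h y) x = T t g x + T t h x.
Proof. by move=> Cg Ch t0; apply: expectD => //; exact: path_summable. Qed.

Lemma semigroupB t (g h : E -> R) x : Cb g -> Cb h -> 0 <= t ->
  T t (fun y => g y - h y) x = T t g x - T t h x.
Proof. by move=> Cg Ch t0; apply: expectB => //; exact: path_summable. Qed.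

Lemma semigroup_cst t c x : T t (fun=> c) x = c.
Proof. exact: expect_cst. Qed.

Lemma semigroupZ t c (h : E -> R) x : Cb h -> 0 <= t ->
  T t (fun y => c * h y) x = c * T t h x.
Proof. by move=> Ch t0; apply: expectZ => //; exact: path_summable. Qed.

Lemma path_rc om t (u : nat -> R) : 0 <= t -> (forall n, t <= u n) ->
  u n @[n --> \oo] --> t -> X (u n) om @[n --> \oo] --> X t om.
Proof.
move=> t0 tu ut V VX.
have /= [e e0 eV] := fm_right_continuous fm (om := om) t0 VX.
have /cvgrPdist_lt /(_ e e0) [N _ uN] := ut.
exists N => // n /uN /= tun; rewrite /nbhs/=.
have [<-|nt] := eqVneq t (u n); first exact: nbhs_singleton.
by apply: eV => //; rewrite lt_neqAle nt tu.
Qed.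

Lemma semigroup_rc (h : E -> R) x t (u : nat -> R) : Cb h -> 0 <= t ->
  (forall n, t <= u n) -> u n @[n --> \oo] --> t ->
  T (u n) h x @[n --> \oo] --> T t h x.
Proof.
move=> [ch [M hM]] t0 tu ut.
have [] // := @expect_dominated _ _ _ (P x) (fun n om => h (X (u n) om))
  (fun om => h (X t om)) (fun=> M).
- by move=> n; apply: path_measurable => //; exact: le_trans (tu n).
- exact: summable_cst.
- by move=> om; apply: continuous_cvg; [exact: ch|exact: path_rc].
Qed.

Lemma closed_set1 (x : E) : closed [set x].
Proof.
apply: compact_closed; first exact: metric_hausdorff.
exact: compact_set1.
Qed.

Lemma semigroup0 (h : E -> R) x : Cb h -> T 0 h x = h x.
Proof.
move=> Ch; have mx : measurable (X 0 @^-1` [set x]).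
  apply: (@filtration_measurable 0) => //.
  apply: (fm_adapted fm (lexx 0) (B := [set x])).
  rewrite -(setCK [set x]); apply: measurableC; apply: sub_sigma_algebra.
  by apply: closed_openC; exact: closed_set1.
rewrite semigroupE -(expect_cst (P x) (h x)) /expect /Rintegral; congr fine.
apply: ae_eq_integral => //.
- by apply/measurable_EFinP; apply: path_measurable => //; case: Ch.
- exists (~` (X 0 @^-1` [set x])); split.
  + exact: measurableC.
  + by apply: (etrans (probability_setC (P x) mx)); rewrite (fm_start fm) subee.
  + by move=> om /= nh eqx; apply: nh => _; rewrite eqx.
Qed.

(** A compactly supported cutoff that captures almost all of the law of X_t: this
    is how statements for C_0 are carried over to bounded continuous
    functions. *)
Lemma tight_bump x t eps : 0 <= t -> 0 < eps ->
  exists phi : E -> R, [/\ continuous phi, forall y, 0 <= phi y <= 1,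
    exists2 K, compact K & forall y, ~ K y -> phi y = 0 &
    1 - eps < T t phi x].
Proof.
move=> t0 eps0; have [K cK PK] := fm_tight fm x t0 eps0.
have [phi [cphi phi01 phiK phi0]] := compact_bump lcE cK.
have Cphi : Cb phi.
  split=> //; exists 1 => y; have /andP[p0 p1] := phi01 y.
  by rewrite ger0_norm.
exists phi; split => //; rewrite ltrBlDr -ltrBlDl.
have mK : measurable (X t @^-1` (~` K)).
  apply: (@filtration_measurable t) => //.
  apply: (fm_adapted fm t0); apply: sub_sigma_algebra; apply: closed_openC.
  by apply: compact_closed cK; exact: metric_hausdorff.
have -> : 1 - T t phi x = expect (P x) (fun om => 1 - phi (X t om)).
  rewrite expectB ?expect_cst//; first exact: summable_cst.
  exact: path_summable.
apply: (@le_lt_trans _ _ (expect (P x) (\1_(X t @^-1` (~` K)) : Om -> R))).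
  apply: expect_le.
  - by apply: summableB; [exact: summable_cst|exact: path_summable].
  - by apply: bounded_summable; split => //; exists 1 => om; rewrite indicE; case: (_ \in _); rewrite ?normr1 ?normr0.
  - move=> om; rewrite indicE; have [_|] := boolP (om \in _).
      by rewrite lerBlDr lerDl; case/andP: (phi01 (X t om)).
    by rewrite notin_setE /= => /contrapT /phiK ->; rewrite subrr.
rewrite /expect /Rintegral -lte_fin fineK.
  by rewrite integral_indic// setIT.
by rewrite integral_indic// setIT fin_num_measure.
Qed.

Lemma compact_support_vanishing (phi : E -> R) : continuous phi ->
  (exists2 K, compact K & forall y, ~ K y -> phi y = 0) ->
  vanishing_continuous phi.
Proof.
move=> cphi [K cK phi0]; split => // eps eps0; exists K => // x nK.
by rewrite phi0// normr0.
Qed.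

(** Replace h by h phi, where phi is a cutoff with T_t phi(x) close to 1. The error
    is at most M (1 - T_t phi), which is small at x and, by continuity of
    T_t phi, near x; and T_t (h phi) is continuous by the Feller property. *)
Lemma semigroup_continuous t (h : E -> R) : Cb h -> 0 <= t ->
  continuous (T t h).
Proof.
move=> Ch t0; have [ch [M hM]] := Ch; move=> x.
have M0 : 0 <= M by exact: le_trans (normr_ge0 _) (hM point).
apply/cvgrPdist_lt => e e0.
(* M + 1 avoids a division by zero when h = 0 *)
pose eps := e / (4 * (M + 1)).
have M1 : 0 < M + 1 by rewrite ltr_wpDl.
have eps0 : 0 < eps by rewrite divr_gt0// mulr_gt0.
have [phi [cphi phi01 cphiK Tphi]] := tight_bump x t0 eps0.
have Cphi : Cb phi.
  split=> //; exists 1 => y; have /andP[p0 p1] := phi01 y.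
  by rewrite ger0_norm.
have Chphi := CbM Ch Cphi.
have [cTphi _] := fm_feller fm t0 (compact_support_vanishing cphi cphiK).
have [cThphi _] : vanishing_continuous (T t (fun y => h y * phi y)).
  apply: (fm_feller fm t0); apply: compact_support_vanishing Chphi.1 _.
  by have [K cK K0] := cphiK; exists K => // y /K0 ->; rewrite mulr0.
have err y : `|T t h y - T t (fun y => h y * phi y) y| <= M * (1 - T t phi y).
  rewrite -semigroupB// -[in leRHS](semigroup_cst t 1 y).
  rewrite -semigroupB//; last exact: Cb_cst.
  rewrite -semigroupZ//; last by apply: CbB => //; exact: Cb_cst.
  apply: expect_abs.
  - exact: (path_measurable (CbB Ch Chphi).1 t0).
  - apply: (path_summable (h := fun y => M * (1 - phi y))) => //.
    by apply: CbM; [exact: Cb_cst|apply: CbB => //; exact: Cb_cst].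
  - move=> om; rewrite -[X in X - _]mulr1 -mulrBr normrM ler_pM//.
    by rewrite ger0_norm// subr_ge0; case/andP: (phi01 (X t om)).
have nearphi : \forall y \near x, 1 - eps < T t phi y by apply: cvgr_gt Tphi; exact: cTphi.
have e4 : 0 < e / 4 by rewrite divr_gt0.
have /cvgrPdist_lt /(_ _ e4) nearh := cThphi x.
have Meps : M * eps <= e / 4.
  have -> : M * eps = e / 4 * (M / (M + 1)) by rewrite /eps; field; rewrite gt_eqF.
  by rewrite ler_piMr ?ltW// ltr_pdivrMr// mul1r ltrDl.
have small z : 1 - eps < T t phi z -> M * (1 - T t phi z) <= e / 4.
  move=> zphi; apply: le_trans Meps; rewrite ler_wpM2l//.
  by rewrite lerBlDr -lerBlDl ltW.
near=> y.
have ey := err y; have ex := err x.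
have sx := small x Tphi.
have sy : M * (1 - T t phi y) <= e / 4 by apply: small; near: y.
have hy : `|T t (fun y => h y * phi y) x - T t (fun y => h y * phi y) y| < e / 4 by near: y.
move: ey ex hy; rewrite !ler_norml !ltr_norml => /andP[? ?] /andP[? ?] /andP[? ?].
by apply/andP; split; lra.
Unshelve. all: by end_near. Qed.

Lemma semigroup_Cb t (h : E -> R) : Cb h -> 0 <= t -> Cb (T t h).
Proof.
move=> Ch t0; split; first exact: semigroup_continuous.
by have [ch [M hM]] := Ch; exists M; exact: semigroup_bound.
Qed.

Lemma bounded_rv_indicM A (Y : Om -> R) : measurable A -> bounded_rv Y ->
  bounded_rv (fun om => \1_A om * Y om).
Proof.
move=> mA [mY [M YM]]; split; first exact: measurable_funM.
exists M => om; rewrite normrM (le_trans _ (YM om))// ler_piMl//.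
by rewrite indicE; case: (_ \in _); rewrite ?normr1 ?normr0.
Qed.

Lemma markov_property x s t A (h : E -> R) : 0 <= s -> 0 <= t -> F s A ->
  Cb h -> expect (P x) (fun om => \1_A om * h (X (s + t) om)) =
          expect (P x) (fun om => \1_A om * T t h (X s om)).
Proof.
move=> s0 t0 FA Ch; rewrite !expect_on.
apply: (fm_markov fm) => //; first by apply: continuous_borel; exact: Ch.1.
have [_ [M hM]] := Ch; exists M; split; first exact: num_real.
by move=> N MN y _ /=; apply: le_trans (hM y) (ltW MN).
Qed.

Lemma filtration_setT t : 0 <= t -> F t setT.
Proof.
move=> t0; have [F0 FC _] := filtration_sigma (fm_filtration fm) t0.
by rewrite -(setD0 setT); exact: FC.
Qed.

Lemma semigroupM s t (h : E -> R) x : Cb h -> 0 <= s -> 0 <= t ->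
  T s (T t h) x = T (s + t) h x.
Proof.
move=> Ch s0 t0; have := markov_property x s0 t0 (filtration_setT s0) Ch.
have ind (Y : Om -> R) : expect (P x) (fun om => \1_setT om * Y om) = expect (P x) Y.
  by apply: expect_ext => om; rewrite indicT mul1r.
by rewrite !ind => /esym.
Qed.

(** * Potentials *)

Lemma scaled_rd_cvg c s : 0 <= s -> c * rd n s @[n --> \oo] --> c * s.
Proof. by move=> s0; apply: cvgMl_tmp; exact: rd_cvg. Qed.

Lemma semigroup_rc_bounded c t (h : E -> R) M y : 0 <= c -> 0 <= t ->
  continuous h -> (forall x, `|h x| <= M) ->
  rc_bounded (fun s => T (t + c * s) h y) M.
Proof.
move=> c0 t0 ch hM; split => s s0; last first.
  by apply: semigroup_bound => //; rewrite addr_ge0// mulr_ge0.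
apply: semigroup_rc => //; first by split => //; exists M.
- by rewrite addr_ge0// mulr_ge0.
- by move=> n; rewrite lerD2l ler_wpM2l// rd_ge.
- by apply: cvgD; [exact: cvg_cst|exact: scaled_rd_cvg].
Qed.

Lemma path_rc_bounded c t (h : E -> R) M om : 0 <= c -> 0 <= t ->
  continuous h -> (forall x, `|h x| <= M) ->
  rc_bounded (fun s => h (X (t + c * s) om)) M.
Proof.
move=> c0 t0 ch hM; split=> // s s0.
apply: continuous_cvg; first exact: ch.
apply: path_rc; first by rewrite addr_ge0// mulr_ge0.
- by move=> n; rewrite lerD2l ler_wpM2l// rd_ge.
- by apply: cvgD; [exact: cvg_cst|exact: scaled_rd_cvg].
Qed.

Lemma semigroup_rc_bounded0 c (h : E -> R) M y : 0 <= c ->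
  continuous h -> (forall x, `|h x| <= M) ->
  rc_bounded (fun s => T (c * s) h y) M.
Proof.
move=> c0 ch hM; have := semigroup_rc_bounded y c0 (lexx 0) ch hM.
by congr (rc_bounded _ _); apply/funext => s; rewrite add0r.
Qed.

Definition potential (rho : R -> R) c (h : E -> R) (y : E) : R :=
  wint rho (fun s => T (c * s) h y).

Section potential.
Variables (rho : R -> R) (c : R).
Hypotheses (wrho : weight rho) (c0 : 0 <= c).
Variables (h : E -> R) (M : R).
Hypotheses (ch : continuous h) (hM : forall x, `|h x| <= M).

Let Ch : Cb h. Proof. by split => //; exists M. Qed.

Lemma potential_Cb : Cb (potential rho c h).
Proof.
split; last first.
  exists (M * wint rho (fun=> 1)) => x; apply: wint_bound => //.
  exact: semigroup_rc_bounded0.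
move=> x; apply: seq_continuousP => u ux.
apply: (@wint_dominated _ _ wrho _ _ M).
  by move=> k; exact: semigroup_rc_bounded0.
move=> s s0; apply: continuous_cvg ux.
by apply: semigroup_continuous => //; rewrite mulr_ge0.
Qed.

(** The Markov property integrated over time, by Fubini's theorem. *)
Lemma potential_markov x t A : 0 <= t -> F t A ->
  expect (P x) (fun om => \1_A om * potential rho c h (X t om)) =
  expect (P x) (fun om => \1_A om * wint rho (fun s => h (X (t + c * s) om))).
Proof.
move=> t0 FA; have mA := filtration_measurable t0 FA.
have ind1 om : `|\1_A om : R| <= 1.
  by rewrite indicE; case: (_ \in _); rewrite ?normr1 ?normr0.
transitivity (expect (P x) (fun om =>
    wint rho (fun s => \1_A om * T (c * s) h (X t om)))).
  apply: expect_ext => om.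
  by rewrite (wintZ wrho _ (semigroup_rc_bounded0 _ c0 ch hM)).
transitivity (expect (P x) (fun om =>
    wint rho (fun s => \1_A om * h (X (t + c * s) om)))); last first.
  apply: expect_ext => om.
  by rewrite (wintZ wrho _ (path_rc_bounded om c0 t0 ch hM)).
rewrite !(@wint_expect _ _ wrho _ _ _ _ M).
- apply: eq_Rintegral => s _.
  have [s0|s0] := leP 0 s; last first.
    by have [_ rho0 _] := wrho; rewrite rho0// !mul0r.
  by rewrite -markov_property// mulr_ge0.
- move=> s s0; apply: measurable_funM => //.
  by apply: path_measurable => //; rewrite addr_ge0// mulr_ge0.
- move=> om; apply: rc_boundedZ; [exact: ind1|exact: path_rc_bounded].
- move=> s s0; apply: measurable_funM => //.
  apply: path_measurable => //; apply: semigroup_continuous => //.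
  by rewrite mulr_ge0.
- move=> om; apply: rc_boundedZ; [exact: ind1|exact: semigroup_rc_bounded0].
Qed.

Lemma semigroup_potential x t : 0 <= t ->
  T t (potential rho c h) x = wint rho (fun s => T (t + c * s) h x).
Proof.
move=> t0; have := potential_markov x t0 (filtration_setT t0).
have ind (Y : Om -> R) : expect (P x) (fun om => \1_setT om * Y om) = expect (P x) Y.
  by apply: expect_ext => om; rewrite indicT mul1r.
rewrite !ind semigroupE => ->; rewrite (@wint_expect _ _ wrho _ _ _ _ M)//.
- by move=> s s0; apply: path_measurable => //; rewrite addr_ge0// mulr_ge0.
- by move=> om; exact: path_rc_bounded.
Qed.

End potential.

(** * Local uniform continuity of the semigroup at time zero *)

(** The mean of T_s h for s exponential of mean 1/(n+1). *)
Definition resolvent n (h : E -> R) := potential expo n.+1%:R^-1 h.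

Section resolvent.
Variables (h : E -> R) (M : R).
Hypotheses (ch : continuous h) (hM : forall x, `|h x| <= M).
Hypothesis h0 : forall x, 0 <= h x.

Let Ch : Cb h. Proof. by split => //; exists M. Qed.

Let n0 n : 0 <= n.+1%:R^-1 :> R. Proof. by rewrite invr_ge0. Qed.

Lemma resolvent_Cb n : Cb (resolvent n h).
Proof. by apply: (@potential_Cb _ _ weight_expo _ h M). Qed.

Lemma semigroup_ge0 t x : 0 <= T t h x.
Proof. by apply: expect_ge0. Qed.

Lemma resolvent_ge0 n x : 0 <= resolvent n h x.
Proof.
apply: Rintegral_ge0 => s _; rewrite mulr_ge0 ?semigroup_ge0//.
by have [] := @weight_expo R.
Qed.

Lemma resolvent_cvg x : resolvent n h x @[n --> \oo] --> h x.
Proof.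
have -> : h x = wint expo (fun s => T 0 h x).
  rewrite (_ : (fun _ => _) = (fun s => h x * 1)); last first.
    by apply/funext => s; rewrite mulr1 semigroup0.
  rewrite (@wintZ _ _ weight_expo _ _ 1) ?wint_expo1 ?mulr1//.
  by split=> [s _|s _]; [exact: cvg_cst|rewrite normr1].
apply: (@wint_dominated _ _ weight_expo _ _ M) => [k|s s0].
  exact: semigroup_rc_bounded0.
apply: semigroup_rc => //; first by move=> n; rewrite mulr_ge0.
rewrite -[X in _ --> X](mul0r s); apply: cvgMr_tmp.
exact: cvg_harmonic.
Qed.

Lemma resolvent_supermedian n t x : 0 <= t ->
  T t (resolvent n h) x <= expR (n.+1%:R * t) * resolvent n h x.
Proof.
move=> t0; rewrite (@semigroup_potential _ _ weight_expo _ h M)//.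
have eq s : n.+1%:R^-1 * (n.+1%:R * t + s) = t + n.+1%:R^-1 * s.
  by rewrite mulrDr mulKf.
pose g s := T (n.+1%:R^-1 * s) h x.
have -> : (fun s => T (t + n.+1%:R^-1 * s) h x) = (fun s => g (n.+1%:R * t + s)).
  by apply/funext => s; rewrite /g eq.
apply: (@wint_expo_shift R g M).
- by rewrite mulr_ge0.
- exact: semigroup_rc_bounded0.
- move=> s s0; rewrite /g eq (_ : (fun _ => _) =
      (fun k => T (t + n.+1%:R^-1 * rd k s) h x)).
    by have [cT _] := semigroup_rc_bounded x (n0 n) t0 ch hM; exact: cT.
  by apply/funext => k; rewrite eq.
- by move=> s s0; exact: semigroup_ge0.
Qed.

End resolvent.

(** Otherwise some eps bounds the resolvent from below along points y_m leaving all
    the sets of a suitable exhaustion. The points where some T_s h is positive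
    form a countable union of compact sets, since by right continuity dyadic
    times s suffice. Exhausting that union, T_r h(y_m) tends to 0 for each r,
    and dominated convergence contradicts the lower bound. *)
Lemma resolvent_vanishing n (h : E -> R) M : vanishing_continuous h ->
  (forall x, `|h x| <= M) -> (forall x, 0 <= h x) ->
  vanishing_continuous (resolvent n h).
Proof.
move=> vh hM h0; have ch := vh.1.
have Ch : Cb h by split => //; exists M.
split; first by apply: (resolvent_Cb ch hM n).1.
move=> eps eps0; apply: contrapT => nK.
have cpt i j k : exists2 C, compact C &
    forall y, ~ C y -> `|T (grid i j) h y| < k.+1%:R^-1.
  have [_ v] := fm_feller fm (grid_ge0 i j) vh.
  by apply: v; rewrite invr_gt0.
have [C CP] : {C : nat -> nat -> nat -> set E | forall i j k, compact (C i j k) /\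
    forall y, ~ C i j k y -> `|T (grid i j) h y| < k.+1%:R^-1}.
  have H i j k : {C | compact C /\ forall y, ~ C y -> `|T (grid i j) h y| < k.+1%:R^-1}.
    by apply: cid; have [C cC CP] := cpt i j k; exists C.
  by exists (fun i j k => sval (H i j k)) => i j k; case: (H i j k).
pose S m : set E := if unpickle m is Some (i, j, k) then C i j k else set0.
have cS m : compact (S m).
  by rewrite /S; case: unpickle => [[[i j] k]|]; [exact: (CP i j k).1|exact: compact0].
have [K [cK KP]] := compact_exhaustion lcE cS.
have [y yP] : {y : nat -> E | forall m, ~ K m (y m) /\ eps <= resolvent n h (y m)}.
  have H m : {y | ~ K m y /\ eps <= resolvent n h y}.
    apply: cid; apply: contrapT => ny; apply: nK; exists (K m) => // x nKx.
    rewrite ger0_norm; last exact: resolvent_ge0.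
    by rewrite ltNge; apply/negP => le; apply: ny; exists x.
  by exists (fun m => sval (H m)) => m; case: (H m).
have small r : 0 <= r -> T r h (y m) @[m --> \oo] --> 0.
  move=> r0; apply/cvgrPdist_lt => e e0.
  have [cT /(_ e e0) [Cr cCr CrP]] := fm_feller fm r0 vh.
  have cC' : compact (Cr `&` [set y | e <= T r h y]).
    apply: compact_closedI => //.
    rewrite (_ : [set _ | _] = T r h @^-1` [set t | e <= t])//.
    by apply: preimage_closed => [z _|]; [exact: cT|exact: closed_ge].
  have sub : Cr `&` [set y | e <= T r h y] `<=` \bigcup_m S m.
    move=> z [_ /= ez].
    have /cvgr_gt /(_ (e / 2)) : T (rd k r) h z @[k --> \oo] --> T r h z.
      by apply: semigroup_rc => // [k|]; [exact: rd_ge|exact: rd_cvg].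
    case; first by rewrite (lt_le_trans _ ez)// ltr_pdivrMr// ltr_pMr// ltr1n.
    move=> k _ /(_ k (leqnn k)) /= ek.
    have [m _ /(_ m (leqnn m)) /= me] := near_infty_natSinv_lt (PosNum (divr_gt0 e0 (ltr0n R 2))).
    exists (pickle (k, up k r, m)) => //; rewrite /S pickleK.
    apply: contrapT => /(CP k (up k r) m).2.
    rewrite ltNge ger0_norm ?semigroup_ge0// => /negP; apply.
    by rewrite ltW// (lt_trans me).
  have [N NP] := KP _ cC' sub.
  have [] := (CP 0 0 0)%N => _ _.
  exists N => // m /= Nm; rewrite sub0r normrN ger0_norm ?semigroup_ge0//.
  rewrite ltNge; apply/negP => em; have [nKm _] := yP m; apply: nKm.
  apply: (NP m Nm); split => //; apply: contrapT => /CrP.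
  by rewrite ger0_norm ?semigroup_ge0// ltNge em.
have : resolvent n h (y m) @[m --> \oo] --> wint expo (fun=> 0 : R).
  apply: (@wint_dominated _ _ weight_expo _ _ M) => [m|s s0].
    by apply: semigroup_rc_bounded0 => //; rewrite invr_ge0.
  by apply: small; rewrite mulr_ge0// invr_ge0.
move=> cres; have : eps <= wint expo (fun=> 0 : R).
  by apply: (cvgr_to_ge cres); apply: nearW => m; have [] := yP m.
by rewrite /wint; under eq_Rintegral do rewrite mulr0; rewrite Rintegral_cst// mul0r leNgt eps0.
Qed.

(** Resolvents v are supermedian up to an exponential factor and tend to h. The
    minimum s of finitely many of them is still supermedian, so that
    exp (-a t) T_t s decreases in t, and with enough of them s <= h + eps
    everywhere, by compactness, while s >= h - eps at x. Hence for t <= t1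
    the value T_t h >= T_t s - eps is bounded below by exp (-a t1) T_t1 s - eps,
    a continuous function of the starting point which at x is close to h(x). *)
Lemma semigroup_lsc_support (h : E -> R) M x eps : 0 < eps ->
  vanishing_continuous h ->
  (forall x, `|h x| <= M) -> (forall x, 0 <= h x) ->
  exists2 t0, 0 < t0 & \forall y \near x, forall t, 0 <= t <= t0 ->
    h y - eps <= T t h y.
Proof.
move=> eps0 vh hM h0; have ch := vh.1; have Ch : Cb h by split => //; exists M.
have e3 : 0 < eps / 4 by rewrite divr_gt0.
have [N NP] : exists N, forall n, (N <= n)%N -> h x - eps / 4 <= resolvent n h x.
  have /cvgr_ge /(_ (h x - eps / 4)) [] := resolvent_cvg ch hM (x := x).
    by rewrite gtrBl.
  by move=> N _ NP; exists N => n Nn; exact: NP.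
pose s := fix s k := if k is k'.+1 then
  (fun y => Num.min (s k' y) (resolvent (N + k) h y)) else resolvent (N + 0) h.
have Cs k : Cb (s k).
  by elim: k => [|k IHk] /=; [|apply: CbI => //]; exact: (resolvent_Cb ch hM).
have s_ge0 k y : 0 <= s k y.
  by elim: k => [|k IHk] /=; rewrite ?le_min ?IHk resolvent_ge0.
have s_x k : h x - eps / 4 <= s k x.
  by elim: k => [|k IHk] /=; rewrite ?le_min ?IHk NP// leq_addr.
have s_dec k m y : (k <= m)%N -> s m y <= s k y.
  move=> /subnK <-; elim: (m - k)%N => [//|j]; apply: le_trans => /=.
  by rewrite ge_min lexx.
have s_le k y : s k y <= resolvent (N + k) h y.
  by case: k => [//|k] /=; rewrite ge_min lexx orbT.
have s_sup k t y : 0 <= t -> T t (s k) y <= expR ((N + k).+1%:R * t) * s k y.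
  move=> t0; elim: k => [|k IHk] /=; first exact: resolvent_supermedian.
  rewrite minr_pMr ?expR_ge0// le_min; apply/andP; split.
    apply: (@le_trans _ _ (T t (s k) y)).
      apply: semigroup_le => //; first exact: (Cs k.+1).
      by move=> z /=; rewrite ge_min lexx.
    apply: le_trans IHk _; rewrite ler_wpM2r// ler_expR ler_wpM2r// ler_nat.
    by rewrite ltnS leq_add2l.
  apply: (@le_trans _ _ (T t (resolvent (N + k.+1) h) y)).
    apply: semigroup_le => //; [exact: (Cs k.+1)|exact: (resolvent_Cb ch hM)|].
    by move=> z /=; rewrite ge_min lexx orbT.
  exact: resolvent_supermedian.
have [k0 k0P] : exists k, forall y, s k y <= h y + eps / 4.
  have [_ /(_ _ e3) [K cK KP]] := resolvent_vanishing (N + 0) vh hM h0.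
  have [] := (iffLR (compact_near_coveringP K) cK) _ \oo
      (fun k y => s k y < h y + eps / 4) _.
    move=> y Ky.
    have /cvgr_lt /(_ (h y + eps / 4)) [] := resolvent_cvg ch hM (x := y).
      by rewrite ltrDl.
    move=> n _ /(_ (n + N)%N (leq_addr _ _)) /= resn.
    have sn : s n y < h y + eps / 4.
      by apply: le_lt_trans (s_le n y) _; rewrite addnC.
    have cd : {for y, continuous (fun z => h z + eps / 4 - s n z)}.
      apply: continuousB; last exact: (Cs n).1.
      by apply: continuousD; [exact: ch|exact: cst_continuous].
    have /cvgr_gt /(_ 0) := cd; rewrite subr_gt0 => /(_ sn) nz.
    exists ([set z | 0 < h z + eps / 4 - s n z], [set k | (n <= k)%N]).
      by split => //; exists n.
    move=> [z k] /= [+ nk]; rewrite subr_gt0; apply: le_lt_trans.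
    exact: s_dec.
  move=> k _ /(_ k (leqnn k)) KPk; exists k => y.
  have [Ky|nKy] := pselect (K y); first by rewrite ltW// KPk.
  apply: (@le_trans _ _ (resolvent (N + 0) h y)); first exact: (s_dec 0%N).
  rewrite (le_trans (ler_norm _))// ltW// (lt_le_trans (KP y nKy))//.
  by rewrite lerDr.
pose a : R := (N + k0).+1%:R.
have dec y t t' : 0 <= t -> t <= t' ->
    expR (- (a * t')) * T t' (s k0) y <= expR (- (a * t)) * T t (s k0) y.
  move=> t0 tt'; have d0 : 0 <= t' - t by rewrite subr_ge0.
  rewrite [in T t'](_ : t' = t + (t' - t)); last by rewrite addrC subrK.
  rewrite -semigroupM//; apply: (@le_trans _ _ (expR (- (a * t')) *
      T t (fun z => expR (a * (t' - t)) * s k0 z) y)).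
    rewrite ler_wpM2l ?expR_ge0//; apply: semigroup_le => //.
    - exact: semigroup_Cb.
    - by apply: CbM => //; exact: Cb_cst.
    - by move=> z; exact: s_sup.
  rewrite semigroupZ// mulrA -expRD le_eqVlt; apply/orP; left; apply/eqP; congr (expR _ * _); ring.
have c0 : expR (- (a * 0)) * T 0 (s k0) x = s k0 x.
  by rewrite mulr0 oppr0 expR0 mul1r semigroup0.
have [t1 t1_gt0 t1P] : exists2 t1, 0 < t1 &
    s k0 x - eps / 4 < expR (- (a * t1)) * T t1 (s k0) x.
  have : expR (- (a * k.+1%:R^-1)) * T k.+1%:R^-1 (s k0) x @[k --> \oo] -->
      expR (- (a * 0)) * T 0 (s k0) x.
    apply: cvgM.
      apply: continuous_cvg; first exact: continuous_expR.
      by apply: cvgN; apply: cvgMl_tmp; exact: cvg_harmonic.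
    by apply: semigroup_rc => //; exact: cvg_harmonic.
  rewrite c0 => /cvgr_gt /(_ (s k0 x - eps / 4)) [].
    by rewrite gtrBl.
  by move=> k _ /(_ k (leqnn k)) /= H; exists k.+1%:R^-1.
exists t1 => //.
have c1 : {for x, continuous (fun y => expR (- (a * t1)) * T t1 (s k0) y + eps / 4 - s k0 y)}.
  apply: continuousB; last exact: (Cs k0).1.
  apply: continuousD; last exact: cst_continuous.
  apply: continuousM; first exact: cst_continuous.
  by apply: semigroup_continuous => //; exact: ltW.
have /cvgr_gt /(_ 0) := c1; rewrite subr_gt0 -ltrBlDr => /(_ t1P) near1.
have c2 : {for x, continuous (fun y => s k0 y - h y)}.
  by apply: continuousB; [exact: (Cs k0).1|exact: ch].
have /cvgr_gt /(_ (- (2 * (eps / 4)))) : s k0 y - h y @[y --> x] --> s k0 x - h x := c2.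
have ltx : - (2 * (eps / 4)) < s k0 x - h x by have := s_x k0; lra.
move=> /(_ ltx) near2.
near=> y => t /andP[t0 tt1].
have y1 : 0 < expR (- (a * t1)) * T t1 (s k0) y + eps / 4 - s k0 y by near: y.
have y2 : - (2 * (eps / 4)) < s k0 y - h y by near: y.
have y3 := dec y t t1 t0 tt1.
have y4 : expR (- (a * t)) * T t (s k0) y <= T t (s k0) y.
  rewrite ler_piMl//; first exact: expect_ge0.
  by rewrite -expR0 ler_expR oppr_le0 mulr_ge0.
have y5 : T t (s k0) y <= T t h y + eps / 4.
  rewrite -[X in _ <= _ + X](semigroup_cst t _ y) -semigroupD//; last exact: Cb_cst.
  by apply: semigroup_le => //; apply: CbD => //; exact: Cb_cst.
by lra.
Unshelve. all: by end_near. Qed.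

(** Apply the preceding lemma to h times a cutoff equal to 1 at x; only a lower
    bound is claimed, so dropping the rest of the mass is harmless. *)
Lemma semigroup_lsc (h : E -> R) x eps : Cb h -> (forall x, 0 <= h x) ->
  0 < eps ->
  exists2 t0, 0 < t0 & \forall y \near x, forall t, 0 <= t <= t0 ->
    h y - eps <= T t h y.
Proof.
move=> Ch h0 eps0; have [ch [M hM]] := Ch.
have e2 : 0 < eps / 2 by rewrite divr_gt0.
have [phi [cphi phi01 phi1 phiK]] := compact_bump lcE (compact_set1 (x := x)).
have hphiM y : `|h y * phi y| <= M.
  have /andP[p0 p1] := phi01 y.
  by rewrite normrM (ger0_norm p0) (le_trans _ (hM y))// ler_piMr.
have hphi0 y : 0 <= h y * phi y by rewrite mulr_ge0//; have /andP[] := phi01 y.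
have chphi : continuous (fun y => h y * phi y).
  by move=> y; apply: continuousM; [exact: ch|exact: cphi].
have Chphi : Cb (fun y => h y * phi y) by split => //; exists M.
have vhphi : vanishing_continuous (fun y => h y * phi y).
  apply: compact_support_vanishing chphi _.
  by have [K cK K0] := phiK; exists K => // y /K0 ->; rewrite mulr0.
have [t0 t0_gt0 near0] := semigroup_lsc_support x e2 vhphi hphiM hphi0.
exists t0 => //.
have c : {for x, continuous (fun y => h y - h y * phi y)}.
  by apply: continuousB; [exact: ch|exact: chphi].
have /cvgr_lt /(_ (eps / 2)) : h y - h y * phi y @[y --> x] --> h x - h x * phi x := c.
rewrite phi1// mulr1 subrr => /(_ e2) near1.
near=> y => t tt0.
have y0 : h y * phi y - eps / 2 <= T t (fun y => h y * phi y) y.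
  by move: t tt0; near: y.
have y1 : h y - h y * phi y < eps / 2 by near: y.
have y2 : T t (fun y => h y * phi y) y <= T t h y.
  apply: semigroup_le => //; first by case/andP: tt0.
  by move=> z; rewrite ler_piMr//; have /andP[] := phi01 z.
lra.
Unshelve. all: by end_near. Qed.

(** Apply the lower bound to M + h and to M - h. *)
Lemma semigroup_locally_uniform (h : E -> R) x eps : Cb h -> 0 < eps ->
  exists2 t0, 0 < t0 & \forall y \near x, forall t, 0 <= t <= t0 ->
    `|T t h y - h y| <= eps.
Proof.
move=> Ch eps0; have [ch [M hM]] := Ch.
have CD : Cb (fun y => M + h y) by apply: CbD => //; exact: Cb_cst.
have CB : Cb (fun y => M - h y) by apply: CbB => //; exact: Cb_cst.
have D0 y : 0 <= M + h y by have := hM y; rewrite ler_norml => /andP[? ?]; lra.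
have B0 y : 0 <= M - h y by have := hM y; rewrite ler_norml => /andP[? ?]; lra.
have [t1 t1_gt0 near1] := semigroup_lsc x CD D0 eps0.
have [t2 t2_gt0 near2] := semigroup_lsc x CB B0 eps0.
exists (Num.min t1 t2); first by rewrite lt_min t1_gt0.
near=> y => t /andP[t0]; rewrite le_min => /andP[tt1 tt2].
have y1 : M + h y - eps <= T t (fun y => M + h y) y.
  have t01 : 0 <= t <= t1 by rewrite t0.
  by move: t t01 {t0 tt1 tt2}; near: y.
have y2 : M - h y - eps <= T t (fun y => M - h y) y.
  have t02 : 0 <= t <= t2 by rewrite t0.
  by move: t t02 {t0 tt1 tt2 y1}; near: y.
move: y1 y2; rewrite semigroupD//; last exact: Cb_cst.
rewrite semigroupB//; last exact: Cb_cst.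
rewrite semigroup_cst ler_norml => y1 y2; apply/andP; split; lra.
Unshelve. all: by end_near. Qed.

Lemma semigroup_compact_uniform (h : E -> R) (K : set E) eps : Cb h ->
  compact K -> 0 < eps ->
  exists2 t0, 0 < t0 & forall y, K y -> forall t, 0 <= t <= t0 ->
    `|T t h y - h y| <= eps.
Proof.
move=> Ch cK eps0.
have [] := (iffLR (compact_near_coveringP K) cK) _ \oo
    (fun n y => forall t, 0 <= t <= mesh n -> `|T t h y - h y| <= eps) _.
  move=> y Ky; have [t0 t0_gt0 nearT] := semigroup_locally_uniform y Ch eps0.
  have nearN : \forall n \near \oo, mesh n < t0.
    have /cvgr_lt := @mesh_cvg R; exact.
  exists ([set z | forall t, 0 <= t <= t0 -> `|T t h z - h z| <= eps],
    [set n | mesh n < t0]) => //=.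
  move=> [z n] /= [zt nt] t /andP[p0 tn]; apply: zt.
  by rewrite p0 (le_trans tn)// ltW.
move=> n _ /(_ n (leqnn n)) KP; exists (mesh n); first exact: mesh_gt0.
by move=> y Ky; exact: KP.
Qed.

(** * Stopping on a dyadic grid *)

(** Stopping times with values on the grid of level n are described by the index of
    their value, so that the Markov property can be summed over the finitely
    many values. *)
Definition grid_stop n (k : Om -> nat) : Prop :=
  forall j, F (grid n j) [set om | (k om <= j)%N].

Lemma filtrationC t A : 0 <= t -> F t A -> F t (~` A).
Proof.
move=> t0 FA; have [_ FC _] := filtration_sigma (fm_filtration fm) t0.
by rewrite -setTD; exact: FC.
Qed.

Lemma filtration_bigcup t (A : nat -> set Om) : 0 <= t ->
  (forall n, F t (A n)) -> F t (\bigcup_n A n).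
Proof. by move=> t0; have [_ _] := filtration_sigma (fm_filtration fm) t0; apply. Qed.

Lemma filtration0 t : 0 <= t -> F t set0.
Proof. by move=> t0; have [] := filtration_sigma (fm_filtration fm) t0. Qed.

Lemma filtrationU t A B : 0 <= t -> F t A -> F t B -> F t (A `|` B).
Proof.
move=> t0 FA FB; rewrite -bigcup2E; apply: filtration_bigcup => // -[|[|n]] //=.
exact: filtration0.
Qed.

Lemma filtrationI t A B : 0 <= t -> F t A -> F t B -> F t (A `&` B).
Proof.
move=> t0 FA FB; rewrite -(setCK (A `&` B)) setCI; apply: filtrationC => //.
by apply: filtrationU => //; exact: filtrationC.
Qed.

Lemma filtrationW s t A : 0 <= s -> s <= t -> F s A -> F t A.
Proof. by move=> s0 st; apply: (filtration_le (fm_filtration fm)). Qed.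

Lemma grid_stop_eq n k j : grid_stop n k -> F (grid n j) [set om | k om == j].
Proof.
move=> sk; case: j => [|j].
  rewrite (_ : [set _ | _] = [set om | (k om <= 0)%N]); first exact: sk.
  by apply/seteqP; split => om /=; rewrite leqn0.
rewrite (_ : [set _ | _] = [set om | (k om <= j.+1)%N] `&`
    ~` [set om | (k om <= j)%N]).
  apply: filtrationI; [exact: grid_ge0|exact: sk|].
  apply: filtrationC; first exact: grid_ge0.
  by apply: filtrationW (sk j); [exact: grid_ge0|rewrite ler_grid].
apply/seteqP; split => om /=.
  by move=> /eqP ->; split => //; rewrite ltnn.
by move=> [kj /negP nkj]; rewrite eqn_leq kj ltnNge.
Qed.

Lemma grid_stop_gt n k j : grid_stop n k -> F (grid n j) [set om | (j < k om)%N].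
Proof.
move=> sk; rewrite (_ : [set _ | _] = ~` [set om | (k om <= j)%N]).
  by apply: filtrationC; [exact: grid_ge0|exact: sk].
by apply/seteqP; split => om /=; rewrite ltnNge => /negP.
Qed.

Lemma grid_stop_measurable n k j : grid_stop n k ->
  measurable [set om | k om == j].
Proof.
move=> sk; apply: (@filtration_measurable (grid n j)); first exact: grid_ge0.
exact: grid_stop_eq.
Qed.

Lemma stop_sumE (k : Om -> nat) N (Y : nat -> Om -> R) om : (k om <= N)%N ->
  Y (k om) om = \sum_(0 <= j < N.+1) \1_[set om | k om == j] om * Y j om.
Proof.
move=> kN; rewrite big_mkord (bigD1 (Ordinal (kN : (k om < N.+1)%N)))//= big1 => [|i].
  by rewrite addr0 indicE mem_set//= mul1r.
move=> ik; rewrite indicE memNset/= ?mul0r// => /eqP ki.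
by move: ik; rewrite -val_eqE/= -ki eqxx.
Qed.

(** An expectation at a bounded grid time splits into deterministic times. *)
Lemma expect_stop (Q : probability Om R) n k N (Y : nat -> Om -> R) :
  grid_stop n k -> (forall om, (k om <= N)%N) ->
  (forall j, (j <= N)%N -> summable_rv Q (Y j)) ->
  summable_rv Q (fun om => Y (k om) om) /\
  expect Q (fun om => Y (k om) om) =
  \sum_(0 <= j < N.+1) expect Q (fun om => \1_[set om | k om == j] om * Y j om).
Proof.
move=> sk kN iY.
have sm j : (j < N.+1)%N -> summable_rv Q (fun om => \1_[set om | k om == j] om * Y j om).
  by move=> jN; apply: summable_indicM; [exact: grid_stop_measurable sk|exact: iY].
rewrite (_ : (fun om => Y (k om) om) = (fun om =>
  \sum_(0 <= j < N.+1) \1_[set om | k om == j] om * Y j om)); last first.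
  by apply/funext => om; exact: stop_sumE.
by split; [exact: summable_sum|exact: expect_sum].
Qed.

(** The delay r may depend on the stopping time: this is used both to move on to a
    fixed horizon and to the next point of a coarser grid. *)
Lemma grid_markov x n k N (r : nat -> R) (h : E -> R) :
  grid_stop n k -> (forall om, (k om <= N)%N) -> (forall j, (j <= N)%N -> 0 <= r j) -> Cb h ->
  expect (P x) (fun om => h (X (grid n (k om) + r (k om)) om)) =
  expect (P x) (fun om => T (r (k om)) h (X (grid n (k om)) om)).
Proof.
move=> sk kN r0 Ch.
have [_ ->] := @expect_stop (P x) n k N (fun j om => h (X (grid n j + r j) om)) sk kN
  (fun j jN => path_summable x Ch (addr_ge0 (grid_ge0 n j) (r0 j jN))).
have [_ ->] := @expect_stop (P x) n k N (fun j om => T (r j) h (X (grid n j) om)) sk kN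
  (fun j jN => path_summable x (semigroup_Cb Ch (r0 j jN)) (grid_ge0 n j)).
apply: eq_big_nat => j /= jN; apply: markov_property => //.
- exact: grid_ge0.
- exact: r0.
- exact: grid_stop_eq.
Qed.

Lemma grid_path_summable x n k N (h : nat -> E -> R) : grid_stop n k ->
  (forall om, (k om <= N)%N) -> (forall j, (j <= N)%N -> Cb (h j)) ->
  summable_rv (P x) (fun om => h (k om) (X (grid n (k om)) om)).
Proof.
move=> sk kN Ch.
by have [] := @expect_stop (P x) n k N (fun j om => h j (X (grid n j) om)) sk kN
  (fun j jN => path_summable x (Ch j jN) (grid_ge0 n j)).
Qed.

(** The resolvent v of phi is bounded below by some c > 0 on the compact set where
    phi is not small, so phi <= eps/2 + v/c everywhere. The right-hand side
    grows at most like exp t under T_t, and v vanishes at infinity. *)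
Lemma semigroup_uniform_decay (phi : E -> R) H eps : vanishing_continuous phi ->
  (forall x, 0 <= phi x <= 1) -> 0 < eps ->
  exists2 K, compact K & forall y, ~ K y -> forall t, 0 <= t <= H ->
    T t phi y <= eps.
Proof.
move=> vphi phi01 eps0; have cphi := vphi.1.
have phi0 x : 0 <= phi x by case/andP: (phi01 x).
have phiM x : `|phi x| <= 1 by rewrite ger0_norm//; case/andP: (phi01 x).
have Cphi : Cb phi by split => //; exists 1.
have e2 : 0 < eps / 2 by rewrite divr_gt0.
have [_ /(_ _ e2) [K0 cK0 K0P]] := vphi.
pose v := resolvent 0 phi.
have Cv : Cb v by exact: (resolvent_Cb cphi phiM).
have v0 x : 0 <= v x by exact: resolvent_ge0.
have cK1 : compact (K0 `&` [set y | eps / 2 <= phi y]).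
  apply: compact_closedI => //.
  rewrite (_ : [set _ | _] = phi @^-1` [set t | eps / 2 <= t])//.
  by apply: preimage_closed => [z _|]; [exact: cphi|exact: closed_ge].
have [c c0 cP] : exists2 c, 0 < c & forall y, (K0 `&` [set y | eps / 2 <= phi y]) y ->
    c <= v y.
  have e4 : 0 < eps / 4 by rewrite divr_gt0.
  have [t0 t0_gt0 tP] := semigroup_compact_uniform Cphi cK1 e4.
  exists (expR (- t0) * (eps / 4) * t0); first by rewrite !mulr_gt0// expR_gt0.
  move=> y Ky; apply: (@wint_expo_ge _ _ 1) => //; try exact: ltW.
  - by apply: semigroup_rc_bounded0.
  - by move=> s _; exact: semigroup_ge0.
  - move=> s /andP[s0 st]; rewrite invr1 mul1r.
    have st0 : 0 <= s <= t0 by rewrite s0 ltW.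
    have := tP y Ky s st0; rewrite ler_norml => /andP[? _].
    have [_ /= ?] := Ky; lra.
have phi_le y : phi y <= eps / 2 + c^-1 * v y.
  have [Ky|nKy] := pselect ((K0 `&` [set y | eps / 2 <= phi y]) y).
    have vc : 1 <= c^-1 * v y by rewrite mulrC ler_pdivlMr// mul1r cP.
    by have /andP[_ ?] := phi01 y; lra.
  have cv0 : 0 <= c^-1 * v y by rewrite mulr_ge0// invr_ge0 ltW.
  suff : phi y <= eps / 2 by lra.
  have [K0y|nK0y] := pselect (K0 y).
    by rewrite leNgt; apply/negP => lt; apply: nKy; split => //=; exact: ltW.
  by have := K0P y nK0y; rewrite ger0_norm// => /ltW.
(* chosen so that c^-1 (expR H * del) = eps / 2 *)
pose del := c * expR (- H) * (eps / 2).
have del0 : 0 < del by rewrite !mulr_gt0// expR_gt0.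
have [_ /(_ _ del0) [K cK KP]] := resolvent_vanishing 0 vphi phiM phi0.
exists K => // y nKy t /andP[t0 tH].
have vdel : v y <= del by rewrite (le_trans (ler_norm _))// ltW// KP.
apply: (@le_trans _ _ (eps / 2 + c^-1 * (expR t * v y))).
  apply: (@le_trans _ _ (T t (fun z => eps / 2 + c^-1 * v z) y)).
    apply: semigroup_le => //; apply: CbD; first exact: Cb_cst.
    by apply: CbM => //; exact: Cb_cst.
  rewrite semigroupD//; last 2 first.
  - exact: Cb_cst.
  - by apply: CbM => //; exact: Cb_cst.
  rewrite semigroup_cst semigroupZ// lerD2l ler_wpM2l ?invr_ge0 ?(ltW c0)//.
  by have := resolvent_supermedian cphi phiM phi0 0 y t0; rewrite mul1r.
have : c^-1 * (expR t * v y) <= eps / 2.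
  rewrite mulrC ler_pdivrMr//.
  apply: (@le_trans _ _ (expR H * del)).
    by rewrite ler_pM ?expR_ge0// ler_expR.
  rewrite /del expRN [leRHS]mulrC le_eqVlt; apply/orP; left; apply/eqP.
  by field; rewrite gt_eqF// expR_gt0.
lra.
Qed.

Lemma bounded_rv_indic (A : set Om) : measurable A ->
  bounded_rv (\1_A : Om -> R).
Proof.
move=> mA; split; first exact: measurable_indic.
by exists 1 => om; rewrite indicE; case: (_ \in _); rewrite ?normr1 ?normr0.
Qed.

Definition outside n (k : Om -> nat) (K : set E) : set Om :=
  [set om | ~ K (X (grid n (k om)) om)].

Lemma outside_measurable n k N K : grid_stop n k -> (forall om, (k om <= N)%N) ->
  compact K -> measurable (outside n k K).
Proof.
move=> sk kN cK.
rewrite (_ : outside n k K = \bigcup_j ([set om | k om == j] `&`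
    X (grid n j) @^-1` (~` K))); last first.
  apply/seteqP; split => [om nK|om [j _ [/eqP <-]]//].
  by exists (k om) => //; split => /=.
apply: bigcupT_measurable => j; apply: measurableI.
  exact: grid_stop_measurable sk.
apply: (@filtration_measurable (grid n j)); first exact: grid_ge0.
apply: (fm_adapted fm (grid_ge0 n j)); apply: sub_sigma_algebra.
by apply: closed_openC; apply: compact_closed cK; exact: metric_hausdorff.
Qed.

Lemma grid_index_le n j (H : R) : grid n j <= H -> (j <= up n H)%N.
Proof.
move=> jH; have H0 := le_trans (grid_ge0 n j) jH.
by rewrite ltnW// -(@ltr_grid R n) (le_lt_trans jH)// rd_gt.
Qed.

(** Take a cutoff phi with T_H phi(y) > 1 - eps/4 for y near x, and K such that
    T_r phi <= eps/4 off K for all r <= H. Restarting at the grid time for the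
    remaining time r, a path that is outside K at the grid time contributes at
    most eps/4 to T_H phi(y); so few paths are outside. *)
Lemma compact_containment x (H : R) eps : 0 <= H -> 0 < eps ->
  exists2 K, compact K & \forall y \near x, forall n k, grid_stop n k ->
    (forall om, grid n (k om) <= H) ->
    expect (P y) (\1_(outside n k K)) <= eps.
Proof.
move=> H0 eps0; have e4 : 0 < eps / 4 by rewrite divr_gt0.
have [phi [cphi phi01 phiK Tphi]] := tight_bump x H0 e4.
have phiM y : `|phi y| <= 1.
  by have /andP[p0 p1] := phi01 y; rewrite ger0_norm.
have Cphi : Cb phi by split => //; exists 1.
have vphi := compact_support_vanishing cphi phiK.
have [K cK KP] := semigroup_uniform_decay H vphi phi01 e4.
exists K => //.
have nearphi : \forall y \near x, 1 - eps / 4 < T H phi y.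
  by apply: cvgr_gt Tphi; exact: semigroup_continuous.
near=> y => n k sk kH.
have yphi : 1 - eps / 4 < T H phi y by near: y.
have [N kN] : exists N, forall om, (k om <= N)%N.
  by exists (up n H) => om; exact: grid_index_le.
pose r j : R := Num.max 0 (H - grid n j).
have r0 j : (j <= N)%N -> 0 <= r j by move=> _; rewrite le_max lexx.
have rE om : r (k om) = H - grid n (k om).
  by rewrite /r; apply/max_idPr; rewrite subr_ge0.
have rH j : r j <= H by rewrite ge_max H0 gerBl grid_ge0.
have mO := outside_measurable sk kN cK.
have iO : summable_rv (P y) (\1_(outside n k K) : Om -> R).
  by apply: bounded_summable; exact: bounded_rv_indic.
have : T H phi y <= 1 + eps / 4 - expect (P y) (\1_(outside n k K)).
  rewrite semigroupE (_ : expect (P y) (fun om => phi (X H om)) =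
      expect (P y) (fun om => phi (X (grid n (k om) + r (k om)) om))); last first.
    by apply: expect_ext => om; rewrite rE addrC subrK.
  rewrite (grid_markov y sk kN)//.
  rewrite -[in leRHS](expect_cst (P y) (1 + eps / 4)) -expectB//; last first.
    exact: summable_cst.
  apply: expect_le.
  - apply: (@grid_path_summable y n k N (fun j => T (r j) phi)) => // j jN.
    by apply: semigroup_Cb => //; exact: r0.
  - by apply: summableB => //; exact: summable_cst.
  - move=> om; rewrite indicE; have [nKo|Ko] := boolP (om \in outside n k K).
      rewrite inE in nKo; rewrite addrC addKr.
      by apply: (KP _ nKo); rewrite rH r0.
    rewrite subr0; apply: (@le_trans _ _ 1); last by rewrite lerDl ltW.
    by apply: le_trans (ler_norm _) _; apply: semigroup_bound => //; exact: r0.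
lra.
Unshelve. all: by end_near. Qed.

(** Rounding up waits for a time less than 2^-n after the grid time. On the compact
    set of the containment lemma such a wait moves w little, uniformly; off that
    set the error is at most 2 M times a small probability. The level n does not
    depend on the finer level n + m. *)
Lemma rounding_error x (H : R) eps (w : E -> R) : 0 <= H -> 0 < eps -> Cb w ->
  exists n0, \forall y \near x, forall n m k, (n0 <= n)%N ->
    grid_stop (n + m) k -> (forall om, grid (n + m) (k om) <= H) ->
    expect (P y) (fun om => w (X (grid n (k om %/ 2 ^ m).+1) om)) <=
    expect (P y) (fun om => w (X (grid (n + m) (k om)) om)) + eps.
Proof.
move=> H0 eps0 Cw; have [cw [M wM]] := Cw.
have M0 : 0 <= M by exact: le_trans (normr_ge0 _) (wM point).
have M1 : 0 < 4 * (M + 1) by rewrite mulr_gt0// ltr_wpDl.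
have eM : 0 < eps / (4 * (M + 1)) by rewrite divr_gt0.
have e2 : 0 < eps / 2 by rewrite divr_gt0.
have [K cK nearK] := compact_containment x H0 eM.
have [t0 t0_gt0 tP] := semigroup_compact_uniform Cw cK e2.
have [n0 _ n0P] : \forall n \near \oo, @mesh R n < t0.
  by have /cvgr_lt := @mesh_cvg R; exact.
exists n0; near=> y => n m k nn0 sk kH.
have yK : expect (P y) (\1_(outside (n + m) k K)) <= eps / (4 * (M + 1)).
  by move: (n + m)%N k sk kH; near: y.
have [N kN] : exists N, forall om, (k om <= N)%N.
  by exists (up (n + m) H) => om; exact: grid_index_le.
pose r j : R := grid n (j %/ 2 ^ m).+1 - grid (n + m) j.
have rlt j : 0 <= r j <= mesh n by exact: round_up_bounds.
have rE j : grid (n + m) j + r j = grid n (j %/ 2 ^ m).+1.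
  by rewrite /r addrC subrK.
have mO := outside_measurable sk kN cK.
have iO : summable_rv (P y) (\1_(outside (n + m) k K) : Om -> R).
  by apply: bounded_summable; exact: bounded_rv_indic.
have r0 j : (j <= N)%N -> 0 <= r j by have /andP[] := rlt j.
have iw : summable_rv (P y) (fun om => w (X (grid (n + m) (k om)) om)).
  exact: (@grid_path_summable y (n + m) k N (fun=> w)).
have : expect (P y) (fun om => w (X (grid n (k om %/ 2 ^ m).+1) om)) <=
    expect (P y) (fun om => w (X (grid (n + m) (k om)) om)) +
    (eps / 2 + 2 * M * expect (P y) (\1_(outside (n + m) k K))).
  rewrite (_ : expect (P y) (fun om => w (X (grid n (k om %/ 2 ^ m).+1) om)) =
      expect (P y) (fun om => w (X (grid (n + m) (k om) + r (k om)) om))); last first.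
    by apply: expect_ext => om; rewrite rE.
  rewrite (grid_markov y sk kN r0)//.
  rewrite -[X in _ + (X + _)](expect_cst (P y)) -expectZ// -expectD//; last 2 first.
  - exact: summable_cst.
  - exact: summableZ.
  rewrite -expectD//; last by apply: summableD; [exact: summable_cst|exact: summableZ].
  apply: expect_le.
  - apply: (@grid_path_summable y _ k N (fun j => T (r j) w)) => // j jN.
    by apply: semigroup_Cb => //; exact: r0.
  - apply: summableD => //.
    by apply: summableD; [exact: summable_cst|exact: summableZ].
  - move=> om; rewrite indicE.
    have [nKo|Ko] := boolP (om \in outside (n + m) k K).
      rewrite mulr1.
      have := wM (X (grid (n + m) (k om)) om).
      have := semigroup_bound cw wM (r0 _ (kN om)) (X (grid (n + m) (k om)) om).
      by rewrite !ler_norml => /andP[? ?] /andP[? ?]; lra.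
    rewrite mulr0 addr0.
    have KX : K (X (grid (n + m) (k om)) om).
      by apply: contrapT => nK; move: Ko; rewrite mem_set.
    have rt0 : 0 <= r (k om) <= t0.
      have /andP[-> rm] := rlt (k om).
      by rewrite (le_trans rm)// ltW// n0P.
    by have := tP _ KX _ rt0; rewrite ler_norml => /andP[? ?]; lra.
have : 2 * M * expect (P y) (\1_(outside (n + m) k K)) <= eps / 2.
  apply: (@le_trans _ _ (2 * M * (eps / (4 * (M + 1))))).
    by rewrite ler_wpM2l// mulr_ge0.
  have -> : 2 * M * (eps / (4 * (M + 1))) = eps / 2 * (M / (M + 1)).
    by field; rewrite gt_eqF// ltr_wpDl.
  by rewrite ler_piMr ?(ltW e2)// ler_pdivrMr ?ltr_wpDl// mul1r lerDl.
lra.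
Unshelve. all: by end_near. Qed.

(** * Bounded stopping times *)

(** Optional times are stopping times of the right continuous filtration, which is
    not assumed to be F; entrance times into open sets are only of this kind. *)
Definition optional_time (tau : Om -> R) : Prop :=
  (forall om, 0 <= tau om) /\ forall t, 0 <= t -> F t [set om | tau om < t].

Definition real_stopping_time (tau : Om -> R) : Prop :=
  (forall om, 0 <= tau om) /\ forall t, 0 <= t -> F t [set om | tau om <= t].

Lemma stopping_of_real tau : real_stopping_time tau ->
  stopping_time F (fun om => (tau om)%:E).
Proof.
move=> [tau0 Ftau]; split=> [om|t t0]; first by rewrite lee_fin.
rewrite (_ : [set _ | _] = [set om | tau om <= t]); first exact: Ftau.
by apply/seteqP; split => om /=; rewrite lee_fin.
Qed.

Lemma stopping_optional tau : real_stopping_time tau -> optional_time tau.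
Proof.
move=> [tau0 Ftau]; split => // t t0.
rewrite (_ : [set _ | _] = \bigcup_n (if 0 <= t - mesh n then
    [set om | tau om <= t - mesh n] else set0)).
  apply: filtration_bigcup => // n; case: ifPn => tn; last exact: filtration0.
  by apply: filtrationW (Ftau _ tn) => //; rewrite gerBl ltW// mesh_gt0.
apply/seteqP; split => om /=.
  move=> taut; have d0 : 0 < t - tau om by rewrite subr_gt0.
  have /cvgr_lt /(_ (t - tau om) d0) [n _ /(_ n (leqnn n)) /= nd] := @mesh_cvg R.
  exists n => //; rewrite ifT /=; first by rewrite lerBrDr -lerBrDl ltW.
  by rewrite subr_ge0 (le_trans (ltW nd))// gerBl.
move=> [n _]; case: ifPn => //= _ le; rewrite (le_lt_trans le)// gtrBl.
exact: mesh_gt0.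
Qed.

Lemma optional_measurable tau : optional_time tau -> measurable_fun setT tau.
Proof.
move=> [tau0 Ftau]; apply: (measurability _ (RGenCInfty.measurableE R)).
move=> _ [_ [t ->] <-]; rewrite setTI.
have [t0|t0] := leP 0 t.
  rewrite (_ : _ @^-1` _ = ~` [set om | tau om < t]).
    apply: measurableC; apply: (@filtration_measurable t) => //; exact: Ftau.
  apply/seteqP; split => om /=; rewrite in_itv/= andbT.
    by rewrite leNgt => /negP.
  by move=> /negP; rewrite -leNgt.
rewrite (_ : _ @^-1` _ = setT); first exact: measurableT.
apply/seteqP; split => om //= _; rewrite in_itv/= andbT.
by rewrite (le_trans (ltW t0)).
Qed.

Lemma grid_stop_up tau n : optional_time tau ->
  grid_stop n (fun om => up n (tau om)).
Proof.
move=> [tau0 Ftau] j; rewrite (_ : [set _ | _] = [set om | tau om < grid n j]).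
  by apply: Ftau; exact: grid_ge0.
by apply/seteqP; split => om /=; rewrite up_le.
Qed.

Lemma grid_stopping_time n k : grid_stop n k ->
  real_stopping_time (fun om => grid n (k om)).
Proof.
move=> sk; split=> [om|t t0]; first exact: grid_ge0.
rewrite (_ : [set _ | _] = [set om | (k om <= (up n t).-1)%N]).
  apply: filtrationW (sk _) => //; first exact: grid_ge0.
  by rewrite leNgt -up_le//= ltnn.
apply/seteqP; split => om /=.
  by move=> kt; rewrite -ltnS /= -(@ltr_grid R n) (le_lt_trans kt)// rd_gt.
move=> kt; apply: (@le_trans _ _ (grid n (up n t).-1)); first by rewrite ler_grid.
by rewrite leNgt -up_le//= ltnn.
Qed.

Lemma stop_measurable n k (Y : nat -> Om -> R) : grid_stop n k ->
  (forall j, measurable_fun setT (Y j)) ->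
  measurable_fun setT (fun om => Y (k om) om).
Proof.
move=> sk mY _ B mB; rewrite setTI.
rewrite (_ : _ @^-1` _ = \bigcup_j ([set om | k om == j] `&` (Y j @^-1` B))).
  apply: bigcupT_measurable => j; apply: measurableI.
    exact: grid_stop_measurable sk.
  by rewrite -[X in measurable X]setTI; exact: mY.
apply/seteqP; split => [om Bom|om [j _ [/eqP <-]]//].
by exists (k om) => //; split => /=.
Qed.

Lemma optional_path_cvg tau om : optional_time tau ->
  X (rd n (tau om)) om @[n --> \oo] --> X (tau om) om.
Proof.
by move=> [tau0 _]; apply: path_rc => // [n|]; [exact: rd_ge|exact: rd_cvg].
Qed.

Lemma optional_path_measurable (h : E -> R) tau : continuous h ->
  optional_time tau -> measurable_fun setT (fun om => h (X (tau om) om)).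
Proof.
move=> ch otau.
apply: (@measurable_fun_cvg _ _ _ _ (fun n om => h (X (rd n (tau om)) om))).
  move=> n; apply: (@stop_measurable n _ (fun j om => h (X (grid n j) om))).
    exact: grid_stop_up.
  by move=> j; apply: path_measurable => //; exact: grid_ge0.
by move=> om _; apply: continuous_cvg; [exact: ch|exact: optional_path_cvg].
Qed.

Lemma optional_path_bounded (h : E -> R) tau : Cb h ->
  optional_time tau -> bounded_rv (fun om => h (X (tau om) om)).
Proof.
move=> [ch [M hM]] otau; split; first exact: optional_path_measurable.
by exists M.
Qed.

(** * Running costs *)

Section running_cost.
Variables (h : E -> R) (M : R).
Hypotheses (ch : continuous h) (hM : forall x, `|h x| <= M).

Let rcb om t : 0 <= t -> rc_bounded (fun s => h (X (t + s) om)) M.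
Proof.
move=> t0; have := path_rc_bounded om ler01 t0 ch hM.
by congr (rc_bounded _ _); apply/funext => s; rewrite mul1r.
Qed.

Let rcb0 om : rc_bounded (fun s => h (X s om)) M.
Proof.
have := rcb om (lexx 0).
by congr (rc_bounded _ _); apply/funext => s; rewrite add0r.
Qed.

Lemma running_costE r om : running_cost X h r om =
  wint (box r) (fun s => h (X s om)).
Proof.
have i := wint_integrable (weight_box r) (rcb0 om).
have eqf : (fun s => box r s * h (X s om)) = (fun s => h (X s om)) \_ `[0, r[.
  by apply/funext => s; rewrite patchE /box indicE; case: ifP; rewrite ?mul1r ?mul0r.
rewrite /running_cost -Rintegral_itv_bndo_bndc.
  by rewrite Rintegral_mkcond /wint eqf.
apply/integrable_mkcond => //.
by rewrite restrict_EFin -eqf.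
Qed.

Lemma running_cost_split a b om : 0 <= a -> 0 <= b ->
  running_cost X h (a + b) om =
  running_cost X h a om + wint (box b) (fun s => h (X (a + s) om)).
Proof.
move=> a0 b0; rewrite !running_costE; apply: (@wint_box_split _ _ M) => //.
by have [+ _] := rcb om a0.
Qed.

Lemma running_cost_lipschitz a b om : 0 <= a -> 0 <= b ->
  `|running_cost X h a om - running_cost X h b om| <= M * `|a - b|.
Proof.
wlog ab : a b / a <= b.
  move=> wl a0 b0; have [ab|/ltW ba] := leP a b; first exact: wl.
  by rewrite distrC (distrC a); exact: wl.
move=> a0 b0; have d0 : 0 <= b - a by rewrite subr_ge0.
have -> : running_cost X h b om = running_cost X h (a + (b - a)) om.
  by rewrite (addrC a) subrK.
rewrite running_cost_split// opprD addrA subrr add0r normrN.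
apply: le_trans (wint_bound (weight_box _) (rcb om a0)) _.
by rewrite wint_box1// distrC (ger0_norm d0).
Qed.

Lemma running_cost_cvg (u : nat -> R) (r : R) om : (forall n, 0 <= u n) -> 0 <= r ->
  u n @[n --> \oo] --> r ->
  running_cost X h (u n) om @[n --> \oo] --> running_cost X h r om.
Proof.
move=> u0 r0 ur; apply/cvgrPdist_le => e e0.
have M0 : 0 <= M by exact: le_trans (normr_ge0 _) (hM point).
have eM : 0 < e / (M + 1) by rewrite divr_gt0// ltr_wpDl.
have /cvgrPdist_lt /(_ _ eM) near_u := ur.
near=> n; apply: le_trans (running_cost_lipschitz om r0 (u0 n)) _.
have : `|r - u n| < e / (M + 1) by near: n.
rewrite ltr_pdivlMr ?ltr_wpDl// => lt.
apply: le_trans (ltW lt); rewrite mulrC ler_wpM2l//; lra.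
Unshelve. all: by end_near. Qed.

(** The running cost up to tau is the integral over [0, H[ of a process that is
    right continuous and is cut off at tau, whence its measurability. *)
Lemma running_cost_bounded (tau : Om -> R) (H : R) : optional_time tau ->
  (forall om, tau om <= H) -> bounded_rv (fun om => running_cost X h (tau om) om).
Proof.
move=> otau tauH; have [tau0 _] := otau.
pose G s om := if s < tau om then h (X s om) else 0.
have -> : (fun om => running_cost X h (tau om) om) =
    (fun om => wint (box H) (G ^~ om)).
  apply/funext => om; rewrite running_costE; apply: eq_Rintegral => s _.
  rewrite !boxE /G; have [s0|s0]/= := leP 0 s; last by rewrite !mul0r.
  case: ifPn => st; last by rewrite mul0r mulr0.
  by rewrite (lt_le_trans st (tauH om)).
apply: (@wint_bounded_rv _ _ (weight_box H) _ _ (P point) _ M) => [s s0|om].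
  apply: measurable_fun_ifT; last exact: measurable_cst.
    apply: measurable_fun_ltr; first exact: measurable_cst.
    exact: optional_measurable.
  exact: path_measurable.
have [crc brc] := rcb0 om.
split=> s s0; rewrite /G; last first.
  by case: ifPn => _; [exact: brc|rewrite normr0 (le_trans (normr_ge0 _) (hM point))].
case: ifPn => st; last first.
  rewrite (_ : (fun _ => _) = (fun=> 0)); first exact: cvg_cst.
  apply/funext => n; rewrite ifF//; apply/negbTE; rewrite -leNgt.
  by rewrite (le_trans _ (rd_ge n s0))// leNgt.
apply: cvg_trans (crc s s0); apply: near_eq_cvg.
near=> n; rewrite ifT//; near: n.
by have /cvgr_lt := rd_cvg s0; exact.
Unshelve. all: by end_near. Qed.

Lemma running_cost_expect t x : 0 <= t ->
  expect (P x) (fun om => running_cost X h t om) = potential (box t) 1 h x.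
Proof.
move=> t0; rewrite /potential.
transitivity (expect (P x) (fun om => wint (box t) (fun s => h (X s om)))).
  by apply: expect_ext => om; rewrite running_costE.
rewrite (@wint_expect _ _ (weight_box t) _ _ _ _ M)//.
  by apply: eq_Rintegral => s _; rewrite mul1r.
by move=> s s0; exact: path_measurable.
Qed.

End running_cost.

(** * Quasi-left-continuity *)

(** The layer-cake decomposition, with an error of one layer. *)
Lemma layer_sum (N : nat) (y : R) : 0 <= y <= N%:R ->
  `|y - \sum_(0 <= i < N) (i.+1%:R <= y)%R%:R| <= 1.
Proof.
move=> /andP[y0 yN].
have -> : \sum_(0 <= i < N) (i.+1%:R <= y)%R%:R = (Num.truncn y)%:R :> R.
  have tN : (Num.truncn y <= N)%N.
    by rewrite truncn_le_nat (le_lt_trans yN)// ltr_nat.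
  rewrite (big_cat_nat (n := Num.truncn y))//= [X in X + _](_ : _ = (Num.truncn y)%:R).
    rewrite [X in _ + X]big1_seq ?addr0// => i.
    rewrite mem_index_iota => /andP[_ /andP[ti _]].
    by rewrite -truncn_ge_nat// leqNgt ltnS ti.
  rewrite big_nat_cond (eq_bigr (fun=> 1)) => [|i /andP[/andP[_ it] _]].
    by rewrite -big_nat_cond sumr_const_nat subn0.
  by rewrite -truncn_ge_nat// it.
have /andP[t1 t2] := truncn_itv y0.
move: t2; rewrite -natr1 => t2.
by rewrite ger0_norm ?subr_ge0// lerBlDl addrC ltW// addrC.
Qed.

(** For an event A the factor g(X_s) is approximated by a finite combination of
    indicators of events in F s, for which the Markov property is known. The
    approximation is uniform within 1/K. *)
Lemma markov_weighted x s t A (g h : E -> R) : 0 <= s -> 0 <= t -> F s A ->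
  Cb g -> Cb h ->
  expect (P x) (fun om => \1_A om * (g (X s om) * h (X (s + t) om))) =
  expect (P x) (fun om => \1_A om * (g (X s om) * T t h (X s om))).
Proof.
move=> s0 t0 FA Cg Ch; have [cg [M gM]] := Cg; have [ch [Mh hM]] := Ch.
have st0 : 0 <= s + t by rewrite addr_ge0.
have M0 : 0 <= M by exact: le_trans (normr_ge0 _) (gM point).
have Mh0 : 0 <= Mh by exact: le_trans (normr_ge0 _) (hM point).
have mA := filtration_measurable s0 FA.
have CT := semigroup_Cb Ch t0.
pose D om := h (X (s + t) om) - T t h (X s om).
have iD : summable_rv (P x) D.
  by apply: summableB; apply: path_summable.
have bD : bounded_rv D.
  split; first exact: summable_measurable iD.
  exists (Mh + Mh) => om; rewrite (le_trans (ler_normB _ _))// lerD//.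
  exact: semigroup_bound.
have Dzero B : F s B -> expect (P x) (fun om => \1_B om * D om) = 0.
  move=> FB; have mB := filtration_measurable s0 FB.
  rewrite (_ : expect _ _ = expect (P x) (fun om => \1_B om * h (X (s + t) om) -
      \1_B om * T t h (X s om))).
    rewrite expectB; [|by apply: summable_indicM => //; apply: path_summable..].
    by rewrite (markov_property x s0 t0 FB Ch) subrr.
  by apply: expect_ext => om; rewrite mulrBr.
have bgA : bounded_rv (fun om => \1_A om * g (X s om)).
  by apply: bounded_rv_indicM => //; exact: path_bounded.
have igD : summable_rv (P x) (fun om => \1_A om * g (X s om) * D om).
  have [mg _] := bgA; have [mD _] := bD.
  apply: bounded_summable; split; first exact: measurable_funM.
  exists (M * (Mh + Mh)) => om; rewrite normrM ler_pM//.
    by rewrite normrM (le_trans _ (gM (X s om)))// ler_piMl// indicE; case: (_ \in _); rewrite ?normr1 ?normr0.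
  rewrite (le_trans (ler_normB _ _))// lerD//; exact: semigroup_bound.
have gDzero : expect (P x) (fun om => \1_A om * g (X s om) * D om) = 0.
  apply/eqP; rewrite -normr_le0; apply/ler_addgt0Pr => e e0; rewrite add0r.
  (* K layers per unit of height: the error 2 Mh / K of the layers is below e *)
  pose K : R := (2 * Mh) / e + 1.
  have K0 : 0 < K by rewrite ltr_wpDl// divr_ge0 ?mulr_ge0// ltW.
  pose N := (Num.truncn (K * (2 * M))).+1.
  pose y om := K * (g (X s om) + M).
  have yN om : 0 <= y om <= N%:R.
    have := gM (X s om); rewrite ler_norml => /andP[g1 g2].
    rewrite mulr_ge0 ?(ltW K0)//=; last by rewrite -lerBlDr sub0r.
    apply: (@le_trans _ _ (K * (2 * M))); last exact: ltW (truncnS_gt _).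
    by rewrite ler_wpM2l ?(ltW K0)//; lra.
  pose B i := A `&` [set om | i.+1%:R <= y om].
  have FB i : F s (B i).
    apply: filtrationI => //.
    have cy : continuous (fun z => K * (g z + M)).
      by have [] : Cb (fun z => K * (g z + M)) by apply: CbM; [exact: Cb_cst|apply: CbD => //; exact: Cb_cst].
    have mB : measurable [set` `[(i.+1%:R:R), +oo[ ] by exact: measurable_itv.
    have := path_adapted cy s0 mB.
    by congr (F _ _); apply/seteqP; split => om /=; rewrite in_itv/= andbT.
  have iBD i : summable_rv (P x) (fun om => \1_(B i) om * D om).
    by apply: summable_indicM => //; exact: (filtration_measurable s0 (FB i)).
  have iSD : summable_rv (P x) (fun om => \sum_(0 <= i < N) \1_(B i) om * D om).
    exact: summable_sum.
  have iAD : summable_rv (P x) (fun om => \1_A om * D om) by exact: summable_indicM.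
  have sumzero : expect (P x) (fun om => \sum_(0 <= i < N) \1_(B i) om * D om) = 0.
    by rewrite expect_sum//; apply: big1 => i _; exact: Dzero.
  have iyD : summable_rv (P x) (fun om => \1_A om * y om * D om).
    have := summableZ K (summableD igD (summableZ M iAD)).
    by congr (is_true (_.-integrable _ _)); apply/funext => om /=; congr (_%:E); rewrite /y; ring.
  have -> : expect (P x) (fun om => \1_A om * g (X s om) * D om) =
      expect (P x) (fun om => K^-1 * (\1_A om * y om * D om - \sum_(0 <= i < N) \1_(B i) om * D om)).
    rewrite expectZ; last exact: summableB.
    rewrite expectB// sumzero subr0.
    have -> : expect (P x) (fun om => \1_A om * y om * D om) =
        expect (P x) (fun om => K * (\1_A om * g (X s om) * D om) + K * M * (\1_A om * D om)).
      by apply: expect_ext => om; rewrite /y; ring.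
    rewrite expectD; [|exact: summableZ|exact: summableZ].
    by rewrite !expectZ// (Dzero A)// mulr0 addr0 mulKf// gt_eqF.
  apply: le_trans (_ : expect (P x) (fun=> K^-1 * (Mh + Mh)) <= _); last first.
    rewrite expect_cst mulrC ler_pdivrMr// /K mulrDr mulrC divfK ?gt_eqF//; lra.
  apply: expect_abs; last 2 first.
  - exact: summable_cst.
  - move=> om; rewrite normrM ger0_norm ?invr_ge0 ?(ltW K0)//.
    rewrite ler_wpM2l ?invr_ge0 ?(ltW K0)//.
    have D2 : `|D om| <= Mh + Mh.
      rewrite (le_trans (ler_normB _ _))// lerD//; exact: semigroup_bound.
    rewrite -mulr_suml -mulrBl normrM -[leRHS]mul1r ler_pM//.
    rewrite (_ : \sum_(0 <= i < N) \1_(B i) om =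
        \1_A om * \sum_(0 <= i < N) (i.+1%:R <= y om)%R%:R); last first.
      rewrite mulr_sumr; apply: eq_bigr => i _; rewrite !indicE /B in_setI.
      have -> : (om \in [set om0 | i.+1%:R <= y om0]) = (i.+1%:R <= y om).
        by apply/idP/idP; rewrite inE.
      by rewrite -mulnb natrM.
    rewrite -mulrBr normrM (le_trans _ (layer_sum (yN om)))// ler_piMl//.
    by rewrite indicE; case: (_ \in _); rewrite ?normr1 ?normr0.
  - apply: (@summable_measurable _ _ _ (P x)).
    exact: summableZ (summableB iyD iSD).
have prod_summable (k : E -> R) r : Cb k -> 0 <= r ->
    summable_rv (P x) (fun om => \1_A om * (g (X s om) * k (X r om))).
  move=> Ck r0; apply: summable_indicM => //; apply: bounded_summable.
  have [mg [M1 g1]] := path_bounded Cg s0; have [mk [M2 k2]] := path_bounded Ck r0.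
  split; first exact: measurable_funM.
  by exists (M1 * M2) => om; rewrite normrM ler_pM.
apply/eqP; rewrite -subr_eq0 -expectB; [|exact: prod_summable..].
rewrite -[X in _ == X]gDzero; apply/eqP; apply: expect_ext => om.
by rewrite /D; ring.
Qed.

Lemma expect_prod_cvg x (u v : nat -> Om -> E) (u' v' : Om -> E) (g h : E -> R) :
  Cb g -> Cb h -> (forall n, measurable_fun setT (g \o u n)) ->
  (forall n, measurable_fun setT (h \o v n)) ->
  (forall om, u n om @[n --> \oo] --> u' om) ->
  (forall om, v n om @[n --> \oo] --> v' om) ->
  summable_rv (P x) (fun om => g (u' om) * h (v' om)) /\
  expect (P x) (fun om => g (u n om) * h (v n om)) @[n --> \oo] -->
  expect (P x) (fun om => g (u' om) * h (v' om)).
Proof.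
move=> [cg [M gM]] [ch [N hN]] mgu mhv uu' vv'.
apply: (@expect_dominated _ _ _ _ _ _ (fun=> M * N)).
- by move=> n; apply: measurable_funM; [exact: mgu|exact: mhv].
- exact: summable_cst.
- by move=> n om; rewrite normrM ler_pM.
- move=> om; apply: cvgM.
    by apply: (@cvg_comp _ _ _ (u ^~ om) g _ _ _ (uu' om)); exact: cg.
  by apply: (@cvg_comp _ _ _ (v ^~ om) h _ _ _ (vv' om)); exact: ch.
Qed.

Lemma expect_prod_unique x (u1 v1 u2 v2 : nat -> Om -> E) (g1 h1 g2 h2 : E -> R)
  (u1' v1' u2' v2' : Om -> E) :
  Cb g1 -> Cb h1 -> Cb g2 -> Cb h2 ->
  (forall n, measurable_fun setT (g1 \o u1 n)) ->
  (forall n, measurable_fun setT (h1 \o v1 n)) ->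
  (forall n, measurable_fun setT (g2 \o u2 n)) ->
  (forall n, measurable_fun setT (h2 \o v2 n)) ->
  (forall om, u1 n om @[n --> \oo] --> u1' om) ->
  (forall om, v1 n om @[n --> \oo] --> v1' om) ->
  (forall om, u2 n om @[n --> \oo] --> u2' om) ->
  (forall om, v2 n om @[n --> \oo] --> v2' om) ->
  (forall n, expect (P x) (fun om => g1 (u1 n om) * h1 (v1 n om)) =
             expect (P x) (fun om => g2 (u2 n om) * h2 (v2 n om))) ->
  expect (P x) (fun om => g1 (u1' om) * h1 (v1' om)) =
  expect (P x) (fun om => g2 (u2' om) * h2 (v2' om)).
Proof.
move=> Cg1 Ch1 Cg2 Ch2 mg1 mh1 mg2 mh2 U1 V1 U2 V2 eq12.
have [_ c1] := expect_prod_cvg x Cg1 Ch1 mg1 mh1 U1 V1.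
have [_ c2] := expect_prod_cvg x Cg2 Ch2 mg2 mh2 U2 V2.
apply: (@cvg_unique _ (@norm_hausdorff _ R^o) _ _ _ _ c1).
by rewrite (_ : (fun n => _) = (fun n => expect (P x) (fun om => g2 (u2 n om) * h2 (v2 n om))))//; apply/funext => n; exact: eq12.
Qed.

(** Known on the grid; let the grid times decrease to tau. The function T_r h is
    continuous, so right continuity of the paths suffices. *)
Lemma strong_markov x tau (H r : R) (g h : E -> R) : optional_time tau ->
  (forall om, tau om <= H) -> 0 <= r -> Cb g -> Cb h ->
  expect (P x) (fun om => g (X (tau om) om) * h (X (tau om + r) om)) =
  expect (P x) (fun om => g (X (tau om) om) * T r h (X (tau om) om)).
Proof.
move=> otau tauH r0 Cg Ch; have CT := semigroup_Cb Ch r0.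
have [tau0 _] := otau.
have sn n := grid_stop_up n otau.
have mX (k : E -> R) (a : R) n : Cb k -> 0 <= a ->
    measurable_fun setT (k \o (fun om => X (rd n (tau om) + a) om)).
  move=> [ck _] a0.
  apply: (@stop_measurable n _ (fun j om => k (X (grid n j + a) om))) => // j.
  by apply: path_measurable => //; rewrite addr_ge0// grid_ge0.
have mX0 (k : E -> R) n : Cb k -> measurable_fun setT (k \o (fun om => X (rd n (tau om)) om)).
  move=> Ck; have := mX k 0 n Ck (lexx 0).
  by congr (measurable_fun _ _); apply/funext => om /=; rewrite addr0.
have cX0 om := @optional_path_cvg tau om otau.
have cX (om : Om) : X (rd n (tau om) + r) om @[n --> \oo] --> X (tau om + r) om.
  apply: path_rc; first by rewrite addr_ge0.
    by move=> n; rewrite lerD2r rd_ge.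
  by apply: cvgD; [exact: rd_cvg|exact: cvg_cst].
apply: (expect_prod_unique (g1 := g) (h1 := h) (g2 := g) (h2 := T r h)
  (u1 := fun n om => X (rd n (tau om)) om) (u2 := fun n om => X (rd n (tau om)) om)
  (v1 := fun n om => X (rd n (tau om) + r) om)
  (v2 := fun n om => X (rd n (tau om)) om)) => //.
- by move=> n; exact: mX0.
- by move=> n; exact: mX.
- by move=> n; exact: mX0.
- by move=> n; exact: mX0.
move=> n.
have kN om : (up n (tau om) <= up n H)%N.
  by rewrite ltnS; apply: le_truncn; rewrite ler_wpM2r// exprn_ge0.
have prod_summable (k : E -> R) (a : R) j : Cb k -> 0 <= a ->
    summable_rv (P x) (fun om => g (X (grid n j) om) * k (X (grid n j + a) om)).
  move=> Ck a0; apply: bounded_summable.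
  have [mg [M1 g1]] := path_bounded Cg (grid_ge0 n j).
  have [mk [M2 k2]] := path_bounded Ck (addr_ge0 (grid_ge0 n j) a0).
  split; first exact: measurable_funM.
  by exists (M1 * M2) => om; rewrite normrM ler_pM.
have [_ ->] := @expect_stop (P x) n _ (up n H)
  (fun j om => g (X (grid n j) om) * h (X (grid n j + r) om)) (sn n) kN
  (fun j _ => prod_summable h r j Ch r0).
have prod0 j : summable_rv (P x) (fun om => g (X (grid n j) om) * T r h (X (grid n j) om)).
  have := prod_summable (T r h) 0 j CT (lexx 0).
  by congr (summable_rv _ _); apply/funext => om /=; rewrite addr0.
have [_ ->] := @expect_stop (P x) n _ (up n H)
  (fun j om => g (X (grid n j) om) * T r h (X (grid n j) om)) (sn n) kN
  (fun j _ => prod0 j).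
apply: eq_bigr => j _; apply: markov_weighted => //; first exact: grid_ge0.
exact: grid_stop_eq.
Qed.

Lemma path_left_cvg om t (l : E) (u : nat -> R) : X s om @[s --> t^'-] --> l ->
  (forall n, u n < t) -> u n @[n --> \oo] --> t ->
  X (u n) om @[n --> \oo] --> l.
Proof.
move=> Xl ult ut V /Xl [e /= e0 eV].
have /cvgrPdist_lt /(_ e e0) [N _ uN] := ut.
by exists N => // n /uN /= tun; exact: eV.
Qed.

Lemma nondecreasing_path_cvg om (u : nat -> R) t : (forall n, 0 <= u n) ->
  nondecreasing_seq u -> u n @[n --> \oo] --> t -> cvgn (fun n => X (u n) om).
Proof.
move=> u0 nu ut.
have ule n : u n <= t.
  have ct : limn u = t by apply: cvg_lim => //; exact: norm_hausdorff.
  by rewrite -ct; apply: nondecreasing_cvgn_le => //; exact: cvgP ut.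
have [[n un]|nt] := pselect (exists n, u n = t).
  apply: (cvgP (X t om)); apply: cvg_near_cst; exists n => // k /= nk.
  by congr X; apply/eqP; rewrite eq_le ule -un nu.
have ult n : u n < t.
  by rewrite lt_neqAle ule andbT; apply/eqP => unt; apply: nt; exists n.
have [l Xl] := fm_left_limits fm om (le_lt_trans (u0 0%N) (ult 0%N)).
exact: cvgP (path_left_cvg Xl ult ut).
Qed.

Lemma optional_shift tau r : 0 <= r -> optional_time tau ->
  optional_time (fun om => tau om + r).
Proof.
move=> r0 [tau0 Ft]; split=> [om|t t0]; first by rewrite addr_ge0.
have [rt|tr] := leP r t.
  apply: (@filtrationW (t - r)); [by rewrite subr_ge0|by rewrite gerBl|].
  have := Ft (t - r); rewrite subr_ge0 => /(_ rt).
  by congr (F _ _); apply/seteqP; split => om /=; rewrite ltrBrDr.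
rewrite (_ : mkset _ = set0); first exact: filtration0.
apply/seteqP; split => om //=; apply/negP; rewrite -leNgt.
by rewrite (le_trans (ltW tr))// lerDr.
Qed.

Section quasi_left_continuity.
Variables (sg : nat -> Om -> R) (sigma : Om -> R) (H : R).
Hypothesis osg : forall n, optional_time (sg n).
Hypothesis sgS : forall om, nondecreasing_seq (sg ^~ om).
Hypothesis sgH : forall n om, sg n om <= H.
Hypothesis sg_cvg : forall om, sg n om @[n --> \oo] --> sigma om.

Let sg_ge0 n om : 0 <= sg n om. Proof. by have [+ _] := osg n; exact. Qed.

Let sg_le n om : sg n om <= sigma om.
Proof.
have <- : limn (sg ^~ om) = sigma om by apply: cvg_lim => //; exact: norm_hausdorff.
apply: (@nondecreasing_cvgn_le _ (sg ^~ om)); first exact: sgS.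
by apply/cvg_ex; exists (sigma om); exact: sg_cvg.
Qed.

Lemma limit_optional : optional_time sigma.
Proof.
split=> [om|t t0]; first exact: le_trans (sg_ge0 0%N om) (sg_le 0%N om).
rewrite (_ : mkset _ = \bigcup_k ~` (\bigcup_n ~` [set om | sg n om < t - k.+1%:R^-1])).
  apply: filtration_bigcup => // k; apply: filtrationC => //.
  apply: filtration_bigcup => // n; apply: filtrationC => //.
  have [tk|tk] := leP 0 (t - k.+1%:R^-1).
    apply: (@filtrationW (t - k.+1%:R^-1)) => //; first by rewrite gerBl invr_ge0.
    by have [_] := osg n; exact.
  rewrite (_ : mkset _ = set0); first exact: filtration0.
  apply/seteqP; split => om //=; apply/negP; rewrite -leNgt.
  exact: le_trans (ltW tk) (sg_ge0 n om).
apply/seteqP; split => om /= => [st|[k _ hk]].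
  have ts0 : 0 < t - sigma om by rewrite subr_gt0.
  have := near_infty_natSinv_lt (PosNum ts0); case=> k _ /(_ k (leqnn _))/= kt.
  exists k => // -[n _]; apply => /=.
  by rewrite (le_lt_trans (sg_le n om))// ltrBrDr -ltrBrDl.
have h n : sg n om < t - k.+1%:R^-1.
  by apply: contrapT => nh; apply: hk; exists n.
apply: (@le_lt_trans _ _ (t - k.+1%:R^-1)); last by rewrite gtrBl invr_gt0.
have cv := @sg_cvg om; apply: (cvgr_to_le cv).
by apply: nearW => n; exact: ltW.
Qed.

Let L r om : E := limn (fun n => X (sg n om + r) om).

Let L_cvg r om : 0 <= r -> X (sg n om + r) om @[n --> \oo] --> L r om.
Proof.
move=> r0; apply: (@nondecreasing_path_cvg om _ (sigma om + r)).
- by move=> n; rewrite addr_ge0.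
- by move=> i j ij; rewrite lerD2r sgS.
- by apply: cvgD; [exact: sg_cvg|exact: cvg_cst].
Qed.

Let r_ j : R := j.+1%:R^-1.
Let r0 j : 0 <= r_ j. Proof. by rewrite invr_ge0. Qed.

(** For a fixed delay r the times sg n + r increase to sigma + r, so L r is the
    left limit there, or the value if sg n reaches sigma. Either is close to
    X_sigma for small r > 0, by right continuity of the path at sigma. *)
Let L_right om : L (r_ j) om @[j --> \oo] --> X (sigma om) om.
Proof.
apply/cvg_ballP => e e0.
have e20 : 0 < e / 2 by rewrite divr_gt0.
have s0 : 0 <= sigma om by have [+ _] := limit_optional; exact.
have /cvg_ballP/(_ _ e20) := fm_right_continuous fm (om := om) s0.
move=> [dl /= dl0 Xb].
near=> j.
have rj0 : 0 < r_ j by rewrite invr_gt0.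
have rjd : r_ j < dl by near: j; exact: (near_infty_natSinv_lt (PosNum dl0)).
have /cvg_ballP/(_ _ e20) Lb := @L_cvg (r_ j) om (r0 j).
have /cvgrPdist_lt/(_ _ rj0) sb := @sg_cvg om.
have [n [Ln sn]] : exists n, ball (L (r_ j) om) (e / 2) (X (sg n om + r_ j) om) /\
    `|sigma om - sg n om| < r_ j.
  by case: (filterI Lb sb) => n _ /(_ n (leqnn n)); exists n.
rewrite [e]splitr; apply: (ball_triangle (y := X (sg n om + r_ j) om)); last exact: ball_sym.
have := sg_le n om; move: sn; rewrite ltr_norml => /andP[sn1 sn2] sn3.
apply: Xb; last by lra.
by rewrite /ball_/= ltr_norml; apply/andP; split; lra.
Unshelve. all: by end_near. Qed.

Let path_mes (h : E -> R) r n : continuous h -> 0 <= r ->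
  measurable_fun setT (h \o (fun om => X (sg n om + r) om)).
Proof.
move=> ch rp; apply: (@optional_path_measurable h (fun om => sg n om + r)) => //.
exact: optional_shift.
Qed.

Let L_mes (h : E -> R) r : continuous h -> 0 <= r -> measurable_fun setT (h \o L r).
Proof.
move=> ch rp.
apply: (@measurable_fun_cvg _ _ _ _ (fun n => h \o (fun om => X (sg n om + r) om))).
  by move=> n; exact: path_mes.
by move=> om _ /=; apply: (@cvg_comp _ _ _ _ h _ _ _ (@L_cvg r om rp)); exact: ch.
Qed.

Let L_markov x r (g h : E -> R) : 0 <= r -> Cb g -> Cb h ->
  expect (P x) (fun om => g (L 0 om) * h (L r om)) =
  expect (P x) (fun om => g (L 0 om) * T r h (L 0 om)).
Proof.
move=> rp Cg Ch; have [cg _] := Cg; have [ch _] := Ch.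
have CT := semigroup_Cb Ch rp; have [cT _] := CT.
apply: (expect_prod_unique (g1 := g) (h1 := h) (g2 := g) (h2 := T r h)
  (u1 := fun n om => X (sg n om + 0) om) (u2 := fun n om => X (sg n om + 0) om)
  (v1 := fun n om => X (sg n om + r) om)
  (v2 := fun n om => X (sg n om + 0) om)) => //.
- by move=> n; exact: path_mes.
- by move=> n; exact: path_mes.
- by move=> n; exact: path_mes.
- by move=> n; exact: path_mes.
- by move=> om; exact: L_cvg.
- by move=> om; exact: L_cvg.
- by move=> om; exact: L_cvg.
- by move=> om; exact: L_cvg.
move=> n; apply: etrans (etrans (strong_markov x (osg n) (sgH n) rp Cg Ch) _).
  by apply: expect_ext => om; rewrite addr0.
by apply: expect_ext => om; rewrite addr0.
Qed.

Let L_transfer x (g h : E -> R) : Cb g -> Cb h ->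
  expect (P x) (fun om => g (L 0 om) * h (X (sigma om) om)) =
  expect (P x) (fun om => g (L 0 om) * h (L 0 om)).
Proof.
move=> Cg Ch; have [cg [M gM]] := Cg; have [ch [N hN]] := Ch.
have [_ c1] := @expect_prod_cvg x (fun=> L 0) (fun j => L (r_ j)) (L 0)
  (fun om => X (sigma om) om) g h Cg Ch (fun=> L_mes cg (lexx 0))
  (fun j => L_mes ch (r0 j)) (fun om => @cvg_cst _ _ _ _ _) L_right.
have [_ c2] : summable_rv (P x) (fun om => g (L 0 om) * h (L 0 om)) /\
    expect (P x) (fun om => g (L 0 om) * T (r_ j) h (L 0 om)) @[j --> \oo] -->
    expect (P x) (fun om => g (L 0 om) * h (L 0 om)).
  apply: (@expect_dominated _ _ _ _ _ _ (fun=> M * N)).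
  - move=> j; apply: measurable_funM; first exact: (L_mes cg (lexx 0)).
    by have [cT _] := semigroup_Cb Ch (r0 j); exact: (L_mes cT (lexx 0)).
  - exact: summable_cst.
  - by move=> j om; rewrite normrM ler_pM// semigroup_bound.
  - move=> om; apply: cvgM; first exact: cvg_cst.
    rewrite -[X in _ --> X](semigroup0 _ Ch); apply: semigroup_rc => //.
    exact: cvg_harmonic.
apply: (@cvg_unique _ (@norm_hausdorff _ R^o) _ _ _ _ c1).
rewrite (_ : (fun j => _) = (fun j => expect (P x) (fun om => g (L 0 om) * T (r_ j) h (L 0 om))))//.
by apply/funext => j; exact: L_markov.
Qed.

(** Let L be the limit of X at sg n, which exists since paths have left limits.
    Passing to the limit in the strong Markov property at sg n, first in n and
    then in the delay r, gives E (g(L) h(X_sigma)) = E (g(L) h(L)) for bounded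
    continuous g and h. With (g, g) and (1, g^2) for (g, h), the mean square of
    g(L) - g(X_sigma) vanishes. *)
Lemma quasi_left_continuity x (g : E -> R) : Cb g ->
  (P x).-negligible
    [set om | ~ (g (X (sg n om) om) @[n --> \oo] --> g (X (sigma om) om))].
Proof.
move=> Cg; have [cg [M gM]] := Cg.
pose Y om := (g (L 0 om) - g (X (sigma om) om)) ^+ 2.
have mL := L_mes cg (lexx 0).
have mS := optional_path_measurable cg limit_optional.
have prod_summable (a b : Om -> R) : measurable_fun setT a -> measurable_fun setT b ->
    (forall om, `|a om| <= M) -> (forall om, `|b om| <= M) ->
    summable_rv (P x) (fun om => a om * b om).
  move=> ma mb aM bM; apply: bounded_summable; split; first exact: measurable_funM.
  by exists (M * M) => om; rewrite normrM ler_pM.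
have sLL : summable_rv (P x) (fun om => g (L 0 om) * g (L 0 om)) by exact: prod_summable.
have sLS : summable_rv (P x) (fun om => g (L 0 om) * g (X (sigma om) om)) by exact: prod_summable.
have sSS : summable_rv (P x) (fun om => g (X (sigma om) om) * g (X (sigma om) om)) by exact: prod_summable.
have EY : expect (P x) Y = 0.
  rewrite (_ : expect _ _ = expect (P x) (fun om =>
    (g (L 0 om) * g (L 0 om) - g (L 0 om) * g (X (sigma om) om)) +
    (g (X (sigma om) om) * g (X (sigma om) om) - g (L 0 om) * g (X (sigma om) om)))); last first.
    by apply: expect_ext => om; rewrite /Y; ring.
  rewrite expectD; [|exact: summableB..].
  rewrite expectB// expectB//.
  have -> := L_transfer x Cg Cg; rewrite subrr add0r.
  have := L_transfer x (Cb_cst 1) (CbM Cg Cg).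
  under expect_ext do rewrite mul1r.
  move=> ->; under expect_ext do rewrite mul1r.
  by rewrite subrr.
have mY : measurable_fun setT Y.
  by apply: measurable_funX; apply: measurable_funB.
have iY : summable_rv (P x) Y.
  have := summableB (summableD sLL sSS) (summableZ 2 sLS).
  by congr (summable_rv _ _); apply/funext => om; rewrite /Y; ring.
have Y0 om : 0 <= Y om by exact: sqr_ge0.
have /(ae_eq_integral_abs _ measurableT) : measurable_fun setT (EFin \o Y) by exact/measurable_EFinP.
move=> /(_ (P x))[+ _]; have -> : (\int[P x]_om `|(EFin \o Y) om| = (expect (P x) Y)%:E)%E.
  rewrite EFin_expect// unlock; apply: eq_integral => om _ /=.
  by rewrite ger0_norm.
rewrite EY => /(_ erefl) [N [mN N0 YN]].
exists N; split => // om /= nc; apply: YN => /= Y0om; apply: nc.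
have /eqP : (EFin \o Y) om = 0%E by exact: Y0om.
rewrite /= eqe sqrf_eq0 subr_eq0 => /eqP <-.
have := @L_cvg 0 om (lexx 0); under eq_fun do rewrite addr0.
by move=> cL; apply: (@cvg_comp _ _ _ _ g _ _ _ cL); exact: cg.
Qed.

End quasi_left_continuity.

(** * Hitting times of closed sets *)

Section hitting.
Variable phi : E -> R.
Hypotheses (cphi : continuous phi) (phi0 : forall y, 0 <= phi y).

Lemma path_right_open om (h : E -> R) t c : continuous h -> 0 <= t ->
  c < h (X t om) ->
  exists2 dl, 0 < dl & forall s, t <= s -> s < t + dl -> c < h (X s om).
Proof.
move=> ch t0 ct.
have cv : h (X s om) @[s --> t^'+] --> h (X t om).
  by apply: (@cvg_comp _ _ _ _ h _ _ _ (fm_right_continuous fm (om := om) t0)); exact: ch.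
have [dl /= dl0 hd] := cvgr_gt _ cv _ ct.
exists dl => // s; rewrite le_eqVlt => /predU1P[<-//|ts] sd.
by apply: hd => //=; rewrite /ball_/= ltr_norml; apply/andP; split; lra.
Qed.

Lemma exists_before_F c t : 0 <= t ->
  F t [set om | exists s, [/\ 0 <= s, s < t & phi (X s om) < c]].
Proof.
move=> t0; rewrite (_ : mkset _ = \bigcup_k \bigcup_j
    [set om | grid k j < t /\ phi (X (grid k j) om) < c]).
  apply: filtration_bigcup => // k; apply: filtration_bigcup => // j.
  have [jt|tj] := ltP (grid k j) t; last first.
    rewrite (_ : mkset _ = set0); first exact: filtration0.
    by apply/seteqP; split => // om /= [].
  apply: (@filtrationW (grid k j)); [exact: grid_ge0|exact: ltW|].
  have mB : measurable [set` `]-oo, (c : R)[ ] by exact: measurable_itv.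
  have := path_adapted cphi (grid_ge0 k j) mB.
  by congr (F _ _); apply/seteqP; split => om /=; rewrite in_itv/=; [split|case].
apply/seteqP; split => om /= => [[s [s0 st sc]]|[k _ [j _ [jt jc]]]]; last first.
  by exists (grid k j); split => //; exact: grid_ge0.
have sc' : - c < - phi (X s om) by rewrite ltrN2.
have cNphi : continuous (fun y => - phi y) by move=> y; apply: cvgN; exact: cphi.
have [dl dl0 hd] := path_right_open cNphi s0 sc'.
have := rd_cvg s0 => /cvgrPdist_lt /(_ (Num.min dl (t - s))).
rewrite lt_min dl0 subr_gt0 => /(_ st) [k _ /(_ k (leqnn k))/=].
rewrite lt_min ltr_norml => /andP[/andP[k1 k2]]; rewrite ltr_norml => /andP[k3 k4].
exists k => //; exists (up k s) => //.
have sr := rd_ge k s0; rewrite /rd in k1 k2 k3 k4 sr; split; first lra.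
by rewrite -ltrN2; apply: hd => //; lra.
Qed.

Lemma exists_upto_F c t : 0 <= t ->
  F t [set om | exists s, [/\ 0 <= s, s <= t & phi (X s om) < c]].
Proof.
move=> t0; have mB : measurable [set` `]-oo, (c : R)[ ] by exact: measurable_itv.
have := filtrationU t0 (exists_before_F c t0) (path_adapted cphi t0 mB).
congr (F _ _); apply/seteqP; split => om /=.
- move=> [[s [s0 st sc]]|]; first by exists s; split => //; exact: ltW.
  by rewrite in_itv/= => tc; exists t; split.
- move=> [s [s0]]; rewrite le_eqVlt => /predU1P[->|st] sc.
    by right; rewrite in_itv.
  by left; exists s.
Qed.

Definition below n (H : R) om : set R :=
  [set s | 0 <= s /\ phi (X s om) < n.+1%:R^-1] `|` [set H].

(** Entrance time into the open set where phi < 1/(n+1), capped at H. These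
    optional times announce the hitting time of the zero set of phi. *)
Definition enter n (H : R) om : R := inf (below n H om).

Section enter.
Variable H : R.
Hypothesis H0 : 0 <= H.

Lemma below_has_inf n om : has_inf (below n H om).
Proof. by split; [exists H; right|exists 0 => s [[]|->]]. Qed.

Lemma enter_ge0 n om : 0 <= enter n H om.
Proof. by apply: lb_le_inf => [|s [[]|->]//]; exists H; right. Qed.

Lemma enter_le n om : enter n H om <= H.
Proof. by apply: ge_inf; [have [] := below_has_inf n om|right]. Qed.

Lemma enter_le_at n om s : 0 <= s -> phi (X s om) < n.+1%:R^-1 -> enter n H om <= s.
Proof. by move=> s0 sn; apply: ge_inf; [have [] := below_has_inf n om|left]. Qed.

Lemma enter_optional n : optional_time (enter n H).
Proof.
split=> [om|t t0]; first exact: enter_ge0.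
have [tH|Ht] := leP t H; last first.
  rewrite (_ : mkset _ = setT); first exact: filtration_setT.
  by apply/seteqP; split => // om _ /=; rewrite (le_lt_trans (enter_le n om)).
have := exists_before_F n.+1%:R^-1 t0; congr (F _ _); apply/seteqP; split => om /=.
  by move=> [s [s0 st sn]]; exact: le_lt_trans (enter_le_at s0 sn) st.
move=> et; have := inf_adherent _ (below_has_inf n om).
move=> /(_ (t - enter n H om)); rewrite subr_gt0 => /(_ et) [s + st].
have {}st : s < t by move: st; rewrite -/(enter n H om) addrC subrK.
move=> [[s0 sn]|sH]; first by exists s.
by move: st; rewrite sH ltNge tH.
Qed.

Lemma enter_nondecreasing om : nondecreasing_seq (fun n => enter n H om).
Proof.
move=> i j ij; apply: lb_le_inf => [|s]; first by have [] := below_has_inf j om.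
move=> [[s0 sj]|->]; last exact: enter_le.
apply: enter_le_at => //; apply: lt_le_trans sj _.
by rewrite lef_pV2 ?posrE// ler_nat.
Qed.

Definition enter_lim om : R := limn (fun n => enter n H om).

Lemma enter_cvg om : enter n H om @[n --> \oo] --> enter_lim om.
Proof.
apply: nondecreasing_is_cvgn; first exact: enter_nondecreasing.
by exists H => _ [n _ <-]; exact: enter_le.
Qed.

Lemma enter_lim_le om : enter_lim om <= H.
Proof.
have cv := @enter_cvg om; apply: (cvgr_to_le cv).
by apply: nearW => n; exact: enter_le.
Qed.

Lemma enter_phi n om : (exists s, [/\ 0 <= s, s <= H & phi (X s om) < n.+1%:R^-1]) ->
  phi (X (enter n H om) om) <= n.+1%:R^-1.
Proof.
move=> [s [s0 sH sn]]; rewrite leNgt; apply/negP => lt.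
have [dl dl0 hd] := path_right_open cphi (enter_ge0 n om) lt.
have big r : 0 <= r -> phi (X r om) < n.+1%:R^-1 -> enter n H om + dl <= r.
  move=> r0 rn; rewrite leNgt; apply/negP => rlt.
  by have := hd r (enter_le_at r0 rn) rlt; rewrite ltNge (ltW rn).
have [r rb rlt] := inf_adherent dl0 (below_has_inf n om).
move: rb rlt => [[r0 rn]|->]; first by rewrite ltNge big.
by rewrite ltNge (le_trans (big s s0 sn)).
Qed.

Definition jump_at_entry (g : E -> R) : set Om :=
  [set om | ~ (g (X (enter n H om) om) @[n --> \oo] --> g (X (enter_lim om) om))].

Lemma jump_at_entry_negligible x g : Cb g -> (P x).-negligible (jump_at_entry g).
Proof.
exact: (quasi_left_continuity enter_optional enter_nondecreasing enter_le enter_cvg).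
Qed.

Definition phi1 y := Num.min 1 (phi y).

Lemma phi1_Cb : Cb phi1.
Proof.
split; first by apply: continuous_minr => // y; exact: cvg_cst.
exists 1 => y; rewrite ger0_norm /phi1 ?ge_min ?lexx//.
by rewrite le_min ler01/=.
Qed.

(** The values of phi at the entrance times tend to 0, so that off the exceptional
    set the limit time is a zero of phi. *)
Lemma entry_hits om : ~ jump_at_entry phi1 om ->
  (forall n, exists s, [/\ 0 <= s, s <= H & phi (X s om) < n.+1%:R^-1]) ->
  phi (X (enter_lim om) om) = 0.
Proof.
move=> /contrapT cv hit.
have l0 : phi1 (X (enter_lim om) om) <= 0.
  apply: (@ler_cvg_to _ _ _ _ _ _ _ _ cv (@cvg_harmonic R)).
  apply: nearW => n /=; rewrite /phi1 ge_min; apply/orP; right.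
  exact: enter_phi.
apply/eqP; rewrite eq_le phi0 andbT.
by move: l0; rewrite /phi1 ge_min leNgt ltr01.
Qed.

End enter.

Let D : set E := [set y | phi y = 0].
Let tau0 := hitting_time X D.

Lemma hitting_le om s : 0 <= s -> phi (X s om) = 0 -> (tau0 om <= s%:E)%E.
Proof. by move=> s0 sD; apply: ereal_inf_lbound; exists s. Qed.

Lemma hitting_ge0 om : (0 <= tau0 om)%E.
Proof. by apply: le_ereal_inf_tmp => _ [s [s0 _] <-]; rewrite lee_fin. Qed.

Lemma hitting_attained om : (tau0 om < +oo)%E ->
  exists s, [/\ 0 <= s, tau0 om = s%:E & phi (X s om) = 0].
Proof.
move=> fin; pose S := [set s : R | 0 <= s /\ D (X s om)].
have [s Ss] : exists s, S s.
  apply: contrapT => nS; move: fin; rewrite /tau0 /hitting_time.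
  rewrite (_ : [set _ | _ in _] = set0) ?ereal_inf0//.
  by apply/seteqP; split => // y [s Ss _]; apply: nS; exists s.
have iS : has_inf S by split; [exists s|exists 0 => r []].
have i0 : 0 <= inf S by apply: lb_le_inf; [exists s|move=> r []].
exists (inf S); split => //; first by rewrite /tau0 /hitting_time ereal_inf_EFin//; case: iS.
apply/eqP; rewrite eq_le phi0 andbT leNgt; apply/negP => lt.
have [dl dl0 hd] := path_right_open cphi i0 lt.
have [r Sr rlt] := inf_adherent dl0 iS.
have ir : inf S <= r by apply: ge_inf => //; case: iS.
by have := hd r ir rlt; have [_ ->] := Sr; rewrite ltxx.
Qed.

(** The event that tau0 <= t is contained in the event A that phi takes arbitrarily
    small values on [0, t], which is in F t. On the difference the entrance times
    converge to a time at which the path jumps away from the zero set, and this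
    is negligible for every starting point, hence in F by completeness. *)
Lemma hitting_stopping : stopping_time F tau0.
Proof.
split=> [om|t t0]; first exact: hitting_ge0.
pose A n := [set om | exists s, [/\ 0 <= s, s <= t & phi (X s om) < n.+1%:R^-1]].
have FA : F t (~` (\bigcup_n ~` A n)).
  apply: filtrationC => //; apply: filtration_bigcup => // n.
  by apply: filtrationC => //; exact: exists_upto_F.
pose N := ~` (\bigcup_n ~` A n) `\` [set om | (tau0 om <= t%:E)%E].
have FN : F t N.
  apply: (@filtrationW 0) => //; apply: (fm_complete fm) => x.
  apply: negligibleS (jump_at_entry_negligible t0 x phi1_Cb).
  move=> om [An nt]; apply: contrapT => nj; apply: nt => /=.
  have hit n : A n om by apply: contrapT => nA; apply: An; exists n.
  apply: (@le_trans _ _ (enter_lim t om)%:E); last by rewrite lee_fin enter_lim_le.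
  apply: hitting_le; last exact: entry_hits.
  have [+ _] := limit_optional (enter_optional t0) (enter_nondecreasing t0) (enter_cvg t0).
  exact.
rewrite (_ : mkset _ = ~` (\bigcup_n ~` A n) `&` ~` N).
  by apply: filtrationI => //; exact: filtrationC.
apply/seteqP; split => om /=.
- move=> tt; split; last by move=> [_]; apply.
  move=> [n _]; apply.
  have [s [s0 ts sD]] := hitting_attained (le_lt_trans tt (ltry _)).
  exists s; split => //; first by rewrite -lee_fin -ts.
  by rewrite sD invr_gt0.
- move=> [An nN]; apply: contrapT => nt; exact: nN.
Qed.

(** The map r / (1 + |r|) is a homeomorphism onto ]-1, 1[; it reduces an unbounded
    function to a bounded one. *)
Lemma cvg_squash (u : nat -> R) (a : R) :
  u n / (1 + `|u n|) @[n --> \oo] --> a / (1 + `|a|) -> u n @[n --> \oo] --> a.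
Proof.
pose k (r : R) := r / (1 - `|r|).
have pos (r : R) : 0 < 1 + `|r| by rewrite ltr_wpDr// ltr01.
have kE (r : R) : k (r / (1 + `|r|)) = r.
  rewrite /k normrM normfV (gtr0_norm (pos r)).
  have pr := lt0r_neq0 (pos r).
  have -> : 1 - `|r| / (1 + `|r|) = (1 + `|r|)^-1 by field.
  by rewrite invrK divfK.
move=> cv; rewrite -[X in _ --> X]kE.
rewrite (_ : u = fun n => k (u n / (1 + `|u n|))); last by apply/funext => n; rewrite kE.
apply: cvgM; first exact: cv.
apply: cvgV; last by apply: cvgB; [exact: cvg_cst|exact: cvg_norm].
rewrite normrM normfV (gtr0_norm (pos a)) gt_eqF// subr_gt0 ltr_pdivrMr//.
by rewrite mul1r ltrDr.
Qed.

(** If phi is bounded below before kappa there is nothing to prove. Otherwise the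
    entrance times stay below kappa, and off a null set their limit is a zero
    of phi, so it is kappa, as kappa precedes the hitting time; by quasi-left-continuity of g = G / (1 + |G|), the
    function G has the left limit G(X_kappa) at kappa. Every time before kappa at
    which phi is small comes after a late entrance time, thus close to kappa. *)
Lemma no_loss_before_hitting x (H : R) (G : E -> R) : 0 <= H -> continuous G ->
  exists2 N, measurable N /\ P x N = 0 &
    forall om, ~ N om -> forall kappa eps : R, 0 <= kappa <= H ->
      (kappa%:E <= tau0 om)%E -> 0 < eps ->
      exists2 c, 0 < c & forall s, 0 <= s -> s < kappa -> phi (X s om) < c ->
        kappa - eps < s /\ `|G (X s om) - G (X kappa om)| <= eps.
Proof.
move=> H0 cG; pose g y := G y / (1 + `|G y|).
have pos (y : E) : 0 < 1 + `|G y| by rewrite ltr_wpDr// ltr01.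
have Cg : Cb g.
  split.
    move=> y; apply: cvgM; first exact: cG.
    apply: cvgV; first by rewrite gt_eqF.
    by apply: cvgD; [exact: cvg_cst|apply: cvg_norm; exact: cG].
  exists 1 => y; rewrite /g normrM normfV (gtr0_norm (pos y)) ler_pdivrMr//.
  by rewrite mul1r lerDr.
have [N [mN N0 jN]] := negligibleU (jump_at_entry_negligible H0 x phi1_Cb)
  (jump_at_entry_negligible H0 x Cg).
exists N; first by split.
move=> om nN kappa eps /andP[k0 kH] ktau eps0.
have nphi : ~ jump_at_entry H phi1 om by move=> j; apply: nN; apply: jN; left.
have ng : ~ jump_at_entry H g om by move=> j; apply: nN; apply: jN; right.
have [[c c0 hc]|approach] := pselect (exists2 c, 0 < c &
    forall s, 0 <= s -> s < kappa -> c <= phi (X s om)).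
  by exists c => // s s0 sk; rewrite ltNge hc.
have hit n : exists s, [/\ 0 <= s, s < kappa & phi (X s om) < n.+1%:R^-1].
  apply: contrapT => nh; apply: approach; exists n.+1%:R^-1 => // s s0 sk.
  by rewrite leNgt; apply/negP => sn; apply: nh; exists s.
have kpos : 0 < kappa by have [s [s0 sk _]] := hit 0%N; exact: le_lt_trans sk.
have ek n : enter n H om < kappa.
  by have [s [s0 sk sn]] := hit n; exact: le_lt_trans (enter_le_at H0 s0 sn) sk.
have limk : enter_lim H om = kappa.
  apply/eqP; rewrite eq_le; apply/andP; split.
    have cv := enter_cvg H0 (om := om); apply: (cvgr_to_le cv).
    by apply: nearW => n; exact: ltW.
  rewrite -lee_fin (le_trans ktau)//; apply: hitting_le.
    have [+ _] := limit_optional (enter_optional H0) (enter_nondecreasing H0) (enter_cvg H0).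
    exact.
  apply: entry_hits => // n; have [s [s0 sk sn]] := hit n.
  by exists s; split => //; exact: le_trans (ltW sk) kH.
have [l Xl] := fm_left_limits fm om kpos.
have ecv : enter n H om @[n --> \oo] --> kappa by rewrite -limk; exact: enter_cvg.
have Ge : G (X (enter n H om) om) @[n --> \oo] --> G l.
  by apply: (@cvg_comp _ _ _ _ G _ _ _ (path_left_cvg Xl ek ecv)); exact: cG.
have Ge' : G (X (enter n H om) om) @[n --> \oo] --> G (X kappa om).
  by apply: cvg_squash; rewrite -limk; exact: contrapT ng.
have Gl : G l = G (X kappa om) by exact: (cvg_unique (@norm_hausdorff _ R^o) Ge Ge').
have GX : G (X s om) @[s --> kappa^'-] --> G (X kappa om).
  by rewrite -Gl; apply: (@cvg_comp _ _ _ _ G _ _ _ Xl); exact: cG.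
have /cvgrPdist_le/(_ eps eps0)[dl /= dl0 Gd] := GX.
have min0 : 0 < Num.min dl eps by rewrite lt_min dl0.
have /cvgrPdist_lt/(_ _ min0)[n _ /(_ n (leqnn n))/=] := ecv.
rewrite gtr0_norm ?subr_gt0// lt_min => /andP[n1 n2].
exists n.+1%:R^-1 => // s s0 sk sn.
have es := enter_le_at H0 s0 sn; split; first lra.
rewrite distrC; apply: Gd => //=; rewrite gtr0_norm ?subr_gt0//; lra.
Qed.

End hitting.

(** * The stopping problem *)

Section stopping_problem.
Variables (f w q : E -> R) (m Kq : R).
Hypotheses (Cf : Cb f) (Cw : Cb w) (m0 : 0 < m) (cq : continuous q).
Hypothesis qK : forall x, q x <= Kq.
Hypothesis q_rep : forall tau, bounded_stopping_time F tau -> forall x,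
  ((q x)%:E = 'E_(P x)[fun om => cost X (fun y => (f y - m)%R) q (tau om) om])%E.
Hypothesis q_ui : forall x, uniformly_integrable (P x) (fun t om => q (X t om)).

Definition payoff (g : E -> R) (tau : Om -> R) (om : Om) : R :=
  running_cost X f (tau om) om + g (X (tau om) om).

Lemma running_costB_cst r om : 0 <= r ->
  running_cost X (fun y => f y - m) r om = running_cost X f r om - m * r.
Proof.
move=> r0; have [cf [M fM]] := Cf.
have Cfm : Cb (fun y => f y - m) by apply: CbB => //; exact: Cb_cst.
have [cfm [M' fM']] := Cfm.
have Cm := Cb_cst m.
have [cm [Mm mM]] := Cm.
rewrite (running_costE cfm fM') (running_costE cf fM).
have -> : m * r = wint (box r) (fun s => m).
  rewrite -[in LHS](wint_box1 r0) -(@wintZ _ _ (weight_box r) _ _ 1).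
    by apply: eq_Rintegral => s _; rewrite mulr1.
  by split=> s s0; [exact: cvg_cst|rewrite normr1].
have rc (h : E -> R) N : continuous h -> (forall x, `|h x| <= N) ->
    rc_bounded (fun s => h (X s om)) N.
  move=> ch hN; have := path_rc_bounded om ler01 (lexx 0) ch hN.
  by congr (rc_bounded _ _); apply/funext => s; rewrite mul1r add0r.
rewrite /wint -RintegralB//.
- by apply: eq_Rintegral => s _; rewrite mulrBr.
- exact: wint_integrable (weight_box r) _ _ (rc _ _ cf fM).
- exact: wint_integrable (weight_box r) _ _ (rc _ _ cm mM).
Qed.

Section at_bounded_stopping_time.
Variables (tau : Om -> R) (H : R).
Hypotheses (stau : real_stopping_time tau) (tauH : forall om, tau om <= H).

Let otau := stopping_optional stau.

Lemma tau_summable x : summable_rv (P x) tau.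
Proof.
apply: bounded_summable; split; first exact: optional_measurable.
by exists H => om; rewrite ger0_norm//; case: stau.
Qed.

Lemma running_cost_summable x :
  summable_rv (P x) (fun om => running_cost X f (tau om) om).
Proof.
apply: bounded_summable; have [cf [M fM]] := Cf.
exact: (running_cost_bounded cf fM otau tauH).
Qed.

(** The expectation in the hypothesis on q is that of a sum in which only q may be
    non-integrable; its finite value forces integrability. *)
Lemma q_summable x : summable_rv (P x) (fun om => q (X (tau om) om)) /\
  expect (P x) (fun om => running_cost X f (tau om) om) =
  m * expect (P x) tau + q x - expect (P x) (fun om => q (X (tau om) om)).
Proof.
have bst : bounded_stopping_time F (fun om => (tau om)%:E).
  by split; [exact: stopping_of_real|exists H => om; rewrite lee_fin].
have := q_rep bst x.
have -> : (fun om => cost X (fun y => f y - m) q (tau om)%:E om) =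
    (fun om => (running_cost X f (tau om) om - m * tau om) + q (X (tau om) om)).
  apply/funext => om; rewrite /cost /= running_costB_cst//.
  by case: stau.
move=> qE.
have mq := optional_path_measurable cq otau.
have irc := running_cost_summable x.
have itau := summableZ m (tau_summable x).
have irt := summableB irc itau.
have mY : measurable_fun setT (fun om =>
    (running_cost X f (tau om) om - m * tau om) + q (X (tau om) om)).
  apply: measurable_funD => //; exact: summable_measurable irt.
have iY : summable_rv (P x) (fun om =>
    (running_cost X f (tau om) om - m * tau om) + q (X (tau om) om)).
  apply/integrableP; split; first exact/measurable_EFinP.
  rewrite (integral_fin_num_abs (P x) measurableT mY).
  by move: qE; rewrite unlock => <-.
have iq : summable_rv (P x) (fun om => q (X (tau om) om)).
  have := summableB iY irt.
  by congr (is_true (_.-integrable _ _)); apply/funext => om /=; congr (_%:E); ring.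
split=> //; move: qE; rewrite -EFin_expect// => -[->].
rewrite expectD// expectB// expectZ//; last exact: tau_summable.
ring.
Qed.

Lemma payoff_summable g x : summable_rv (P x) (fun om => g (X (tau om) om)) ->
  summable_rv (P x) (payoff g tau).
Proof. by move=> ig; apply: summableD => //; exact: running_cost_summable. Qed.

(** The cost of running up to tau is the mean of m tau, up to q. *)
Lemma payoff_rep g x : summable_rv (P x) (fun om => g (X (tau om) om)) ->
  expect (P x) (payoff g tau) =
  q x + expect (P x) (fun om => m * tau om + (g (X (tau om) om) - q (X (tau om) om))).
Proof.
move=> ig; have [iq E1] := q_summable x.
rewrite /payoff expectD//; last exact: running_cost_summable.
rewrite E1 expectD; last 2 first.
- by apply: summableZ; exact: tau_summable.
- exact: summableB.
rewrite expectB// expectZ; last exact: tau_summable.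
ring.
Qed.

End at_bounded_stopping_time.

Lemma real_stopping_cst t : 0 <= t -> real_stopping_time (fun=> t).
Proof.
move=> t0; split=> [//|s s0]; have [ts|st] := leP t s.
  rewrite (_ : [set _ | _] = setT); first exact: filtration_setT.
  by apply/seteqP; split.
rewrite (_ : [set _ | _] = set0); first exact: filtration0.
by apply/seteqP; split => // om /=; rewrite leNgt st.
Qed.

(** The hypothesis on q at the constant time t expresses this expectation by q and
    a potential of f, although q may be unbounded below. *)
Lemma expect_q_continuous t : 0 <= t ->
  continuous (fun x => expect (P x) (fun om => q (X t om))).
Proof.
move=> t0; have [cf [M fM]] := Cf.
have -> : (fun x => expect (P x) (fun om => q (X t om))) =
    (fun x => m * t + q x - potential (box t) 1 f x).
  apply/funext => x.
  have [_] := q_summable (real_stopping_cst t0) (fun=> lexx t) x.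
  rewrite (running_cost_expect cf fM)// expect_cst => ->; ring.
move=> x; apply: cvgB.
  by apply: cvgD; [exact: cvg_cst|exact: cq].
by have [cU _] := potential_Cb (weight_box t) ler01 cf fM; exact: cU.
Qed.

(** The negative part of q + A. *)
Definition excess A (y : E) : R := - Num.min 0 (q y + A).

Lemma excess_continuous A : continuous (excess A).
Proof.
rewrite /excess => x; apply: cvgN; apply: cvg_minr; first exact: cvg_cst.
by apply: cvgD; [exact: cq|exact: cvg_cst].
Qed.

Lemma excess_ge0 A y : 0 <= excess A y.
Proof. by rewrite /excess oppr_ge0 ge_min lexx. Qed.

Lemma excess_max A y : excess A y = - (q y + A) + - Num.min 0 (- (q y + A)).
Proof.
rewrite /excess; have [qA|qA] := leP 0 (q y + A).
  by rewrite (min_r (x := 0)) ?oppr_le0// oppr0 opprK addNr.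
by rewrite (min_l (x := 0)) ?oppr_ge0 ?(ltW qA)// oppr0 addr0.
Qed.

Lemma pos_part_Cb A : Cb (fun y => - Num.min 0 (- (q y + A))).
Proof.
apply: CbN; split.
  move=> x; apply: cvg_minr; first exact: cvg_cst.
  by apply: cvgN; apply: cvgD; [exact: cq|exact: cvg_cst].
exists `|Kq + A| => x; rewrite ler0_norm; last by rewrite ge_min lexx.
rewrite oppr_min opprK ge_max oppr0 normr_ge0/=.
by rewrite (le_trans _ (ler_norm _))// lerD2r.
Qed.

Lemma q_path_summable t x : 0 <= t -> summable_rv (P x) (fun om => q (X t om)).
Proof.
by move=> t0; have [] := q_summable (real_stopping_cst t0) (fun=> lexx t) x.
Qed.

Lemma excess_summable A t x : 0 <= t ->
  summable_rv (P x) (fun om => excess A (X t om)).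
Proof.
move=> t0; under eq_fun do rewrite excess_max.
apply: summableD; last exact: (path_summable x (pos_part_Cb A) t0).
have := summableZ (-1) (summableD (q_path_summable x t0) (summable_cst (P x) A)).
by congr (is_true (_.-integrable _ _)); apply/funext => om /=; rewrite mulN1r.
Qed.

Lemma expect_excess_continuous A t : 0 <= t ->
  continuous (fun x => expect (P x) (fun om => excess A (X t om))).
Proof.
move=> t0.
have -> : (fun x => expect (P x) (fun om => excess A (X t om))) = (fun x =>
    - (expect (P x) (fun om => q (X t om)) + A) +
    T t (fun y => - Num.min 0 (- (q y + A))) x).
  apply/funext => x; have iq := q_path_summable x t0.
  have iqA := summableD iq (summable_cst (P x) A).
  rewrite semigroupE -[X in - (_ + X)](expect_cst (P x) A) -expectD//; last first.
    exact: summable_cst.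
  rewrite -mulN1r -expectZ// -expectD//.
  - by apply: expect_ext => om; rewrite excess_max mulN1r.
  - exact: summableZ.
  - exact: (path_summable x (pos_part_Cb A) t0).
move=> x; apply: cvgD; last first.
  by apply: semigroup_continuous => //; exact: pos_part_Cb.
by apply: cvgN; apply: cvgD; [exact: expect_q_continuous|exact: cvg_cst].
Qed.

(** Uniform integrability, read for the negative part: excess A is at most |q| and
    it vanishes unless |q| > A. *)
Lemma excess_small x eps : 0 < eps -> exists A,
  forall t, 0 <= t -> expect (P x) (fun om => excess A (X t om)) <= eps.
Proof.
move=> eps0; have := q_ui x.
move=> /fine_cvgP [fin_near].
move=> /cvgrPdist_le /(_ eps eps0) small_near.
have [A [A0 [finA smallA]]] : exists A, 0 <= A /\ (sup_tail_expectation (P x) (fun t om => q (X t om)) A \is a fin_num) /\ fine (sup_tail_expectation (P x) (fun t om => q (X t om)) A) <= eps.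
  have near0 : \forall A \near (pinfty_nbhs R), 0 <= A by exists 0; split => [|A /ltW]; [exact: num_real|].
  near (pinfty_nbhs R) => A; exists A; split; first by near: A.
  split; first by near: A.
  have : `|0 - fine (sup_tail_expectation (P x) (fun t om => q (X t om)) A)| <= eps.
    by near: A.
  by rewrite sub0r normrN; apply: le_trans; exact: ler_norm.
exists A => t t0; rewrite -lee_fin EFin_expect; last exact: excess_summable.
apply: (@le_trans _ _ (sup_tail_expectation (P x) (fun t om => q (X t om)) A)); last first.
  by rewrite -(fineK finA) lee_fin.
apply: (@le_trans _ _ (\int[P x]_(om in [set om | (A < `|q (X t om)|)%R]) `|q (X t om)|%:E)%E); last first.
  by apply: ereal_sup_ubound; exists t.
have mq := path_measurable cq t0.
have mA : measurable [set om | A < `|q (X t om)|].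
  rewrite -[X in measurable X]setTI.
  apply: (measurable_fun_ltr (measurable_cst A) _ measurableT (Y := [set true])) => //.
  exact: measurableT_comp.
rewrite unlock [leRHS]integral_mkcond.
apply: ge0_le_integral => //.
- by move=> om _; rewrite lee_fin excess_ge0.
- by apply/measurable_EFinP; apply: path_measurable => //; exact: excess_continuous.
- apply: (iffLR (measurable_restrictT _ mA)); apply: measurable_funTS.
  by apply/measurable_EFinP; exact: measurableT_comp.
move=> om _; rewrite patchE; case: ifPn => [_|].
  rewrite lee_fin /excess; have [qA|qA] := leP 0 (q (X t om) + A).
    by rewrite oppr0.
  by apply: (@le_trans _ _ (- q (X t om))); [lra|rewrite -normrN ler_norm].
rewrite notin_setE /= => /negP; rewrite -leNgt ler_norml => /andP[qA _].
rewrite lee_fin /excess min_l ?oppr0//; lra.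
Unshelve. all: by end_near. Qed.

(** * Dynamic programming on a grid *)

Definition step_cost n : E -> R := potential (box (mesh n)) 1 f.

Lemma step_cost_Cb n : Cb (step_cost n).
Proof.
have [cf [M fM]] := Cf.
exact: (potential_Cb (weight_box (mesh n)) ler01 cf fM).
Qed.

Lemma mesh_ge0 n : 0 <= mesh n :> R. Proof. exact: ltW (mesh_gt0 n). Qed.

Let rc_split n j om : running_cost X f (grid n j.+1) om =
  running_cost X f (grid n j) om +
  wint (box (mesh n)) (fun s => f (X (grid n j + s) om)).
Proof.
have [cf [M fM]] := Cf.
by rewrite gridS (running_cost_split cf fM)//; [exact: grid_ge0|exact: mesh_ge0].
Qed.

Lemma running_cost0 om : running_cost X f 0 om = 0.
Proof.
have [cf [M fM]] := Cf; rewrite (running_costE cf fM).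
rewrite /wint (_ : (fun _ => _) = (fun=> 0)) ?Rintegral_cst ?mul0r//.
by apply/funext => s; rewrite boxE; case: (leP 0 s) => s0; rewrite ?mul0r//= ltNge s0 mul0r.
Qed.

Section dynkin.
Variables (x : E) (n : nat) (k : Om -> nat) (N : nat) (V : nat -> E -> R).
Hypotheses (sk : grid_stop n k) (kN : forall om, (k om <= N)%N).
Hypothesis CV : forall j, Cb (V j).

(** The increment over one grid step of the running cost plus V. *)
Let incr j om := wint (box (mesh n)) (fun s => f (X (grid n j + s) om)) +
  V j.+1 (X (grid n j + mesh n) om) - V j (X (grid n j) om).

Let telescope i om : running_cost X f (grid n i) om + V i (X (grid n i) om) =
  V 0%N (X 0 om) + \sum_(0 <= j < i) incr j om.
Proof.
elim: i => [|i IHi].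
  by rewrite big_geq// addr0 /grid mul0r running_cost0 add0r.
rewrite big_nat_recr//= addrA -IHi rc_split /incr -gridS; ring.
Qed.

Let stopped_sum om : \sum_(0 <= j < k om) incr j om =
  \sum_(0 <= j < N) \1_[set om | (j < k om)%N] om * incr j om.
Proof.
rewrite [RHS](big_cat_nat (n := k om))//= [X in _ + X]big1_seq ?addr0.
  rewrite big_nat_cond [RHS]big_nat_cond; apply: eq_bigr => j /andP[/andP[_ jk] _].
  by rewrite indicE mem_set//= mul1r.
move=> j; rewrite mem_index_iota => /andP[_ /andP[kj _]].
by rewrite indicE memNset/= ?mul0r//; apply/negP; rewrite -leqNgt.
Qed.

Let wint_summable j : summable_rv (P x)
  (fun om => wint (box (mesh n)) (fun s => f (X (grid n j + s) om))).
Proof.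
have i1 := running_cost_summable (real_stopping_cst (grid_ge0 n j.+1)) (fun=> lexx _) x.
have i0 := running_cost_summable (real_stopping_cst (grid_ge0 n j)) (fun=> lexx _) x.
have := summableB i1 i0; congr (is_true (_.-integrable _ _)).
by apply/funext => om /=; rewrite rc_split addrC addKr.
Qed.

Let gtF j : F (grid n j) [set om | (j < k om)%N]. Proof. exact: grid_stop_gt. Qed.

Let gtm j : measurable [set om | (j < k om)%N].
Proof. exact: (filtration_measurable (grid_ge0 n j) (gtF j)). Qed.

Let iV j i : summable_rv (P x) (fun om => V i (X (grid n j) om)).
Proof. by apply: path_summable => //; exact: grid_ge0. Qed.

Let iVS j i : summable_rv (P x) (fun om => V i (X (grid n j + mesh n) om)).
Proof. by rewrite -gridS. Qed.

Let iincr j : summable_rv (P x) (incr j).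
Proof. by apply: summableB => //; exact: summableD. Qed.

(** Telescoping over the grid steps made before k; each of these steps is decided at
    its beginning, so the Markov property replaces its increment by its
    conditional mean. *)
Lemma dynkin_formula :
  expect (P x) (fun om => running_cost X f (grid n (k om)) om +
                          V (k om) (X (grid n (k om)) om)) =
  V 0%N x + \sum_(0 <= j < N) expect (P x) (fun om => \1_[set om | (j < k om)%N] om *
    (step_cost n (X (grid n j) om) + T (mesh n) (V j.+1) (X (grid n j) om)
     - V j (X (grid n j) om))).
Proof.
have [cf [M fM]] := Cf.
transitivity (expect (P x) (fun om => V 0%N (X 0 om) +
    \sum_(0 <= j < N) \1_[set om | (j < k om)%N] om * incr j om)).
  by apply: expect_ext => om; rewrite telescope stopped_sum.
have isum j : (j < N)%N ->
    summable_rv (P x) (fun om => \1_[set om | (j < k om)%N] om * incr j om).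
  by move=> _; exact: summable_indicM.
rewrite expectD; last 2 first.
- by apply: path_summable.
- exact: summable_sum.
rewrite -semigroupE semigroup0//; congr (_ + _).
rewrite expect_sum//; apply: eq_bigr => j _.
have iS : summable_rv (P x) (fun om => step_cost n (X (grid n j) om)).
  by apply: path_summable; [exact: step_cost_Cb|exact: grid_ge0].
have iT : summable_rv (P x) (fun om => T (mesh n) (V j.+1) (X (grid n j) om)).
  by apply: path_summable; [apply: semigroup_Cb => //; exact: mesh_ge0|exact: grid_ge0].
have split (A B C : Om -> R) : summable_rv (P x) A -> summable_rv (P x) B ->
    summable_rv (P x) C ->
    expect (P x) (fun om => \1_[set om | (j < k om)%N] om * (A om + B om - C om)) =
    expect (P x) (fun om => \1_[set om | (j < k om)%N] om * A om) +
    expect (P x) (fun om => \1_[set om | (j < k om)%N] om * B om) -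
    expect (P x) (fun om => \1_[set om | (j < k om)%N] om * C om).
  move=> iA iB iC.
  rewrite -expectD; [|exact: summable_indicM|exact: summable_indicM].
  rewrite -expectB; [|by apply: summableD; exact: summable_indicM|exact: summable_indicM].
  by apply: expect_ext => om; ring.
have e1 : expect (P x) (fun om => \1_[set om | (j < k om)%N] om *
      step_cost n (X (grid n j) om)) =
    expect (P x) (fun om => \1_[set om | (j < k om)%N] om *
      wint (box (mesh n)) (fun s => f (X (grid n j + s) om))).
  apply: (etrans (potential_markov (weight_box _) ler01 cf fM x (grid_ge0 n j) (gtF j))).
  apply: expect_ext => om; congr (_ * wint _ _); apply/funext => s.
  by rewrite mul1r.
have e2 := markov_property x (grid_ge0 n j) (mesh_ge0 n) (gtF j) (CV j.+1).
apply: (etrans (split _ _ _ (wint_summable j) (iVS j j.+1) (iV j j))).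
apply: (etrans _ (esym (split _ _ _ iS iT (iV j j)))).
by rewrite e1 e2.
Qed.

End dynkin.

(** The optimal cost with k decisions left, one every 2^-n. *)
Fixpoint W n k : E -> R := if k is k'.+1 then
  (fun x => Num.min (w x) (step_cost n x + T (mesh n) (W n k') x)) else w.

Lemma W_Cb n k : Cb (W n k).
Proof.
elim: k => [//|k IHk] /=; apply: CbI => //; apply: CbD; first exact: step_cost_Cb.
by apply: semigroup_Cb => //; exact: mesh_ge0.
Qed.

Lemma W_le n k x : W n k x <= w x.
Proof. by case: k => [//|k] /=; rewrite ge_min lexx. Qed.

Lemma W_step n k x : W n k.+1 x <= step_cost n x + T (mesh n) (W n k) x.
Proof. by rewrite /= ge_min lexx orbT. Qed.

Lemma W_step_eq n k x : W n k.+1 x < w x ->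
  W n k.+1 x = step_cost n x + T (mesh n) (W n k) x.
Proof. by rewrite /= gt_min ltxx /= => /ltW /min_idPr. Qed.

Lemma W_dec n i j x : (i <= j)%N -> W n j x <= W n i x.
Proof.
have WS k y : W n k.+1 y <= W n k y.
  elim: k y => [|k IHk] y; first exact: W_le.
  rewrite /= le_min ge_min lexx/= ge_min; apply/orP; right.
  by rewrite lerD2l; apply: (semigroup_le y (W_Cb n k.+1) (W_Cb n k) (mesh_ge0 n)).
by move=> /subnK <-; elim: (j - i)%N => [//|l]; apply: le_trans; exact: WS.
Qed.

(** In Dynkin's formula for V j = W n (N - j) all the terms are nonnegative. *)
Lemma W_submartingale x n k N : grid_stop n k -> (forall om, (k om <= N)%N) ->
  W n N x <= expect (P x) (fun om => running_cost X f (grid n (k om)) om +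
                          W n (N - k om) (X (grid n (k om)) om)).
Proof.
move=> sk kN.
rewrite (@dynkin_formula x n k N (fun j => W n (N - j)))//; last first.
  by move=> j; exact: W_Cb.
rewrite subn0 lerDl big_nat_cond; apply: sumr_ge0 => j /andP[/andP[_ jN] _].
apply: expect_ge0 => om; rewrite mulr_ge0// subr_ge0 -(subnSK jN).
exact: W_step.
Qed.

(** Where W is below w the recursion is an equality, so all terms of Dynkin's
    formula vanish. *)
Lemma W_martingale x n k N : grid_stop n k -> (forall om, (k om <= N)%N) ->
  (forall om j, (j < k om)%N -> W n (N - j) (X (grid n j) om) < w (X (grid n j) om)) ->
  expect (P x) (fun om => running_cost X f (grid n (k om)) om +
                          W n (N - k om) (X (grid n (k om)) om)) = W n N x.
Proof.
move=> sk kN kW.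
rewrite (@dynkin_formula x n k N (fun j => W n (N - j)))//; last first.
  by move=> j; exact: W_Cb.
rewrite subn0 -[RHS]addr0; congr (_ + _).
rewrite big_nat_cond; apply: big1 => j /andP[/andP[_ jN] _].
rewrite -(expect_cst (P x) 0); apply: expect_ext => om.
rewrite indicE; have [jk|_] := boolP (om \in _); last by rewrite mul0r.
rewrite inE/= in jk; have := kW om j jk.
by rewrite -(subnSK jN) => /W_step_eq ->; rewrite subrr mulr0.
Qed.

(** The first time at which the grid problem with horizon N stops. The value of
    find is N when no index below N qualifies, and W n 0 = w there. *)
Definition grid_contact n N (om : Om) : nat :=
  find (fun j => w (X (grid n j) om) <= W n (N - j) (X (grid n j) om)) (iota 0 N).

Lemma grid_contact_le n N om : (grid_contact n N om <= N)%N.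
Proof. by rewrite -[leqRHS](size_iota 0) find_size. Qed.

Lemma grid_contact_before n N om j : (j < grid_contact n N om)%N ->
  W n (N - j) (X (grid n j) om) < w (X (grid n j) om).
Proof.
move=> jk; have jN : (j < N)%N by exact: leq_trans jk (grid_contact_le n N om).
by have := before_find 0%N jk; rewrite nth_iota// add0n leNgt => /negbFE.
Qed.

Lemma grid_contact_at n N om : w (X (grid n (grid_contact n N om)) om) <=
  W n (N - grid_contact n N om) (X (grid n (grid_contact n N om)) om).
Proof.
have [kN|] := ltnP (grid_contact n N om) N.
  have := @nth_find _ 0%N (fun j => w (X (grid n j) om) <= W n (N - j) (X (grid n j) om)) (iota 0 N).
  by rewrite has_find size_iota => /(_ kN); rewrite nth_iota.
move=> Nk; have -> : grid_contact n N om = N.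
  by apply/eqP; rewrite eqn_leq grid_contact_le.
by rewrite subnn.
Qed.

Lemma grid_contact_stop n N : grid_stop n (grid_contact n N).
Proof.
move=> j; have [Nj|jN] := leqP N j.
  rewrite (_ : [set _ | _] = setT); first by apply: filtration_setT; exact: grid_ge0.
  by apply/seteqP; split => // om _ /=; rewrite (leq_trans (grid_contact_le n N om)).
rewrite (_ : [set _ | _] = \bigcup_i (if (i <= j)%N then
    [set om | 0 <= W n (N - i) (X (grid n i) om) - w (X (grid n i) om)] else set0)).
  apply: filtration_bigcup; first exact: grid_ge0.
  move=> i; case: ifPn => ij; last by apply: filtration0; exact: grid_ge0.
  apply: (@filtrationW (grid n i)); [exact: grid_ge0|by rewrite ler_grid|].
  have cWw : continuous (fun y => W n (N - i) y - w y).
    by have [] := CbB (W_Cb n (N - i)) Cw.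
  have mB : measurable [set` `[(0:R), +oo[ ] by exact: measurable_itv.
  have := path_adapted cWw (grid_ge0 n i) mB.
  by congr (F _ _); apply/seteqP; split => om /=; rewrite in_itv/= andbT.
apply/seteqP; split => om /=.
  move=> kj; exists (grid_contact n N om) => //; rewrite kj /=.
  by rewrite subr_ge0; exact: grid_contact_at.
move=> [i _]; case: ifPn => //= ij; rewrite subr_ge0 => wW.
rewrite leqNgt; apply/negP => jk.
by have := grid_contact_before (leq_ltn_trans ij jk); rewrite ltNge wW.
Qed.

Lemma W_optimal x n N : W n N x =
  expect (P x) (payoff w (fun om => grid n (grid_contact n N om))).
Proof.
rewrite -(W_martingale x (grid_contact_stop n N) (grid_contact_le n N)); last first.
  by move=> om j; exact: grid_contact_before.
apply: expect_ext => om; rewrite /payoff; congr (_ + _).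
by apply/eqP; rewrite eq_le W_le grid_contact_at.
Qed.

Lemma W_lower x n N k : grid_stop n k -> (forall om, (k om <= N)%N) ->
  W n N x <= expect (P x) (payoff w (fun om => grid n (k om))).
Proof.
move=> sk kN; apply: le_trans (W_submartingale x sk kN) _.
have irc : summable_rv (P x) (fun om => running_cost X f (grid n (k om)) om).
  apply: (running_cost_summable (H := grid n N) (grid_stopping_time sk)).
  by move=> om; rewrite ler_grid.
apply: expect_le.
- apply: summableD => //; apply: (@grid_path_summable x n k N (fun j => W n (N - j))) => //.
  by move=> j _; exact: W_Cb.
- by apply: summableD => //; apply: (@grid_path_summable x n k N (fun=> w)).
- by move=> om; rewrite /payoff lerD2l W_le.
Qed.

Lemma grid_stop_refine n l k : grid_stop n k ->
  grid_stop (n + l) (fun om => (k om * 2 ^ l)%N).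
Proof.
move=> sk j; rewrite (_ : [set _ | _] = [set om | (k om <= j %/ 2 ^ l)%N]).
  apply: filtrationW (sk _); first exact: grid_ge0.
  by rewrite (grid_refine n l) ler_grid leq_divM.
by apply/seteqP; split => om /=; rewrite leq_divRL// expn_gt0.
Qed.

(** A grid time of level n is one of level n + l, so refining the grid lowers the
    optimal cost. *)
Lemma W_refine x n l N : W (n + l) (N * 2 ^ l) x <= W n N x.
Proof.
rewrite (W_optimal x n N).
have -> : (fun om => grid n (grid_contact n N om)) =
    (fun om => grid (n + l) (grid_contact n N om * 2 ^ l)) :> (Om -> R).
  by apply/funext => om; rewrite -grid_refine.
apply: W_lower; first by apply: grid_stop_refine; exact: grid_contact_stop.
by move=> om; rewrite leq_pmul2r ?expn_gt0// grid_contact_le.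
Qed.

(** * The value function *)

Lemma limf_einf_pinfty_le (G : R -> \bar R) (H : R) (c : \bar R) :
  (forall t, H <= t -> (G t <= c)%E) -> (limf_einf G (pinfty_nbhs R) <= c)%E.
Proof.
move=> Gc; rewrite limf_einfE; apply: ge_ereal_sup => _ [V [a [_ aV]] <-].
apply: (@le_trans _ _ (G (Num.max H (a + 1)))).
  apply: ereal_inf_lbound; exists (Num.max H (a + 1)) => //; apply: aV.
  by rewrite lt_max ltrDl ltr01 orbT.
by apply: Gc; rewrite le_max lexx.
Qed.

Lemma limf_einf_pinfty_ge (G : R -> \bar R) (H : R) (c : \bar R) :
  (forall t, H <= t -> (c <= G t)%E) -> (c <= limf_einf G (pinfty_nbhs R))%E.
Proof.
move=> Gc; rewrite limf_einfE; apply: (@le_trans _ _ (ereal_inf (G @` [set t | H < t]))).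
  by apply: le_ereal_inf_tmp => _ [t /= Ht <-]; apply: Gc; exact: ltW.
apply: ereal_sup_ubound; exists [set t | H < t] => //.
by exists H; split => //; exact: num_real.
Qed.

Definition truncate (tau : Om -> \bar R) t (om : Om) : R := fine (Order.min (tau om) t%:E).

Lemma truncateE tau t om : (0 <= tau om)%E -> 0 <= t ->
  ((truncate tau t om)%:E = Order.min (tau om) t%:E)%E.
Proof.
move=> tau0 t0; rewrite /truncate fineK// fin_numElt.
apply/andP; split; last by rewrite gt_min ltry orbT.
by rewrite lt_min ltNyr andbT (lt_le_trans _ tau0)// ltNyr.
Qed.

Lemma truncate_le tau t om : (0 <= tau om)%E -> 0 <= t -> truncate tau t om <= t.
Proof. by move=> tau0 t0; rewrite -lee_fin truncateE// ge_min lexx orbT. Qed.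

Lemma truncate_stopping tau t : stopping_time F tau -> 0 <= t ->
  real_stopping_time (truncate tau t).
Proof.
move=> [tau0 Ftau] t0; split=> [om|s s0].
  by rewrite -lee_fin truncateE// le_min tau0 lee_fin.
have [ts|st] := leP t s.
  rewrite (_ : [set _ | _] = setT); first exact: filtration_setT.
  by apply/seteqP; split => // om _ /=; rewrite (le_trans (truncate_le _ _)).
rewrite (_ : [set _ | _] = [set om | (tau om <= s%:E)%E]); first exact: Ftau.
by apply/seteqP; split => om /=; rewrite -lee_fin truncateE// ge_min lee_fin (leNgt t s) st orbF.
Qed.

Lemma Cb_stop_summable (g : E -> R) tau x : Cb g -> optional_time tau ->
  summable_rv (P x) (fun om => g (X (tau om) om)).
Proof. by move=> Cg otau; apply: bounded_summable; exact: optional_path_bounded. Qed.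

Lemma payoff_w_summable tau (H : R) x : real_stopping_time tau ->
  (forall om, tau om <= H) -> summable_rv (P x) (payoff w tau).
Proof.
move=> stau tauH; apply: payoff_summable tauH _ _ _ => //.
by apply: Cb_stop_summable => //; exact: stopping_optional.
Qed.

Lemma expected_cost_truncate tau t x : stopping_time F tau -> 0 <= t ->
  ('E_(P x)[fun om => cost X f w (Order.min (tau om) t%:E) om] =
  (expect (P x) (payoff w (truncate tau t)))%:E)%E.
Proof.
move=> stau t0; rewrite EFin_expect//.
apply: payoff_w_summable (truncate_stopping stau t0) _ => om.
by apply: truncate_le => //; case: stau.
Qed.

Definition evalue : E -> \bar R := value P X F f w.

Lemma value_le tau (H : R) x : real_stopping_time tau ->
  (forall om, tau om <= H) -> (evalue x <= (expect (P x) (payoff w tau))%:E)%E.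
Proof.
move=> stau tauH.
apply: (@le_trans _ _ (expected_cost (P x) (cost X f w) (fun om => (tau om)%:E))).
  by apply: ereal_inf_lbound; exists (fun om => (tau om)%:E) => //; exact: stopping_of_real.
apply: (@limf_einf_pinfty_le _ (Num.max 0 H)) => t; rewrite ge_max => /andP[t0 Ht].
rewrite (expected_cost_truncate x (stopping_of_real stau) t0).
rewrite lee_fin le_eqVlt; apply/orP; left; apply/eqP; apply: expect_ext => om.
rewrite /payoff; congr (running_cost _ _ _ _ + w (X _ _)).
  by rewrite /truncate min_l// lee_fin (le_trans (tauH om)).
by rewrite /truncate min_l// lee_fin (le_trans (tauH om)).
Qed.

Lemma value_ge x (c : R) : (forall tau (H : R), real_stopping_time tau ->
    (forall om, tau om <= H) -> c <= expect (P x) (payoff w tau)) ->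
  (c%:E <= evalue x)%E.
Proof.
move=> ctau; apply: le_ereal_inf_tmp => _ [tau stau <-].
apply: (@limf_einf_pinfty_ge _ 0) => t t0.
rewrite (expected_cost_truncate x stau t0).
rewrite lee_fin; apply: (ctau _ t); first exact: truncate_stopping.
by move=> om; apply: truncate_le => //; case: stau.
Qed.

Definition wq_lower_bound (C : R) : Prop := 0 <= C /\ forall y, - C <= w y - q y.

Lemma wq_lower_boundP : exists C, wq_lower_bound C.
Proof.
have [_ [M wM]] := Cw; exists (`|Kq| + M); split.
  by rewrite addr_ge0// (le_trans (normr_ge0 _) (wM point)).
move=> y; have := wM y; have := qK y; have := ler_norm Kq.
by rewrite ler_norml => ? ? /andP[? ?]; lra.
Qed.

Lemma payoff_ge tau (H : R) x C : wq_lower_bound C -> real_stopping_time tau ->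
  (forall om, tau om <= H) ->
  q x - C + m * expect (P x) tau <= expect (P x) (payoff w tau).
Proof.
move=> [C0 wqC] stau tauH.
have iw : summable_rv (P x) (fun om => w (X (tau om) om)).
  by apply: Cb_stop_summable => //; exact: stopping_optional.
have [iq _] := q_summable stau tauH x.
have it := tau_summable stau tauH x.
rewrite (payoff_rep stau tauH iw) -addrA lerD2l.
rewrite expectD; [|exact: summableZ|exact: summableB].
rewrite expectZ// addrC lerD2l; apply: expect_ge_cst; first exact: summableB.
by move=> om; exact: wqC.
Qed.

Lemma expect_stop_ge0 tau x : real_stopping_time tau -> 0 <= expect (P x) tau.
Proof. by move=> [tau0 _]; apply: expect_ge0. Qed.

Lemma value_fin x : evalue x \is a fin_num.
Proof.
have [C wqC] := wq_lower_boundP.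
rewrite fin_numElt; apply/andP; split.
  apply: (@lt_le_trans _ _ (q x - C)%:E); first exact: ltNyr.
  apply: value_ge => tau H stau tauH; apply: le_trans (payoff_ge x wqC stau tauH).
  by rewrite lerDl mulr_ge0 ?(ltW m0)// expect_stop_ge0.
apply: le_lt_trans (value_le x (real_stopping_cst (lexx 0)) (fun=> lexx 0)) _.
exact: ltry.
Qed.

Definition rvalue (x : E) : R := fine (evalue x).

Lemma rvalueE x : evalue x = (rvalue x)%:E. Proof. by rewrite fineK// value_fin. Qed.

Lemma rvalue_le tau (H : R) x : real_stopping_time tau ->
  (forall om, tau om <= H) -> rvalue x <= expect (P x) (payoff w tau).
Proof. by move=> stau tauH; rewrite -lee_fin -rvalueE; exact: value_le tauH. Qed.

Lemma rvalue_ge_q x C : wq_lower_bound C -> q x - C <= rvalue x.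
Proof.
move=> wqC; rewrite -lee_fin -rvalueE.
apply: value_ge => tau H stau tauH; apply: le_trans (payoff_ge x wqC stau tauH).
by rewrite lerDl mulr_ge0 ?(ltW m0)// expect_stop_ge0.
Qed.

Lemma payoff_cvg tau (H : R) x : real_stopping_time tau ->
  (forall om, tau om <= H) ->
  expect (P x) (payoff w (fun om => rd n (tau om))) @[n --> \oo] -->
  expect (P x) (payoff w tau).
Proof.
move=> stau tauH; have otau := stopping_optional stau; have [tau0 _] := stau.
have [cf [M fM]] := Cf; have [cw [Mw wM]] := Cw.
have M0 : 0 <= M by exact: le_trans (normr_ge0 _) (fM point).
have sn n := grid_stopping_time (grid_stop_up n otau).
have mesh1 n : @mesh R n <= 1.
  by rewrite /mesh invf_le1 ?exprn_gt0// exprn_ege1// ler1n.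
have rdH n om : rd n (tau om) <= H + 1.
  by rewrite (le_trans (rd_le n (tau0 om)))// lerD.
have [] // := @expect_dominated _ _ _ (P x) (fun n => payoff w (fun om => rd n (tau om)))
  (payoff w tau) (fun=> M * (H + 1) + Mw).
- by move=> n; apply: summable_measurable (payoff_w_summable x (sn n) (rdH n)).
- exact: summable_cst.
- move=> n om; rewrite /payoff (le_trans (ler_normD _ _))// lerD//.
  have r0 : 0 <= rd n (tau om) := grid_ge0 _ _.
  have := @running_cost_lipschitz f M cf fM (rd n (tau om)) 0 om r0 (lexx 0).
  rewrite running_cost0 !subr0 => lip; apply: le_trans lip _.
  by rewrite ger0_norm// ler_wpM2l.
- move=> om; apply: cvgD.
    apply: (running_cost_cvg cf fM) => //; last exact: rd_cvg.
    by move=> n; exact: grid_ge0.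
  by apply: continuous_cvg; [exact: cw|exact: optional_path_cvg].
Qed.

(** Rounding a bounded stopping time up to finer and finer grids changes its cost by
    an amount that tends to 0; here x is fixed. *)
Lemma rvalue_approx x eps : 0 < eps -> exists n k N, [/\ grid_stop n k,
  forall om, (k om <= N)%N &
  expect (P x) (payoff w (fun om => grid n (k om))) < rvalue x + eps].
Proof.
move=> eps0; apply: contrapT => nex.
have : ((rvalue x + eps)%:E <= evalue x)%E.
  apply: value_ge => tau H stau tauH.
  have cv := payoff_cvg (x := x) stau tauH.
  apply: (cvgr_to_ge cv); apply: nearW => n.
  rewrite leNgt; apply/negP => lt; apply: nex.
  exists n, (fun om => up n (tau om)), (up n (Num.max 0 H)); split => //.
    by apply: grid_stop_up; exact: stopping_optional.
  move=> om; have [tau0 _] := stau.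
  have H0 : 0 <= Num.max 0 H by rewrite le_max lexx.
  by rewrite up_le// (le_lt_trans _ (rd_gt n H0))// le_max tauH orbT.
by rewrite rvalueE lee_fin; lra.
Qed.

Lemma rvalue_le_w x : rvalue x <= w x.
Proof.
apply: le_trans (rvalue_le x (real_stopping_cst (lexx 0)) (fun=> lexx 0)) _.
rewrite (_ : expect _ _ = expect (P x) (fun om => w (X 0 om))).
  by rewrite -semigroupE semigroup0.
by apply: expect_ext => om; rewrite /payoff running_cost0 add0r.
Qed.

Lemma rvalue_le_W x n N : rvalue x <= W n N x.
Proof.
rewrite W_optimal; apply: (rvalue_le (H := grid n N)).
  by apply: grid_stopping_time; exact: grid_contact_stop.
by move=> om; rewrite ler_grid grid_contact_le.
Qed.

Lemma grid_stop_min n k (c : nat) : grid_stop n k -> grid_stop n (fun om => minn (k om) c).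
Proof.
move=> sk j; have [cj|jc] := leqP c j.
  rewrite (_ : [set _ | _] = setT); first by apply: filtration_setT; exact: grid_ge0.
  by apply/seteqP; split => // om _ /=; rewrite geq_min cj orbT.
rewrite (_ : [set _ | _] = [set om | (k om <= j)%N]); first exact: sk.
by apply/seteqP; split => om /=; rewrite geq_min (leqNgt c) jc orbF.
Qed.

Lemma grid_stop_round n l k : grid_stop (n + l) k ->
  grid_stop n (fun om => (k om %/ 2 ^ l).+1).
Proof.
move=> sk [|j].
  rewrite (_ : [set _ | _] = set0); first by apply: filtration0; exact: grid_ge0.
  by apply/seteqP; split.
rewrite (_ : [set _ | _] = [set om | (k om <= (j.+1 * 2 ^ l).-1)%N]).
  apply: filtrationW (sk _); first exact: grid_ge0.
  by rewrite (grid_refine n l) ler_grid leq_pred.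
apply/seteqP; split => om /=; rewrite ltn_divLR ?expn_gt0//.
  by case: (j.+1 * 2 ^ l)%N.
by move=> kj; rewrite (leq_ltn_trans kj)// prednK// muln_gt0 expn_gt0.
Qed.

(** Cutting at H only matters on the paths with k > H 2^n. There it saves the clock
    m H at least, and raises (w - q)(X) by at most a constant plus the negative
    part of q + A at time H. The constant is paid on an event of probability at
    most B / H, where B bounds the mean of a time whose cost is within 1 of the value; the
    negative part has a small mean at x, and near x by continuity. *)
Lemma cut_horizon x eps : 0 < eps -> exists2 H : nat, (0 < H)%N &
  \forall y \near x, forall n k N, grid_stop n k -> (forall om, (k om <= N)%N) ->
    expect (P y) (payoff w (fun om => grid n (k om))) <= rvalue y + 1 ->
    expect (P y) (payoff w (fun om => grid n (minn (k om) (H * 2 ^ n)))) <=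
    expect (P y) (payoff w (fun om => grid n (k om))) + eps.
Proof.
move=> eps0; have [C wqC] := wq_lower_boundP; have [C0 wqC'] := wqC.
have [_ [Mw wM]] := Cw.
have Mw0 : 0 <= Mw by exact: le_trans (normr_ge0 _) (wM point).
have e2 : 0 < eps / 2 by rewrite divr_gt0.
have e4 : 0 < eps / 4 by rewrite divr_gt0.
have [A AP] := excess_small x e4.
pose D : R := Num.max 0 (Mw + C + A).
have D0 : 0 <= D by rewrite le_max lexx.
pose B : R := Num.max 0 ((Mw + 2 - q x + C) / m).
have B0 : 0 <= B by rewrite le_max lexx.
(* large enough for D B / H <= eps / 2, by Markov's inequality *)
pose H := (Num.truncn (D * B / (eps / 2))).+1.
have DBH : D * B <= H%:R * (eps / 2).
  by rewrite -ler_pdivrMr// ltW// truncnS_gt.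
have H0 : 0 < H%:R :> R by [].
exists H => //.
have nearA : \forall y \near x, expect (P y) (fun om => excess A (X H%:R om)) < eps / 2.
  have lt : expect (P x) (fun om => excess A (X H%:R om)) < eps / 2.
    by apply: le_lt_trans (AP _ (ltW H0)) _; lra.
  have c := @expect_excess_continuous A H%:R (ltW H0) x.
  by have /cvgr_lt := c; exact.
have nearq : \forall y \near x, q x - 1 < q y.
  by have /cvgr_gt := @cq x; apply; rewrite gtrBl.
near=> y => n k N sk kN Ek.
have yA : expect (P y) (fun om => excess A (X H%:R om)) < eps / 2 by near: y.
have yq : q x - 1 < q y by near: y.
pose c := (H * 2 ^ n)%N.
have cH : grid n c = H%:R :> R by rewrite grid_int.
have stau := grid_stopping_time sk.
have tauN om : grid n (k om) <= grid n N :> R by rewrite ler_grid.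
have scut := grid_stopping_time (grid_stop_min c sk).
have cutN om : grid n (minn (k om) c) <= grid n N :> R.
  by rewrite ler_grid geq_min kN.
have Etau : expect (P y) (fun om => grid n (k om)) <= B.
  have := payoff_ge y wqC stau tauN.
  have := rvalue_le_w y; have := wM y; rewrite ler_norml => /andP[_ ?] ? ?.
  rewrite le_max; apply/orP; right; rewrite ler_pdivlMr// mulrC; lra.
have iw1 := Cb_stop_summable y Cw (stopping_optional stau).
have iw2 := Cb_stop_summable y Cw (stopping_optional scut).
have [iq1 _] := q_summable stau tauN y.
have [iq2 _] := q_summable scut cutN y.
have it1 := tau_summable stau tauN y.
have it2 := tau_summable scut cutN y.
have iA := excess_summable A y (ltW H0).
rewrite (payoff_rep stau tauN iw1) (payoff_rep scut cutN iw2) -addrA lerD2l.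
apply: (@le_trans _ _ (expect (P y) (fun om => m * grid n (k om) +
    (w (X (grid n (k om)) om) - q (X (grid n (k om)) om))) +
    expect (P y) (fun om => D / H%:R * grid n (k om) + excess A (X H%:R om)))).
  have i1 : summable_rv (P y) (fun om => m * grid n (k om) +
      (w (X (grid n (k om)) om) - q (X (grid n (k om)) om))).
    by apply: summableD; [exact: summableZ|exact: summableB].
  have i2 : summable_rv (P y)
      (fun om => D / H%:R * grid n (k om) + excess A (X H%:R om)).
    by apply: summableD => //; exact: summableZ.
  rewrite -expectD//; apply: expect_le.
  - by apply: summableD; [exact: summableZ|exact: summableB].
  - exact: summableD.
  move=> om; have exc0 := excess_ge0 A (X H%:R om).
  have [kc|ck] := leqP (k om) c.
    by rewrite lerDl addr_ge0// mulr_ge0 ?grid_ge0// divr_ge0// ltW.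
  rewrite cH.
  have t1 : m * H%:R <= m * grid n (k om).
    by rewrite ler_wpM2l ?(ltW m0)// -cH ler_grid ltnW.
  have t2 : D <= D / H%:R * grid n (k om).
    rewrite -mulrA ler_peMr// mulrC ler_pdivlMr// mul1r -cH.
    by rewrite ler_grid ltnW.
  have t3 : Mw + C + A <= D by rewrite le_max lexx orbT.
  have t4 := wqC' (X (grid n (k om)) om).
  have t5 : - q (X H%:R om) - A <= excess A (X H%:R om).
    rewrite excess_max opprD lerDl oppr_ge0 ge_min lexx//.
  have := wM (X H%:R om); rewrite ler_norml => /andP[_ t6].
  lra.
rewrite lerD2l expectD//; last exact: summableZ.
rewrite expectZ//.
have : D / H%:R * expect (P y) (fun om => grid n (k om)) <= eps / 2.
  apply: (@le_trans _ _ (D / H%:R * B)).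
    by rewrite ler_wpM2l// divr_ge0// ltW.
  by rewrite mulrAC ler_pdivrMr// (mulrC (eps / 2)).
lra.
Unshelve. all: by end_near. Qed.

(** Take a near-optimal grid time for y, of whatever level n, cut it at H and round
    it up to the fixed level n1. The level n depends on y, but n1 and H do
    not. *)
Lemma W_approx x eps : 0 < eps -> exists n N,
  \forall y \near x, W n N y <= rvalue y + eps.
Proof.
wlog eps1 : eps / eps <= 1.
  move=> wl eps0; have [e1|/ltW e1] := leP eps 1; first exact: wl.
  have [n [N nN]] := wl 1 (lexx _) ltr01; exists n, N.
  by apply: filterS nN => y; lra.
move=> eps0; have [cf [Mf fM]] := Cf.
have Mf0 : 0 <= Mf by exact: le_trans (normr_ge0 _) (fM point).
have e4 : 0 < eps / 4 by rewrite divr_gt0.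
have [H H0 nearH] := cut_horizon x e4.
have [n0 nearn0] := rounding_error x (ler0n R H) e4 Cw.
have [n1 n01 n1P] : exists2 n1, (n0 <= n1)%N & Mf * @mesh R n1 <= eps / 4.
  have c : Mf * @mesh R n @[n --> \oo] --> Mf * 0 by apply: cvgMl_tmp; exact: mesh_cvg.
  have /cvgr_lt /(_ (eps / 4)) := c; rewrite mulr0 => /(_ e4) [N _ NP].
  exists (maxn n0 N); first exact: leq_maxl.
  by apply: ltW; apply: NP; exact: leq_maxr.
(* one more than H * 2 ^ n1, as rounding up may pass H *)
exists n1, (H * 2 ^ n1).+1; apply: filterS2 nearH nearn0 => y yH yn0.
have [n [k [N [sk kN Ek]]]] := rvalue_approx y e4.
have Ek1 : expect (P y) (payoff w (fun om => grid n (k om))) <= rvalue y + 1.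
  by apply: le_trans (ltW Ek) _; lra.
have Ecut := yH n k N sk kN Ek1.
pose k1 om := minn (k om) (H * 2 ^ n).
have sk1 : grid_stop n k1 by exact: grid_stop_min.
pose k2 om := (k1 om * 2 ^ n1)%N.
have sk2 : grid_stop (n1 + n) k2 by rewrite addnC; exact: grid_stop_refine.
have k2E om : grid (n1 + n) (k2 om) = grid n (k1 om) :> R.
  by rewrite /k2 addnC -grid_refine.
have k1H om : grid n (k1 om) <= H%:R :> R.
  by rewrite -(grid_int n) ler_grid geq_minr.
have k2H om : grid (n1 + n) (k2 om) <= H%:R :> R by rewrite k2E.
pose k3 om := (k2 om %/ 2 ^ n).+1.
have sk3 : grid_stop n1 k3 by exact: grid_stop_round.
have k3N om : (k3 om <= (H * 2 ^ n1).+1)%N.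
  rewrite /k3 ltnS /k2 -(@mulnK (H * 2 ^ n1) (2 ^ n)) ?expn_gt0//.
  by rewrite leq_div2r// mulnAC leq_mul2r geq_minr orbT.
have W3 := W_lower y sk3 k3N.
apply: le_trans W3 _.
have s2 := grid_stopping_time sk2.
have s3 := grid_stopping_time sk3.
have b3 om : grid n1 (k3 om) <= grid n1 (H * 2 ^ n1).+1 :> R by rewrite ler_grid.
have rw := yn0 n1 n k2 n01 sk2 k2H.
have iw2 := Cb_stop_summable y Cw (stopping_optional s2).
have iw3 := Cb_stop_summable y Cw (stopping_optional s3).
have ir2 := running_cost_summable s2 k2H y.
have ir3 := running_cost_summable s3 b3 y.
have E3 : expect (P y) (payoff w (fun om => grid n1 (k3 om))) <=
    expect (P y) (payoff w (fun om => grid (n1 + n) (k2 om))) + (eps / 4 + eps / 4).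
  rewrite /payoff !expectD// addrACA lerD//.
  rewrite -[X in _ + X](expect_cst (P y)) -expectD//; last exact: summable_cst.
  apply: expect_le => //; first by apply: summableD => //; exact: summable_cst.
  move=> om; rewrite -lerBlDl (le_trans (ler_norm _))//.
  apply: le_trans (running_cost_lipschitz cf fM om (grid_ge0 _ _) (grid_ge0 _ _)) _.
  apply: le_trans n1P; rewrite ler_wpM2l//.
  by have /andP[r0 r1] := @round_up_bounds R n1 n (k2 om); rewrite ger0_norm.
have E2 : (fun om => grid (n1 + n) (k2 om)) = (fun om => grid n (k1 om)) :> (Om -> R).
  by apply/funext => om; rewrite k2E.
rewrite E2 in E3.
lra.
Qed.

(** Near x the continuous function W n N is within eps of the value function. *)
Lemma rvalue_continuous : continuous rvalue.
Proof.
move=> x; apply/cvgrPdist_le => eps eps0.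
have e3 : 0 < eps / 3 by rewrite divr_gt0.
have [n [N nearW]] := W_approx x e3.
have Wx := nbhs_singleton nearW.
have [cW _] := W_Cb n N.
have /cvgrPdist_lt /(_ _ e3) nearc := cW x.
apply: filterS2 nearW nearc => y Wy; rewrite distrC.
have := rvalue_le_W x n N; have := rvalue_le_W y n N.
rewrite ler_norml ltr_norml => zy zx /andP[? ?]; apply/andP; split; lra.
Qed.

(** The budget (L - c) 2^L is that of a problem with horizon L after a start at a
    time at most c; it eventually exceeds any N after refinement. *)
Lemma W_eventually x eps (c : nat) : 0 < eps -> exists L0,
  \forall y \near x, forall L, (L0 <= L)%N -> W L ((L - c) * 2 ^ L) y <= rvalue y + eps.
Proof.
move=> eps0; have [n [N nearW]] := W_approx x eps0.
exists (n + (N + c))%N; apply: filterS nearW => y Wy L L0L.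
have nL : (n <= L)%N by exact: leq_trans (leq_addr _ _) L0L.
have -> : L = (n + (L - n))%N by rewrite subnKC.
apply: le_trans Wy; apply: le_trans (W_refine y n (L - n) N).
apply: W_dec; rewrite subnKC//; apply: leq_mul; last first.
  by rewrite leq_exp2l// leq_subr.
by rewrite leq_subRL; [rewrite addnC; apply: leq_trans L0L; rewrite leq_addl|
  apply: leq_trans L0L; rewrite addnA leq_addl].
Qed.

Lemma rvalue_stop_summable tau (H : R) x : real_stopping_time tau ->
  (forall om, tau om <= H) -> summable_rv (P x) (fun om => rvalue (X (tau om) om)).
Proof.
move=> stau tauH; have [C wqC] := wq_lower_boundP.
have [_ [M wM]] := Cw.
have [iq _] := q_summable stau tauH x.
apply: (@summable_le _ _ _ _ _ (fun om => `|q (X (tau om) om)| + (`|C| + M))).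
- by apply: optional_path_measurable; [exact: rvalue_continuous|exact: stopping_optional].
- by apply: summableD; [exact: integrable_norm|exact: summable_cst].
move=> om; have := rvalue_ge_q (X (tau om) om) wqC; have := rvalue_le_w (X (tau om) om).
have := wM (X (tau om) om); have := ler_norm C.
have := ler_norm (- q (X (tau om) om)); rewrite normrN ler_norml.
have := normr_ge0 (q (X (tau om) om)); have := normr_ge0 C.
by move=> ? ? ? ? /andP[? ?] ? ?; rewrite ler_norml; apply/andP; split; lra.
Qed.

Lemma payoff_rvalue_summable tau (H : R) x : real_stopping_time tau ->
  (forall om, tau om <= H) -> summable_rv (P x) (payoff rvalue tau).
Proof.
move=> stau tauH; apply: (payoff_summable stau tauH).
exact: (rvalue_stop_summable x stau tauH).
Qed.

Lemma W_stop_summable n (k : Om -> nat) N x : grid_stop n k -> (forall om, (k om <= N)%N) ->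
  forall l j, summable_rv (P x) (fun om => W l j (X (grid n (k om)) om)).
Proof.
move=> sk kN l j; apply: (@grid_path_summable x n k N (fun=> W l j)) => // *.
exact: W_Cb.
Qed.

(** The submartingale inequality for W on finer and finer grids; at the time k the
    function W with remaining budget tends to the value function, and it lies
    between q - C and w. *)
Lemma rvalue_submartingale_grid x n k N : grid_stop n k -> (forall om, (k om <= N)%N) ->
  rvalue x <= expect (P x) (payoff rvalue (fun om => grid n (k om))).
Proof.
move=> sk kN; have [C wqC] := wq_lower_boundP; have [_ [M wM]] := Cw.
have stau := grid_stopping_time sk.
have tauN om : grid n (k om) <= grid n N :> R by rewrite ler_grid.
have irc := running_cost_summable stau tauN x.
have [iq _] := q_summable stau tauN x.
pose u l y := W (n + l) ((n + l - N) * 2 ^ (n + l)) y.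
have cvu y : u l y @[l --> \oo] --> rvalue y.
  apply/cvgrPdist_le => e e0; have [L0 nearL] := W_eventually y N e0.
  have yL := nbhs_singleton nearL.
  exists L0 => // l /= L0l; rewrite distrC ger0_norm ?subr_ge0 ?rvalue_le_W//.
  by rewrite lerBlDl yL// (leq_trans L0l)// leq_addl.
have iu l : summable_rv (P x) (fun om => u l (X (grid n (k om)) om)).
  exact: (W_stop_summable x sk kN).
have zru l : (N <= l)%N ->
    rvalue x <= expect (P x) (fun om => running_cost X f (grid n (k om)) om + u l (X (grid n (k om)) om)).
  move=> Nl; have Nnl : (N <= n + l)%N by exact: leq_trans Nl (leq_addl _ _).
  apply: (@le_trans _ _ (W (n + l) ((n + l) * 2 ^ (n + l)) x)); first exact: rvalue_le_W.
  have sk' := grid_stop_refine l sk.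
  have kN' om : (k om * 2 ^ l <= (n + l) * 2 ^ (n + l))%N.
    by rewrite leq_mul// ?leq_exp2l// ?leq_addl// (leq_trans (kN om)).
  apply: le_trans (W_submartingale x sk' kN') _.
  have iW : summable_rv (P x) (fun om => W (n + l) ((n + l) * 2 ^ (n + l) - k om * 2 ^ l)
      (X (grid (n + l) (k om * 2 ^ l)) om)).
    apply: (@grid_path_summable x (n + l) (fun om => k om * 2 ^ l)%N _
      (fun j => W (n + l) ((n + l) * 2 ^ (n + l) - j)) sk' kN') => j _.
    exact: W_Cb.
  apply: expect_le.
  - apply: summableD => //.
    by move: irc; congr (is_true (_.-integrable _ _)); apply/funext => om /=; rewrite -grid_refine.
  - exact: summableD.
  move=> om; rewrite -grid_refine lerD2l; apply: W_dec.
  by rewrite mulnBl leq_sub2l// leq_mul// leq_exp2l// leq_addl.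
pose Y_ l om := running_cost X f (grid n (k om)) om + u l (X (grid n (k om)) om).
pose Z om := `|running_cost X f (grid n (k om)) om| +
  (`|q (X (grid n (k om)) om)| + (`|C| + M)).
have mY l : measurable_fun setT (Y_ l).
  by apply: (@summable_measurable _ _ _ (P x)); exact: summableD.
have iZ : summable_rv (P x) Z.
  apply: summableD; first exact: integrable_norm.
  by apply: summableD; [exact: integrable_norm|exact: summable_cst].
have YZ l om : `|Y_ l om| <= Z om.
  rewrite (le_trans (ler_normD _ _))// lerD2l.
  set y := X _ _.
  have := rvalue_ge_q y wqC; have := rvalue_le_W y (n + l) ((n + l - N) * 2 ^ (n + l)).
  have := W_le (n + l) ((n + l - N) * 2 ^ (n + l)) y.
  have := wM y; have := ler_norm C.
  have := ler_norm (- q y); rewrite normrN ler_norml.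
  have := normr_ge0 (q y); have := normr_ge0 C; rewrite -/(u l y).
  by move=> ? ? ? ? /andP[? ?] ? ? ?; rewrite ler_norml; apply/andP; split; lra.
have cY om : Y_ l om @[l --> \oo] --> payoff rvalue (fun om => grid n (k om)) om.
  by apply: cvgD; [exact: cvg_cst|exact: cvu].
have [_ cvE] := expect_dominated mY iZ YZ cY.
by apply: (cvgr_to_ge cvE); exists N => // l /= Nl; exact: zru.
Qed.

(** Limit of the preceding inequality along grid times decreasing to tau. Only an
    upper bound of the payoff is available along them, from w, so Fatou's lemma
    is applied to the negatives. *)
Lemma rvalue_submartingale tau (H : R) x : real_stopping_time tau ->
  (forall om, tau om <= H) -> rvalue x <= expect (P x) (payoff rvalue tau).
Proof.
move=> stau tauH; have otau := stopping_optional stau; have [tau0 _] := stau.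
have [cf [M fM]] := Cf; have [_ [Mw wM]] := Cw.
have M0 : 0 <= M by exact: le_trans (normr_ge0 _) (fM point).
have sn n := grid_stop_up n otau.
have H0 : 0 <= H by exact: le_trans (tau0 point) (tauH point).
have upN n om : (up n (tau om) <= up n H)%N.
  by rewrite up_le// (le_lt_trans (tauH om))// rd_gt.
have mesh1 n : @mesh R n <= 1.
  by rewrite /mesh invf_le1 ?exprn_gt0// exprn_ege1// ler1n.
have rdN n om : rd n (tau om) <= rd n H by rewrite ler_grid upN.
have iz := payoff_rvalue_summable x stau tauH.
have izn n := payoff_rvalue_summable x (grid_stopping_time (sn n)) (rdN n).
rewrite -lerN2 -mulN1r -expectZ//.
apply: (@expect_fatou _ _ _ (P x) set0
  (fun n om => -1 * payoff rvalue (fun om => rd n (tau om)) om) _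
  (- (M * (H + 1) + Mw)) (fun=> - rvalue x)) => //.
- by move=> n; exact: (summableZ (-1) (izn n)).
- exact: (summableZ (-1) iz).
- move=> n om; rewrite mulN1r lerN2 /payoff lerD//.
    have r0 : 0 <= rd n (tau om) := grid_ge0 _ _.
    have := @running_cost_lipschitz f M cf fM (rd n (tau om)) 0 om r0 (lexx 0).
    rewrite running_cost0 !subr0 => lip.
    rewrite (le_trans (ler_norm _))// (le_trans lip)// ger0_norm// ler_wpM2l//.
    by rewrite (le_trans (rd_le n (tau0 om)))// lerD.
  apply: le_trans (rvalue_le_w _) _; exact: le_trans (ler_norm _) (wM _).
- move=> om _ eps eps0.
  have c : payoff rvalue (fun om => rd n (tau om)) om @[n --> \oo] --> payoff rvalue tau om.
    apply: cvgD.
      apply: (running_cost_cvg cf fM) => //; last exact: rd_cvg.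
      by move=> n; exact: grid_ge0.
    by apply: continuous_cvg; [exact: rvalue_continuous|exact: optional_path_cvg].
  have /cvgrPdist_le /(_ eps eps0) := c; apply: filterS => n.
  by rewrite ler_norml => /andP[? ?]; lra.
- move=> n; rewrite (expectZ (-1) (izn n)) mulN1r lerN2.
  exact: (rvalue_submartingale_grid x (sn n) (upN n)).
- exact: cvg_cst.
Qed.

(** * No loss up to the contact set *)

(** Each point of [0, c] has a neighbourhood of times whose positions are close to
    X_s or to the left limit at s; convergence of W to the value function is
    uniform near both, and [0, c] is compact. *)
Lemma W_path_uniform om eps (c : nat) : 0 < eps ->
  \forall n \near \oo, forall s, 0 <= s <= c%:R ->
    W n ((n - c) * 2 ^ n) (X s om) <= rvalue (X s om) + eps.
Proof.
move=> eps0.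
have good y : \forall y' \near y & n \near \oo,
    W n ((n - c) * 2 ^ n) y' <= rvalue y' + eps.
  have [L0 nL] := W_eventually y c eps0.
  exists ([set y' | forall L, (L0 <= L)%N -> W L ((L - c) * 2 ^ L) y' <= rvalue y' + eps],
    [set n | (L0 <= n)%N]) => /=; first by split => //; exists L0.
  by move=> [y' n] /= [h1 h2]; exact: h1.
have cI : compact [set` `[(0:R), c%:R]] by exact: segment_compact.
move/compact_near_coveringP/near_covering_withinP : (cI) => /(_ nat \oo
  (fun n s => W n ((n - c) * 2 ^ n) (X s om) <= rvalue (X s om) + eps)).
move=> /(_ _)-cov.
apply: filterS (cov _) => [n h s sc|s]; first by apply: h; rewrite /= in_itv.
rewrite /= in_itv/= => /andP[s0 _].
have [[A1 B1] /= [nA1 nB1] AB1] := good (X s om).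
have [[A2 B2] [/= nA2 nB2 AB2]] : exists AB : set R * set nat, [/\
    (\forall r \near s^'-, 0 <= r -> AB.1 r), (\forall n \near \oo, AB.2 n) &
    forall r n, AB.1 r -> AB.2 n -> W n ((n - c) * 2 ^ n) (X r om) <= rvalue (X r om) + eps].
  have [spos|s_le0] := ltP 0 s.
    have [l Xl] := fm_left_limits fm om spos.
    have [[A2 B2] /= [nA2 nB2] AB2] := good l.
    exists ([set r | A2 (X r om)], B2); split => //=.
      by have [d2 /= d20 hd2] := Xl _ nA2; exists d2 => //= r rd rs _; exact: hd2.
    by move=> r n a2 b2; exact: (AB2 (X r om, n)).
  exists (set0, setT); split => //=; last by apply: nearW.
  exists 1 => //= r _ rs r0.
  by have := le_lt_trans r0 rs; rewrite ltNge s_le0.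
have [d1 /= d10 hd1] := fm_right_continuous fm (om := om) s0 nA1.
have [d2 /= d20 hd2] := nA2.
exists ([set r | `|s - r| < Num.min d1 d2], B1 `&` B2) => /=.
  split; last exact: filterI.
  by exists (Num.min d1 d2) => //=; rewrite lt_min d10.
move=> [r n] /= [rd [b1 b2]]; rewrite in_itv/= => /andP[r0 rc].
move: rd; rewrite lt_min => /andP[rd1 rd2].
have [rs|sr|->] := ltgtP r s.
- by apply: AB2 => //; exact: hd2.
- by apply: (AB1 (X r om, n)); split => //=; exact: hd1.
- by apply: (AB1 (X s om, n)); split => //=; exact: nbhs_singleton nA1.
Qed.

Definition gap (y : E) : R := w y - rvalue y.

Lemma gap_ge0 y : 0 <= gap y. Proof. by rewrite subr_ge0 rvalue_le_w. Qed.

Lemma gap_continuous : continuous gap.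
Proof. by have [cw _] := Cw; move=> y; apply: cvgB; [exact: cw|exact: rvalue_continuous]. Qed.

Definition contact_time := hitting_time X [set y | gap y = 0].

Section before_contact.
Variables (x : E) (kappa : Om -> R) (H : R).
Hypotheses (skappa : real_stopping_time kappa) (kappaH : forall om, kappa om <= H).
Hypothesis kappa_tau : forall om, ((kappa om)%:E <= contact_time om)%E.

Let N n := (n * 2 ^ n)%N.
Let k n om := minn (grid_contact n (N n) om) (up n (kappa om)).
Let r n om : R := grid n (k n om).

Let sk n : grid_stop n (k n).
Proof.
move=> j; have := filtrationU (grid_ge0 n j) (grid_contact_stop n (N n) j)
  (grid_stop_up n (stopping_optional skappa) j).
congr (F _ _); apply/seteqP; split => om /=; rewrite /k geq_min.
  by move=> [->//|->]; rewrite orbT.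
by move=> /orP[]; [left|right].
Qed.

Let kN n om : (k n om <= N n)%N.
Proof. by rewrite geq_min grid_contact_le. Qed.

Let rN n om : r n om <= grid n (N n). Proof. by rewrite ler_grid kN. Qed.

Let Wk n om := W n (N n - k n om) (X (r n om) om).

Let Wk_summable n : summable_rv (P x) (Wk n).
Proof.
apply: (@grid_path_summable x n (k n) (N n) (fun j => W n (N n - j)) (sk n)) => //.
by move=> j _; exact: W_Cb.
Qed.

Let Y n om := m * r n om + (Wk n om - q (X (r n om) om)).

Let Y_summable n : summable_rv (P x) (Y n).
Proof.
have [iq _] := q_summable (grid_stopping_time (sk n)) (rN n) x.
apply: summableD; last exact: summableB.
by apply: summableZ; exact: tau_summable (grid_stopping_time (sk n)) (rN n) x.
Qed.

Let Y_expect n : expect (P x) (Y n) = W n (N n) x - q x.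
Proof.
have sr := grid_stopping_time (sk n).
have [iq rcE] := q_summable sr (rN n) x.
have ir := tau_summable sr (rN n) x.
have irc := running_cost_summable sr (rN n) x.
have := W_martingale x (sk n) (kN n); rewrite expectD//=; last exact: Wk_summable.
move=> <- => [|om j jk]; last first.
  by apply: grid_contact_before; apply: leq_trans jk _; rewrite geq_minl.
rewrite /Y expectD; [|exact: summableZ|exact: summableB].
rewrite expectZ// expectB// rcE.
by rewrite /Wk /r; ring.
Qed.

Let Y_ge C n om : wq_lower_bound C -> - C <= Y n om.
Proof.
move=> Cb_; have := rvalue_ge_q (X (r n om) om) Cb_.
have := rvalue_le_W (X (r n om) om) n (N n - k n om).
have : 0 <= m * r n om by rewrite mulr_ge0 ?(ltW m0)// grid_ge0.
rewrite /Y /Wk; lra.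
Qed.

Let G y := rvalue y - q y.

Let G_le n om : m * r n om + G (X (r n om) om) <= Y n om.
Proof.
have := rvalue_le_W (X (r n om) om) n (N n - k n om); rewrite /Y /Wk /G; lra.
Qed.

(** Stop the grid problem of level n at its own contact time or at kappa rounded up,
    whichever comes first: W is a martingale until then, so the mean of Y n is
    W n N x - q x, which tends to rvalue x - q x. Being bounded below, Y obeys
    Fatou's lemma. If the grid contact comes strictly before kappa, then w is
    close to the value function there, by uniform convergence along the path, and
    no_loss_before_hitting shows that the time and the value of G are close to
    those at kappa. *)
Lemma payoff_before_contact : expect (P x) (payoff rvalue kappa) <= rvalue x.
Proof.
have [C wqC] := wq_lower_boundP.
have cG : continuous G.
  by move=> y; apply: cvgB; [exact: rvalue_continuous|exact: cq].
have iz := rvalue_stop_summable x skappa kappaH.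
have [iq _] := q_summable skappa kappaH x.
have it := tau_summable skappa kappaH x.
have [kappa0 _] := skappa.
rewrite (payoff_rep skappa kappaH iz) -lerBrDl.
pose c := (Num.truncn H).+1.
have Hc : H <= c%:R by exact: ltW (truncnS_gt _).
have kc om : 0 <= kappa om <= c%:R by rewrite kappa0 (le_trans (kappaH om)).
have [B [mB B0] noloss] := no_loss_before_hitting gap_continuous gap_ge0 x (ler0n R c) cG.
apply: (@expect_fatou _ _ _ _ B Y _ (- C) (fun n => W n (N n) x - q x)) => //.
- apply: summableD; last exact: summableB.
  exact: summableZ.
- by move=> n om; exact: Y_ge.
- move=> om nB eps eps0.
  have m1 : 0 < m + 1 by rewrite addr_gt0.
  (* the error is m e from the clock and e from G *)
  pose e := eps / (m + 1).
  have e0 : 0 < e by rewrite divr_gt0.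
  have ee : m * e + e = eps by rewrite /e; field; rewrite gt_eqF.
  have [c1 c10 near_end] := noloss om nB _ _ (kc om) (kappa_tau om) e0.
  have c120 : 0 < c1 / 2 by rewrite divr_gt0.
  have Gk : G (X (rd n (kappa om)) om) @[n --> \oo] --> G (X (kappa om) om).
    by apply: (@cvg_comp _ _ _ _ G _ _ _ (optional_path_cvg (om := om) (stopping_optional skappa))); exact: cG.
  have /cvgrPdist_le/(_ e e0) Gke := Gk.
  near=> n; apply: le_trans (G_le n om).
  have Gn : `|G (X (kappa om) om) - G (X (rd n (kappa om)) om)| <= e by near: n.
  have Wn : forall s, 0 <= s <= c%:R ->
      W n ((n - c) * 2 ^ n) (X s om) <= rvalue (X s om) + c1 / 2.
    by near: n; exact: W_path_uniform.
  suff [h1 h2] : kappa om - e <= r n om /\ G (X (kappa om) om) - e <= G (X (r n om) om).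
    have : m * (kappa om - e) <= m * r n om by rewrite ler_pM2l.
    rewrite mulrBr /G in h2 *; move: h2 ee; rewrite /G; lra.
  have [kup|upk] := ltnP (k n om) (up n (kappa om)); last first.
    have -> : r n om = rd n (kappa om).
      rewrite /r /rd; congr grid; apply/eqP; rewrite eqn_leq upk andbT.
      by rewrite /k geq_minr.
    split; first by have := rd_ge n (kappa0 om); lra.
    by move: Gn; rewrite ler_norml; lra.
  have rk : r n om <= kappa om.
    by rewrite leNgt -up_le// -ltnNge.
  have [rlt|] := ltP (r n om) (kappa om); last first.
    move=> kr; have -> : r n om = kappa om by apply/eqP; rewrite eq_le rk.
    split; lra.
  have kfirst : k n om = grid_contact n (N n) om.
    by move: kup; rewrite /k gtn_min ltnn orbF => /ltnW /minn_idPl.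
  have rc : 0 <= r n om <= c%:R.
    by rewrite grid_ge0 (le_trans rk)//; have /andP[] := kc om.
  have gapn : gap (X (r n om) om) < c1.
    have kle : (k n om <= c * 2 ^ n)%N.
      by have /andP[_] := rc; rewrite -(grid_int n c) ler_grid.
    have wW := grid_contact_at n (N n) om; rewrite -kfirst in wW.
    have Wd : W n (N n - k n om) (X (r n om) om) <= W n ((n - c) * 2 ^ n) (X (r n om) om).
      by apply: W_dec; rewrite mulnBl leq_sub2l.
    have := Wn _ rc; rewrite /gap /r in wW Wd *; lra.
  have [h1 h2] := near_end _ (grid_ge0 _ _) rlt gapn.
  by split; [exact: ltW|move: h2; rewrite ler_norml; lra].
- by move=> n; rewrite Y_expect.
- apply: cvgB; last exact: cvg_cst.
  apply/cvgrPdist_le => e e0; have [L0 nL] := W_eventually x 0 e0.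
  exists L0 => // n /= Ln; have := nbhs_singleton nL n Ln; rewrite subn0.
  have := rvalue_le_W x n (N n); rewrite /N => h1 h2.
  by rewrite ler_norml; apply/andP; split; lra.
Unshelve. all: by end_near. Qed.

End before_contact.

(** * Optimality and dynamic programming *)

Lemma stopping_min tau sigma : stopping_time F tau -> stopping_time F sigma ->
  stopping_time F (fun om => Order.min (tau om) (sigma om)).
Proof.
move=> [tau0 Ftau] [sigma0 Fsigma]; split=> [om|t t0].
  by rewrite le_min tau0 sigma0.
have := filtrationU t0 (Ftau t t0) (Fsigma t t0).
congr (F _ _); apply/seteqP; split => om /=; rewrite ge_min.
  by move=> [->//|->]; rewrite orbT.
by move=> /orP.
Qed.

Section stopped_before.
Variables (tau sigma : Om -> \bar R).
Hypotheses (stau : stopping_time F tau) (ssigma : stopping_time F sigma).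

Let tau0 om : (0 <= tau om)%E. Proof. by case: stau. Qed.

Let sigma0 om : (0 <= sigma om)%E. Proof. by case: ssigma. Qed.

Definition until t : Om -> R :=
  truncate (fun om => Order.min (tau om) (sigma om)) t.

Definition stopped_early t : set Om := [set om | (Order.min (tau om) t%:E < sigma om)%E].

Let theta0 om : (0 <= Order.min (tau om) (sigma om))%E.
Proof. by rewrite le_min tau0 sigma0. Qed.

Lemma until_stopping t : 0 <= t -> real_stopping_time (until t).
Proof. by apply: truncate_stopping; exact: stopping_min. Qed.

Lemma until_le t om : 0 <= t -> until t om <= t.
Proof. by move=> t0; exact: truncate_le. Qed.

Lemma untilE t om : 0 <= t ->
  ((until t om)%:E = Order.min (Order.min (tau om) t%:E) (sigma om))%E.
Proof. by move=> t0; rewrite truncateE// minAC. Qed.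

Lemma stopped_early_measurable t : 0 <= t -> measurable (stopped_early t).
Proof.
move=> t0; have t10 : 0 <= t + 1 by rewrite addr_ge0.
have ms := optional_measurable (stopping_optional (truncate_stopping ssigma t10)).
have mu := optional_measurable (stopping_optional (until_stopping t0)).
have := measurable_fun_ltr mu ms; rewrite /measurable_fun => /(_ measurableT [set true]).
rewrite setTI => /(_ I); congr measurable; apply/seteqP; split => om /=.
  move=> ut; rewrite /stopped_early/= ltNge; apply/negP => st.
  have um := untilE om t0; rewrite min_r// in um.
  move: ut; rewrite -lte_fin um truncateE//.
  by rewrite lt_min ltxx.
rewrite /stopped_early/= => ts; have um := untilE om t0; rewrite (min_l (ltW ts)) in um.
rewrite -lte_fin um truncateE// lt_min ts/=.
by rewrite gt_min lte_fin ltrDl ltr01 orbT.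
Qed.

Lemma cost_untilE t om : 0 <= t ->
  cost_until X f w rvalue sigma (Order.min (tau om) t%:E) om =
  payoff rvalue (until t) om + \1_(stopped_early t) om * gap (X (until t om) om).
Proof.
move=> t0; rewrite /cost_until /payoff -untilE//= -addrA; congr (_ + _).
have [early|late] := ltP (Order.min (tau om) t%:E) (sigma om).
  rewrite indicE mem_set//= mul1r /gap addrC subrK.
  by congr (w (X _ _)); rewrite -(min_l (ltW early)) -untilE.
rewrite indicE memNset/= ?mul0r ?addr0; last by rewrite /stopped_early/= ltNge late.
by congr (rvalue (X _ _)); rewrite -(min_r late) -untilE.
Qed.

Lemma gap_until_summable t x : 0 <= t ->
  summable_rv (P x) (fun om => gap (X (until t om) om)).
Proof.
move=> t0; have su := until_stopping t0; apply: summableB.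
  exact: (Cb_stop_summable x Cw (stopping_optional su)).
exact: (rvalue_stop_summable x su (fun om => until_le om t0)).
Qed.

(** The cost differs from the payoff with final reward rvalue only when tau /\ t
    comes before sigma, by the gap between w and rvalue. *)
Lemma cost_until_expect t x : 0 <= t ->
  ('E_(P x)[fun om => cost_until X f w rvalue sigma (Order.min (tau om) t%:E) om])%E =
  (expect (P x) (payoff rvalue (until t)) +
   expect (P x) (fun om => \1_(stopped_early t) om * gap (X (until t om) om)))%:E.
Proof.
move=> t0.
have ip := payoff_rvalue_summable x (until_stopping t0) (fun om => until_le om t0).
have ig := summable_indicM (stopped_early_measurable t0) (gap_until_summable x t0).
rewrite -expectD//; under eq_fun do rewrite (cost_untilE _ t0).
rewrite -EFin_expect//; exact: summableD.
Qed.

Lemma cost_until_ge x :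
  ((rvalue x)%:E <= expected_cost (P x) (cost_until X f w rvalue sigma) tau)%E.
Proof.
apply: (@limf_einf_pinfty_ge _ 0) => t t0; rewrite (cost_until_expect x t0) lee_fin.
rewrite -[leLHS]addr0 lerD//.
  exact: (rvalue_submartingale x (until_stopping t0) (fun om => until_le om t0)).
by apply: expect_ge0 => om; rewrite mulr_ge0 ?gap_ge0.
Qed.

End stopped_before.

Lemma contact_stopping : stopping_time F contact_time.
Proof. exact: hitting_stopping gap_continuous gap_ge0. Qed.

Section contact_cost.
Variables (sigma : Om -> \bar R) (x : E).
Hypothesis ssigma : stopping_time F sigma.
Local Notation theta := (until contact_time sigma).

Let theta_stop t : 0 <= t -> real_stopping_time (theta t).
Proof. by move=> t0; exact: (until_stopping contact_stopping ssigma). Qed.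

Let theta_le t om : 0 <= t -> theta t om <= t.
Proof. by move=> t0; exact: (until_le contact_stopping ssigma). Qed.

Let theta_contact t om : 0 <= t -> ((theta t om)%:E <= contact_time om)%E.
Proof. by move=> t0; rewrite (untilE contact_stopping ssigma)// !ge_min lexx. Qed.

Let payoff_theta t : 0 <= t -> expect (P x) (payoff rvalue (theta t)) <= rvalue x.
Proof.
move=> t0; apply: (payoff_before_contact x (theta_stop t0)) => om.
  exact: theta_le.
exact: theta_contact.
Qed.

Let running t : set Om := [set om | (t%:E < Order.min (contact_time om) (sigma om))%E].

Let running_measurable t : 0 <= t -> measurable (running t).
Proof.
move=> t0; have [_ Fm] := stopping_min contact_stopping ssigma.
have := filtration_measurable t0 (filtrationC t0 (Fm t t0)).
congr measurable; apply/seteqP; split => om /=; rewrite /running/= ltNge.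
  by move/negP.
by move/negP.
Qed.

(** At the contact time the gap is zero, so it is only paid on the paths that are
    still running at time t. *)
Let early_gap t om : 0 <= t ->
  \1_(stopped_early contact_time sigma t) om * gap (X (theta t om) om) =
  \1_(running t) om * gap (X t om).
Proof.
move=> t0; have tE := untilE contact_stopping ssigma om t0.
have [run|nrun] := pselect (running t om).
  have := run; rewrite /running/= lt_min => /andP[tc ts].
  have tt : theta t om = t.
    by apply/EFin_inj; rewrite tE (min_r (ltW tc)) min_l// ltW.
  rewrite tt !indicE !mem_set//.
  by rewrite /stopped_early/= (min_r (ltW tc)).
rewrite [in RHS]indicE memNset// mul0r.
have [early|late] := pselect (stopped_early contact_time sigma t om); last first.
  by rewrite indicE memNset// mul0r.
have ct : (contact_time om <= t%:E)%E.
  rewrite leNgt; apply/negP => tc; apply: nrun; rewrite /running/= lt_min tc/=.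
  by move: early; rewrite /stopped_early/= (min_r (ltW tc)).
have [s [s0 cs gs]] := hitting_attained gap_continuous gap_ge0 (le_lt_trans ct (ltry _)).
have -> : theta t om = s.
  apply/EFin_inj; rewrite tE (min_l ct) -cs min_l//.
  by move: early; rewrite /stopped_early/= (min_l ct) => /ltW.
by rewrite gs mulr0.
Qed.

(** Up to until t the clock m t is paid for by payoff_before_contact, since
    rvalue - q is bounded below: the probability of still running at t is of
    order 1 / t. *)
Let running_small C t : wq_lower_bound C -> 0 <= t ->
  t * expect (P x) (\1_(running t)) <= (rvalue x - q x + C) / m.
Proof.
move=> wqC t0; have st := theta_stop t0.
have tl om := theta_le om t0.
have iz := rvalue_stop_summable x st tl.
have [iq _] := q_summable st tl x.
have it := tau_summable st tl x.
have irun : summable_rv (P x) (\1_(running t)).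
  by apply: bounded_summable; apply: bounded_rv_indic; exact: running_measurable.
rewrite -(expectZ t irun) ler_pdivlMr// mulrC.
apply: (@le_trans _ _ (m * expect (P x) (theta t))).
  rewrite ler_pM2l//; apply: expect_le => //; first exact: summableZ.
  move=> om; have [run|nrun] := pselect (running t om).
    rewrite indicE mem_set// mulr1 -lee_fin (untilE contact_stopping ssigma)//.
    have := run; rewrite /running/= lt_min => /andP[tc ts].
    by rewrite (min_r (ltW tc)) min_l// ltW.
  by rewrite indicE memNset// mulr0; have [+ _] := st; exact.
have := payoff_theta t0; rewrite (payoff_rep st tl iz).
have : expect (P x) (fun om => m * theta t om + - C) <=
    expect (P x) (fun om => m * theta t om + (rvalue (X (theta t om) om) - q (X (theta t om) om))).
  apply: expect_le.
  - by apply: summableD; [exact: summableZ|exact: summable_cst].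
  - by apply: summableD; [exact: summableZ|exact: summableB].
  - move=> om; rewrite lerD2l; have := rvalue_ge_q (X (theta t om) om) wqC; lra.
rewrite expectD; [|exact: summableZ|exact: summable_cst].
rewrite expectZ// expect_cst; lra.
Qed.

(** The gap is at most K + excess A: the constant is paid with probability of order
    1 / t, and excess A has mean at most e / 2 at all times. *)
Lemma cost_until_contact_le :
  (expected_cost (P x) (cost_until X f w rvalue sigma) contact_time <= (rvalue x)%:E)%E.
Proof.
apply/lee_addgt0Pr => e e0.
have [C wqC] := wq_lower_boundP; have [_ [M wM]] := Cw.
have e20 : 0 < e / 2 by rewrite divr_gt0.
have [A exA] := excess_small x e20.
pose K := `|M + C + A| + 1.
have K0 : 0 < K by rewrite ltr_wpDl.
pose V := `|rvalue x - q x + C| / m.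
have V0 : 0 <= V by rewrite divr_ge0// ltW.
(* from this time on K V / t <= e / 2 *)
pose t1 := K * V * 2 / e + 1.
have t10 : 0 < t1 by rewrite ltr_wpDl// divr_ge0 ?(ltW e0)// mulr_ge0// mulr_ge0// (ltW K0).
rewrite -EFinD; apply: (@limf_einf_pinfty_le _ t1) => t tt.
have tpos : 0 < t by exact: lt_le_trans tt.
have t0 := ltW tpos.
rewrite (cost_until_expect contact_stopping ssigma x t0) lee_fin.
apply: lerD; first exact: payoff_theta.
rewrite (expect_ext _ (fun om => early_gap om t0)).
have irun : summable_rv (P x) (\1_(running t)).
  by apply: bounded_summable; apply: bounded_rv_indic; exact: running_measurable.
have iex := excess_summable A x t0.
have igap : summable_rv (P x) (fun om => gap (X t om)).
  apply: summableB; first exact: path_summable.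
  exact: (rvalue_stop_summable x (real_stopping_cst t0) (fun=> lexx t)).
apply: (@le_trans _ _ (expect (P x) (fun om => K * \1_(running t) om + excess A (X t om)))).
  apply: expect_le.
  - by apply: summable_indicM => //; exact: running_measurable.
  - by apply: summableD => //; exact: summableZ.
  - move=> om; have e0' := excess_ge0 A (X t om).
    have [run|nrun] := pselect (running t om); last first.
      by rewrite indicE memNset//= mul0r mulr0 add0r.
    rewrite indicE mem_set//= mul1r mulr1.
    have := rvalue_ge_q (X t om) wqC; have := wM (X t om).
    have : - (q (X t om) + A) <= excess A (X t om).
      by rewrite /excess lerN2 ge_min lexx orbT.
    have := ler_norm (M + C + A); rewrite /gap /K ler_norml.
    by move=> ? ? /andP[? ?] ?; lra.
rewrite expectD//; last exact: summableZ.
rewrite expectZ//; apply: (@le_trans _ _ (e / 2 + e / 2)); last by rewrite -splitr.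
apply: lerD; last exact: exA.
have small := running_small wqC t0.
have smallV : t * expect (P x) (\1_(running t)) <= V.
  by apply: le_trans small _; rewrite ler_pM2r ?invr_gt0// ler_norm.
rewrite -(ler_pM2l tpos) mulrCA.
apply: (@le_trans _ _ (K * V)); first by rewrite ler_pM2l.
apply: (@le_trans _ _ (t1 * (e / 2))); last by rewrite ler_pM2r.
have -> : t1 * (e / 2) = K * V + e / 2 by rewrite /t1; field; rewrite gt_eqF.
by rewrite lerDl ltW.
Qed.

End contact_cost.

Lemma dynamic_programming sigma x : stopping_time F sigma ->
  (rvalue x)%:E = inf_expected_cost F (P x) (cost_until X f w rvalue sigma).
Proof.
move=> ssigma; apply/eqP; rewrite eq_le; apply/andP; split.
  by apply: le_ereal_inf_tmp => _ [tau stau <-]; exact: cost_until_ge.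
apply: le_trans (cost_until_contact_le x ssigma).
by apply: ereal_inf_lbound; exists contact_time => //; exact: contact_stopping.
Qed.

Lemma never_stopping : stopping_time F (fun=> +oo%E : \bar R).
Proof.
split=> [om|t t0]; first exact: leey.
rewrite (_ : [set _ | _] = set0); first exact: filtration0.
by apply/seteqP; split => om //=; rewrite leye_eq.
Qed.

Lemma contact_optimal x :
  expected_cost (P x) (cost X f w) contact_time = evalue x.
Proof.
apply/eqP; rewrite eq_le; apply/andP; split; last first.
  by apply: ereal_inf_lbound; exists contact_time => //; exact: contact_stopping.
rewrite rvalueE; apply: le_trans (cost_until_contact_le x never_stopping).
rewrite le_eqVlt; apply/orP; left; apply/eqP; congr limf_einf.
apply/funext => t; congr (expectation (P x)); apply/funext => om.
have fin : (Order.min (contact_time om) t%:E < +oo)%E by rewrite gt_min ltry orbT.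
by rewrite /cost_until /cost (min_l (y := +oo%E)) ?leey// fin.
Qed.

Lemma contact_timeE : contact_time = hitting_time X [set y | ((w y)%:E <= evalue y)%E].
Proof.
congr hitting_time; apply/seteqP; split => y /=; rewrite rvalueE lee_fin /gap.
  by move/eqP; rewrite subr_eq0 => /eqP ->.
by move=> wz; apply/eqP; rewrite subr_eq0 eq_le wz rvalue_le_w.
Qed.

End stopping_problem.
End feller_process.
Unset Implicit Arguments.

Theorem theorem4p3 (R : realType) (d : measure_display) (Om : measurableType d)
    (E : pmetricType R) (P : E -> probability Om R) (X : R -> Om -> E)
    (F : R -> set (set Om)) (f w : E -> R) (mu : probability (borel E) R) :
  locally_compact [set: E] ->
  feller_markov P X F ->
  bounded_continuous f ->
  bounded_continuous w ->
  assumption_A1 P X F f mu ->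
  0 < mean mu f ->
  let z : E -> \bar R := value P X F f w in
  let tau_star : Om -> \bar R :=
    hitting_time X [set y | ((w y)%:E <= z y)%E] in
  [/\ (forall x, z x \is a fin_num) /\ continuous (fun x => fine (z x)),
      stopping_time F tau_star /\
      (forall x, expected_cost (P x) (cost X f w) tau_star = z x) &
      forall (sigma : Om -> \bar R), stopping_time F sigma -> forall x : E,
        z x = inf_expected_cost F (P x)
                (cost_until X f w (fun y => fine (z y)) sigma)].
Proof.
move=> lcE fm bf bw A1 m0 z tau_star.
have Cf := Cb_bounded_continuous bf; have Cw := Cb_bounded_continuous bw.
have [q [cq q_rep [Kq qK] q_ui]] := A1_potential A1.
have tauE : contact_time P X F f w = tau_star.
  exact: (contact_timeE fm Cf Cw m0 cq qK q_rep).
split.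
- split=> [x|]; first exact: (value_fin fm Cf Cw m0 cq qK q_rep).
  exact: (rvalue_continuous fm lcE Cf Cw m0 cq qK q_rep q_ui).
- rewrite -tauE; split.
    exact: (contact_stopping fm lcE Cf Cw m0 cq qK q_rep q_ui).
  exact: (contact_optimal fm lcE Cf Cw m0 cq qK q_rep q_ui).
- move=> sigma ssigma x; rewrite /z.
  rewrite -(dynamic_programming fm lcE Cf Cw m0 cq qK q_rep q_ui x ssigma).
  exact: (rvalueE fm Cf Cw m0 cq qK q_rep).
Qed.
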